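(* Let $\mathcal F$ be a field with $\mathrm{char}(\mathcal F)\neq 2,3$. Let $\mathcal V$ be the variety of (not necessarily associative) $\mathcal F$-algebras defined by the identities $$(x,y,y)=0,\qquad (xy)(zt)=0,\qquad (x\circ y)\circ z=0,\qquad [(x,yz,x),t]=0,$$ and let $\mathrm{Var}\,\tilde{\mathrm G}_2(\mathcal V)$ be the variety generated by the Grassmann $\mathcal V$-algebra $\tilde{\mathrm G}_2(\mathcal V)$ of rank $2$. Then $\mathrm{Var}\,\tilde{\mathrm G}_2(\mathcal V)$ is a non-finitely based subvariety of $\mathcal V$, and it is distinguished in $\mathcal V$ by the infinite system of identities $$\Bigl(x,\bigl(y_1,\ldots,(y_{n-1},(y_n,x,y_n),y_{n+1}),\ldots,y_{2n-1}\bigr),x\Bigr)=0,\qquad n=1,2,\ldots$$ (that is, it consists exactly of the algebras of $\mathcal V$ satisfying all these identities). Moreover, $\mathrm{Var}\,\tilde{\mathrm G}_2(\mathcal V)$ can be generated by the Grassmann envelope of a five-dimensional superalgebra over $\mathcal F$ that is generated by two odd elements and has one-dimensional even part.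
   Context: All algebras are over $\mathcal F$ and not assumed associative or unital. $(a,b,c)=(ab)c-a(bc)$, $a\circ b=ab+ba$, $[a,b]=ab-ba$. In the identity with index $n$, one starts with $p_1=(y_n,x,y_n)$, puts $p_{k+1}=(y_{n-k},p_k,y_{n+k})$ for $k=1,\dots,n-1$, and the identity is $(x,p_n,x)=0$; for $n=1$ it is $(x,(y_1,x,y_1),x)=0$. A variety is non-finitely based if it cannot be defined by a finite set of identities. A superalgebra is a $\mathbb Z_2$-graded algebra $\mathcal A=\mathcal A_0\oplus\mathcal A_1$, $\mathcal A_i\mathcal A_j\subseteq \mathcal A_{i+j \pmod 2}$, with even part $\mathcal A_0$ and odd part $\mathcal A_1$. $\mathrm G=\mathrm G_0\oplus \mathrm G_1$ is the (associative) Grassmann algebra on a countable set of anticommuting generators $e_1,e_2,\dots$ ($e_ie_j=-e_je_i$), where $\mathrm G_0$ and $\mathrm G_1$ are spanned by the words of even and odd length in the $e_i$. The Grassmann envelope of $\mathcal A$ is the subalgebra $\mathrm G(\mathcal A)=\mathrm G_0\otimes\mathcal A_0+\mathrm G_1\otimes\mathcal A_1$ of $\mathrm G\otimes\mathcal A$. $\mathcal A$ is a $\mathcal V$-superalgebra if $\mathrm G(\mathcal A)\in\mathcal V$. Grassmann $\mathcal V$-algebra of rank $r$: let $\mathcal F^{(s)}_{\mathcal V}[U]$ be the free $\mathcal V$-superalgebra on a set $U=\{u_1,\dots,u_r\}$ of free odd generators. Put $u_{ij}=u_i\otimes e_{i+rj}$ for $i=1,\dots,r$, $j=0,1,2,\dots$.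 Then $\tilde{\mathrm G}_r(\mathcal V)$ is the subalgebra of $\mathrm G\bigl(\mathcal F^{(s)}_{\mathcal V}[U]\bigr)$ generated by all the $u_{ij}$. *)

(* Defs.v *)
From HB Require Import structures.
From mathcomp Require Import all_boot all_order all_algebra.
From mathcomp Require Import finmap generic_quotient.
From mathcomp Require Import boolp functions.

Set Implicit Arguments.
Unset Strict Implicit.
Unset Printing Implicit Defensive.

Import GRing.Theory.
Local Open Scope ring_scope.
Local Open Scope quotient_scope.

HB.mixin Record Lmodule_isNAAlgebra (F : fieldType) A of GRing.Lmodule F A := {
  namul : A -> A -> A;
  namulDl : forall x y z, namul (x + y) z = namul x z + namul y z;
  namulDr : forall x y z, namul x (y + z) = namul x y + namul x z;
  namulZl : forall k x y, namul (k *: x) y = k *: namul x y;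
  namulZr : forall k x y, namul x (k *: y) = k *: namul x y
}.

#[short(type="naAlgType")]
HB.structure Definition NAAlgebra (F : fieldType) :=
  { A of GRing.Lmodule F A & Lmodule_isNAAlgebra F A }.

Notation "x ** y" := (namul x y) (at level 40, left associativity) : ring_scope.

(* Z_2-graded algebras: [homog false] is the even part, [homog true] the odd
   part, and the underlying module is their direct sum. *)
HB.mixin Record NAAlgebra_isSuperAlgebra (F : fieldType) A
    of NAAlgebra F A := {
  homog : bool -> A -> Prop;
  homog0 : forall b, homog b 0;
  homogL : forall b k x y, homog b x -> homog b y -> homog b (k *: x + y);
  homog_add : forall x,
    exists y z, [/\ homog false y, homog true z & x = y + z];
  homog_cap : forall x, homog false x -> homog true x -> x = 0;
  homogM : forall b c x y, homog b x -> homog c y -> homog (b (+) c) (x ** y)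
}.

#[short(type="superAlgType")]
HB.structure Definition SuperAlgebra (F : fieldType) :=
  { A of NAAlgebra F A & NAAlgebra_isSuperAlgebra F A }.

Section NAAlgebraTheory.
Variables (F : fieldType) (A : naAlgType F).
Implicit Types x y : A.

Lemma namul0r y : 0 ** y = 0 :> A.
Proof. by apply: (addrI (0 ** y)); rewrite -namulDl !addr0. Qed.

Lemma namulr0 x : x ** 0 = 0 :> A.
Proof. by apply: (addrI (x ** 0)); rewrite -namulDr !addr0. Qed.

End NAAlgebraTheory.

Section Subalgebras.
Variables (F : fieldType) (A : naAlgType F).

Record subalg := Subalg {
  subalg_pred :> A -> Prop;
  subalg0 : subalg_pred 0;
  subalgL : forall k x y,
    subalg_pred x -> subalg_pred y -> subalg_pred (k *: x + y);
  subalgM : forall x y, subalg_pred x -> subalg_pred y -> subalg_pred (x ** y)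
}.

Definition subalg_mem (B : subalg) : pred A := fun x => `[< B x >].

Record subalg_sort (B : subalg) :=
  SubalgElt { subalg_val : A; subalg_valP : subalg_mem B subalg_val }.

HB.instance Definition _ (B : subalg) := [isSub for @subalg_val B].
HB.instance Definition _ (B : subalg) := [Choice of subalg_sort B by <:].

Lemma subalg_mem_closed (B : subalg) : submod_closed (subalg_mem B).
Proof.
split; first by apply/asboolP; exact: subalg0.
move=> k x y; rewrite /in_mem /= /subalg_mem => /asboolP Bx /asboolP By.
by apply/asboolP; exact: subalgL.
Qed.

HB.instance Definition _ (B : subalg) :=
  GRing.SubChoice_isSubLmodule.Build F A (subalg_mem B) (subalg_sort B)
    (subalg_mem_closed B).

Lemma subalg_mem_mul (B : subalg) (x y : subalg_sort B) :
  subalg_mem B (subalg_val x ** subalg_val y).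
Proof.
by apply/asboolP; apply: subalgM; apply/asboolP; exact: subalg_valP.
Qed.

Definition subalg_mul (B : subalg) (x y : subalg_sort B) : subalg_sort B :=
  SubalgElt (subalg_mem_mul x y).

Lemma subalg_mulDl B (x y z : subalg_sort B) :
  subalg_mul (x + y) z = subalg_mul x z + subalg_mul y z.
Proof. by apply: val_inj; rewrite GRing.valD /= -namulDl -GRing.valD. Qed.

Lemma subalg_mulDr B (x y z : subalg_sort B) :
  subalg_mul x (y + z) = subalg_mul x y + subalg_mul x z.
Proof. by apply: val_inj; rewrite GRing.valD /= -namulDr -GRing.valD. Qed.

Lemma subalg_mulZl B k (x y : subalg_sort B) :
  subalg_mul (k *: x) y = k *: subalg_mul x y.
Proof. by apply: val_inj; rewrite GRing.valZ /= -namulZl -GRing.valZ. Qed.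

Lemma subalg_mulZr B k (x y : subalg_sort B) :
  subalg_mul x (k *: y) = k *: subalg_mul x y.
Proof. by apply: val_inj; rewrite GRing.valZ /= -namulZr -GRing.valZ. Qed.

HB.instance Definition _ (B : subalg) :=
  Lmodule_isNAAlgebra.Build F (subalg_sort B) (@subalg_mulDl B)
    (@subalg_mulDr B) (@subalg_mulZl B) (@subalg_mulZr B).

Inductive generated (S : A -> Prop) : A -> Prop :=
  | Gen_in x : S x -> generated S x
  | Gen_0 : generated S 0
  | Gen_lin k x y :
      generated S x -> generated S y -> generated S (k *: x + y)
  | Gen_mul x y : generated S x -> generated S y -> generated S (x ** y).

Definition generated_subalg (S : A -> Prop) : subalg :=
  Subalg (@Gen_0 S) (@Gen_lin S) (@Gen_mul S).

Definition has_dim (P : A -> Prop) (n : nat) : Prop :=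
  exists b : 'I_n -> A, (forall i, P (b i)) /\
    forall x, P x -> exists! c : {ffun 'I_n -> F}, x = \sum_i c i *: b i.

End Subalgebras.

(* Expressions for nonassociative polynomials; distinct expressions may denote
   the same element of the free algebra on X. *)
Inductive npoly (F X : Type) :=
  | NVar of X
  | NZero
  | NAdd of npoly F X & npoly F X
  | NScale of F & npoly F X
  | NMul of npoly F X & npoly F X.
Arguments NVar {F X}.
Arguments NZero {F X}.

Fixpoint neval (F : fieldType) (X : Type) (A : naAlgType F) (a : X -> A)
    (t : npoly F X) : A :=
  match t with
  | NVar i => a i
  | NZero => 0
  | NAdd t1 t2 => neval a t1 + neval a t2
  | NScale k t1 => k *: neval a t1
  | NMul t1 t2 => neval a t1 ** neval a t2
  end.

Definition hom (F : fieldType) (A B : naAlgType F) (p : A -> B) : Prop :=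
  [/\ forall x y, p (x + y) = p x + p y,
      forall k x, p (k *: x) = k *: p x
    & forall x y, p (x ** y) = p x ** p y].

Lemma hom_neval (F : fieldType) (X : Type) (A B : naAlgType F) (p : A -> B)
    (a : X -> A) (t : npoly F X) :
  hom p -> p (neval a t) = neval (p \o a) t.
Proof.
case=> pD pZ pM; elim: t => //= [|t IHt s IHs|k t IHt|t IHt s IHs].
- by rewrite -(scale0r 0) pZ scale0r.
- by rewrite pD IHt IHs.
- by rewrite pZ IHt.
- by rewrite pM IHt IHs.
Qed.

Section Varieties.
Variable F : fieldType.
Implicit Types (A B : naAlgType F) (f g h : npoly F nat).

Definition satisfies A f := forall a : nat -> A, neval a f = 0.

Definition algClass := naAlgType F -> Prop.

Definition defined_by (I : npoly F nat -> Prop) : algClass :=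
  fun A => forall f, I f -> satisfies A f.

Definition is_variety (C : algClass) :=
  exists I, forall A, C A <-> defined_by I A.

Definition subvariety (C D : algClass) :=
  is_variety C /\ forall A, C A -> D A.

Definition finitely_based (C : algClass) :=
  exists (n : nat) (f : 'I_n -> npoly F nat),
    forall A, C A <-> forall i, satisfies A (f i).

Definition Var A : algClass := defined_by (satisfies A).

Definition NSub f g := NAdd f (NScale (-1) g).
Definition Nassoc f g h := NSub (NMul (NMul f g) h) (NMul f (NMul g h)).
Definition Njordan f g := NAdd (NMul f g) (NMul g f).
Definition Ncomm f g := NSub (NMul f g) (NMul g f).

Definition V_identity (i : 'I_4) : npoly F nat :=
  let x := NVar 0%N in let y := NVar 1%N in
  let z := NVar 2%N in let t := NVar 3%N in
  match val i with
  | 0 => Nassoc x y y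
  | 1 => NMul (NMul x y) (NMul z t)
  | 2 => Njordan (Njordan x y) z
  | _ => Ncomm (Nassoc x (NMul y z) x) t
  end.

Definition V : algClass := fun A => forall i, satisfies A (V_identity i).

Lemma V_is_variety : is_variety V.
Proof.
exists (fun f => exists i, f = V_identity i) => A.
by split=> [VA f [i ->]|VA i]; [exact: VA | apply: VA; exists i].
Qed.

(* x is the variable 0 and y_i the variable i; [chain n k] is p_{k+1}. *)
Fixpoint chain (n k : nat) : npoly F nat :=
  match k with
  | 0 => Nassoc (NVar n) (NVar 0%N) (NVar n)
  | k'.+1 => Nassoc (NVar (n - k)%N) (chain n k') (NVar (n + k)%N)
  end.

Definition chain_identity (n : nat) : npoly F nat :=
  Nassoc (NVar 0%N) (chain n n.-1) (NVar 0%N).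

End Varieties.

(* The Grassmann algebra G, with unit, on generators e_0, e_1, ... has the basis
   e_S = e_{s_1} ... e_{s_k}, S = {s_1 < ... < s_k} a finite set of indices, and
   e_S e_T = (-1)^(inv S T) e_{S u T} if S and T are disjoint, 0 otherwise.  An
   element sum_S e_S (x) a_S of G (x) A is the finitely supported function
   S |-> a_S.  The product below makes sense for all functions. *)
Section Grassmann.
Variables (F : fieldType).

Definition inversions (S T : {fset nat}) : nat :=
  (\sum_(s <- S) \sum_(t <- T) (t < s))%N.

Lemma fsetU_compl (S T : {fset nat}) :
  (T `<=` S)%fset -> (T `|` (S `\` T))%fset = S.
Proof. by move=> TS; rewrite fsetUDl fsetDv fsetD0; apply/fsetUidPr. Qed.

Section Functions.
Variable A : naAlgType F.

Definition gfun : Type := {fset nat} -> A.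
HB.instance Definition _ := GRing.Lmodule.on gfun.

Lemma gfunD (f g : gfun) S : (f + g) S = f S + g S.
Proof. by []. Qed.

Lemma gfunZ k (f : gfun) S : (k *: f) S = k *: f S.
Proof. by []. Qed.

Definition gfun_mul (f g : gfun) : gfun := fun S =>
  \sum_(T <- fpowerset S)
    (-1) ^+ inversions T (S `\` T)%fset *: (f T ** g (S `\` T)%fset).

Lemma gfun_mulDl f g h : gfun_mul (f + g) h = gfun_mul f h + gfun_mul g h.
Proof.
apply/funext => S; rewrite gfunD /gfun_mul -big_split /=.
by apply: eq_bigr => T _; rewrite gfunD namulDl scalerDr.
Qed.

Lemma gfun_mulDr f g h : gfun_mul f (g + h) = gfun_mul f g + gfun_mul f h.
Proof.
apply/funext => S; rewrite gfunD /gfun_mul -big_split /=.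
by apply: eq_bigr => T _; rewrite gfunD namulDr scalerDr.
Qed.

Lemma gfun_mulZl k f g : gfun_mul (k *: f) g = k *: gfun_mul f g.
Proof.
apply/funext => S; rewrite gfunZ /gfun_mul scaler_sumr.
by apply: eq_bigr => T _; rewrite gfunZ namulZl !scalerA mulrC.
Qed.

Lemma gfun_mulZr k f g : gfun_mul f (k *: g) = k *: gfun_mul f g.
Proof.
apply/funext => S; rewrite gfunZ /gfun_mul scaler_sumr.
by apply: eq_bigr => T _; rewrite gfunZ namulZr !scalerA mulrC.
Qed.

HB.instance Definition _ := Lmodule_isNAAlgebra.Build F gfun
  gfun_mulDl gfun_mulDr gfun_mulZl gfun_mulZr.

(* e_S (x) a *)
Definition gword (S : {fset nat}) (a : A) : gfun :=
  fun T => if T == S then a else 0.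

Lemma gword_mul S T a b : gword S a ** gword T b =
  if [disjoint S & T]%fset
  then (-1) ^+ inversions S T *: gword (S `|` T)%fset (a ** b) else 0.
Proof.
apply/funext => U; rewrite {1}/namul /= /gfun_mul.
case: ifPn => [dST|ndST]; last first.
  rewrite big1_seq // => W /andP[_ _]; rewrite /gword.
  case: eqVneq => [->|_]; last by rewrite namul0r scaler0.
  case: eqVneq => [UT|_]; last by rewrite namulr0 scaler0.
  case/negP: ndST; rewrite -UT; apply/fdisjointP => n nW.
  by rewrite inE nW.
rewrite gfunZ /gword; case: eqVneq => [->|neU].
  rewrite (big_fsetD1 S) /=; last by rewrite fpowersetE fsubsetUl.
  rewrite eqxx fsetDUl fsetDv fset0U.
  have -> : (T `\` S)%fset = T.
    by apply/fsetDidPl; rewrite fdisjoint_sym.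
  rewrite eqxx big1_seq ?addr0 // => W /andP[_].
  by rewrite !inE => /andP[/negPf-> _]; rewrite namul0r scaler0.
rewrite scaler0 big1_seq // => W /andP[_ WU].
case: eqVneq => [WS|_]; last by rewrite namul0r scaler0.
case: eqVneq => [UT|_]; last by rewrite namulr0 scaler0.
by case/eqP: neU; rewrite -WS -UT fsetU_compl -?fpowersetE.
Qed.

End Functions.

Definition finsupp_gfun (A : naAlgType F) (f : gfun A) :=
  exists s : seq {fset nat}, forall S, f S <> 0 -> S \in s.

Section Envelope.
Variable A : superAlgType F.

Definition grass_pred (f : gfun A) : Prop :=
  finsupp_gfun f /\ forall S : {fset nat}, homog (odd #|` S|) (f S).

Lemma grass_pred0 : grass_pred 0.
Proof. by split=> [|S]; [exists nil | exact: homog0]. Qed.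

Lemma grass_predL k f g :
  grass_pred f -> grass_pred g -> grass_pred (k *: f + g).
Proof.
move=> [[s fs] hf] [[t gt] hg]; split=> [|S]; last first.
  by rewrite gfunD gfunZ; exact: homogL.
exists (s ++ t) => S; rewrite gfunD gfunZ mem_cat => nz.
have [fS0|/eqP/fs-> //] := eqVneq (f S) 0.
have [gS0|/eqP/gt->] := eqVneq (g S) 0; last by rewrite orbT.
by case: nz; rewrite fS0 gS0 scaler0 addr0.
Qed.

Lemma grass_predM f g : grass_pred f -> grass_pred g -> grass_pred (f ** g).
Proof.
move=> [[s fs] hf] [[t gt] hg]; split=> [|S]; last first.
  rewrite /namul /= /gfun_mul big_seq.
  elim/big_rec: _ => [|T x]; first exact: homog0.
  rewrite fpowersetE => TS hx; apply: homogL => //.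
  have -> : odd #|` S| = odd #|` T| (+) odd #|` (S `\` T)%fset|.
    by rewrite -oddD -[in LHS](cardfsID T S) (fsetIidPr TS).
  exact: homogM.
exists [seq (x `|` y)%fset | x <- s, y <- t] => S nz.
apply: contrapT => nS; apply: nz; rewrite /namul /= /gfun_mul.
rewrite big1_seq // => T /andP[_]; rewrite fpowersetE => TS.
have [->|/eqP/fs Ts] := eqVneq (f T) 0; first by rewrite namul0r scaler0.
have [->|/eqP/gt Dt] := eqVneq (g (S `\` T)%fset) 0.
  by rewrite namulr0 scaler0.
case: nS; apply/allpairsP; exists (T, (S `\` T)%fset); split=> //=.
by rewrite fsetU_compl.
Qed.

Definition grass_subalg : subalg (gfun A) :=
  Subalg grass_pred0 grass_predL grass_predM.

Definition grass_env : naAlgType F := subalg_sort grass_subalg.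

End Envelope.
End Grassmann.

(* The free C-superalgebra on r odd generators: expressions in the generators,
   two of them being identified when they take the same value in all
   C-superalgebras under all substitutions of odd elements.  The universal
   property is [freeSuper_class], [free_gen_odd] and [freeSuper_universal]. *)
Section FreeSuper.
Variables (F : fieldType) (C : algClass F) (r : nat).

Definition term := npoly F 'I_r.
HB.instance Definition _ := gen_eqMixin term.
HB.instance Definition _ := gen_choiceMixin term.

Definition free_eq (t s : term) : Prop :=
  forall (S : superAlgType F) (u : 'I_r -> S),
    C (grass_env S) -> (forall i, homog true (u i)) -> neval u t = neval u s.

Definition free_eqb : rel term := fun t s => `[< free_eq t s >].

Lemma free_eqb_refl : reflexive free_eqb.
Proof. by move=> t; apply/asboolP. Qed.

Lemma free_eqb_sym : symmetric free_eqb.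
Proof.
by move=> t s; apply/asboolP/asboolP => ts S u CS uo; rewrite ts.
Qed.

Lemma free_eqb_trans : transitive free_eqb.
Proof.
by move=> t s w /asboolP st /asboolP tw; apply/asboolP => S u CS uo;
  rewrite st // tw.
Qed.

Canonical free_equiv :=
  EquivRel free_eqb free_eqb_refl free_eqb_sym free_eqb_trans.

Definition freeSuper := {eq_quot free_eqb}.
HB.instance Definition _ := Choice.on freeSuper.

Implicit Types (x y z : freeSuper) (t s : term).

Definition fpi t : freeSuper := \pi_freeSuper t.

Lemma fpi_eq t s : fpi t = fpi s <-> free_eq t s.
Proof. by split=> [/eqquotP/asboolP|ts] //; apply/eqquotP/asboolP. Qed.

Lemma fpiK x : fpi (repr x) = x.
Proof. exact: reprK. Qed.

Definition free_add x y := fpi (NAdd (repr x) (repr y)).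
Definition free_opp x := fpi (NScale (-1) (repr x)).
Definition free_scale k x := fpi (NScale k (repr x)).
Definition free_mul x y := fpi (NMul (repr x) (repr y)).

Definition free_eval (S : superAlgType F) (u : 'I_r -> S) x : S :=
  neval u (repr x).

Section Eval.
Variables (S : superAlgType F) (u : 'I_r -> S).
Hypotheses (CS : C (grass_env S)) (uo : forall i, homog true (u i)).

Lemma free_eval_pi t : free_eval u (fpi t) = neval u t.
Proof.
have /fpi_eq h : fpi (repr (fpi t)) = fpi t by rewrite fpiK.
exact: h.
Qed.

Lemma free_evalE :
  (free_eval u (fpi NZero) = 0) *
  (forall x y, free_eval u (free_add x y) = free_eval u x + free_eval u y) *
  (forall x, free_eval u (free_opp x) = - free_eval u x) *
  (forall k x, free_eval u (free_scale k x) = k *: free_eval u x) *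
  (forall x y, free_eval u (free_mul x y) = free_eval u x ** free_eval u y).
Proof. by do !split=> *; rewrite free_eval_pi //= scaleN1r. Qed.

End Eval.

Lemma free_ext x y :
  (forall (S : superAlgType F) (u : 'I_r -> S), C (grass_env S) ->
    (forall i, homog true (u i)) -> free_eval u x = free_eval u y) -> x = y.
Proof.
by move=> h; rewrite -(fpiK x) -(fpiK y); apply/fpi_eq => S u CS uo; exact: h.
Qed.

Lemma free_addA : associative free_add.
Proof.
by move=> x y z; apply: free_ext => S u CS uo; rewrite !(free_evalE CS uo) addrA.
Qed.

Lemma free_addC : commutative free_add.
Proof.
by move=> x y; apply: free_ext => S u CS uo; rewrite !(free_evalE CS uo) addrC.
Qed.

Lemma free_add0 : left_id (fpi NZero) free_add.
Proof.
by move=> x; apply: free_ext => S u CS uo; rewrite !(free_evalE CS uo) add0r.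
Qed.

Lemma free_addN : left_inverse (fpi NZero) free_opp free_add.
Proof.
by move=> x; apply: free_ext => S u CS uo; rewrite !(free_evalE CS uo) addNr.
Qed.

HB.instance Definition _ := GRing.isZmodule.Build freeSuper
  free_addA free_addC free_add0 free_addN.

Lemma free_scaleA a b x : free_scale a (free_scale b x) = free_scale (a * b) x.
Proof.
by apply: free_ext => S u CS uo; rewrite !(free_evalE CS uo) scalerA.
Qed.

Lemma free_scale1 : left_id 1 free_scale.
Proof.
by move=> x; apply: free_ext => S u CS uo; rewrite !(free_evalE CS uo) scale1r.
Qed.

Lemma free_scaleDr : right_distributive free_scale +%R.
Proof.
move=> k x y; apply: free_ext => S u CS uo.
by rewrite !(free_evalE CS uo) scalerDr.
Qed.

Lemma free_scaleDl x : {morph free_scale^~ x : a b / a + b}.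
Proof.
move=> a b; apply: free_ext => S u CS uo.
by rewrite !(free_evalE CS uo) scalerDl.
Qed.

HB.instance Definition _ := GRing.Zmodule_isLmodule.Build F freeSuper
  free_scaleA free_scale1 free_scaleDr free_scaleDl.

Lemma free_mulDl x y z : free_mul (x + y) z = free_mul x z + free_mul y z.
Proof.
by apply: free_ext => S u CS uo; rewrite !(free_evalE CS uo) namulDl.
Qed.

Lemma free_mulDr x y z : free_mul x (y + z) = free_mul x y + free_mul x z.
Proof.
by apply: free_ext => S u CS uo; rewrite !(free_evalE CS uo) namulDr.
Qed.

Lemma free_mulZl k x y : free_mul (k *: x) y = k *: free_mul x y.
Proof.
by apply: free_ext => S u CS uo; rewrite !(free_evalE CS uo) namulZl.
Qed.

Lemma free_mulZr k x y : free_mul x (k *: y) = k *: free_mul x y.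
Proof.
by apply: free_ext => S u CS uo; rewrite !(free_evalE CS uo) namulZr.
Qed.

HB.instance Definition _ := Lmodule_isNAAlgebra.Build F freeSuper
  free_mulDl free_mulDr free_mulZl free_mulZr.

Fixpoint npart (b : bool) (t : term) : term :=
  match t with
  | NVar i => if b then NVar i else NZero
  | NZero => NZero
  | NAdd t1 t2 => NAdd (npart b t1) (npart b t2)
  | NScale k t1 => NScale k (npart b t1)
  | NMul t1 t2 => NAdd (NMul (npart false t1) (npart b t2))
                       (NMul (npart true t1) (npart (~~ b) t2))
  end.

Definition free_homog (b : bool) x : Prop := exists t, x = fpi (npart b t).

Section Parts.
Variables (S : superAlgType F) (u : 'I_r -> S).
Hypotheses (CS : C (grass_env S)) (uo : forall i, homog true (u i)).

Lemma homogD b (x y : S) : homog b x -> homog b y -> homog b (x + y).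
Proof. by move=> hx hy; rewrite -[x]scale1r; exact: homogL. Qed.

Lemma homogZ b k (x : S) : homog b x -> homog b (k *: x).
Proof. by move=> hx; rewrite -[_ *: _]addr0; apply: homogL => //; exact: homog0. Qed.

Lemma npart_homog b t : homog b (neval u (npart b t)).
Proof.
elim: t b => [i||t IHt s IHs|k t IHt|t IHt s IHs] b /=.
- by case: b => //=; exact: homog0.
- exact: homog0.
- exact: homogD.
- exact: homogZ.
- by apply: homogD; [exact: (@homogM _ _ false b) | case: b => //=;
    [exact: (@homogM _ _ true false) | exact: (@homogM _ _ true true)]].
Qed.

Lemma npart_sum t : neval u (npart false t) + neval u (npart true t) = neval u t.
Proof.
elim: t => [i||t IHt s IHs|k t IHt|t IHt s IHs] /=; rewrite ?add0r //.
- by rewrite addrACA IHt IHs.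
- by rewrite -scalerDr IHt.
- rewrite -[in RHS]IHt -[in RHS]IHs namulDr !namulDl.
  by rewrite [X in _ + X = _]addrC addrACA [X in _ + X = _]addrC.
Qed.

Lemma homog_split (x y x' y' : S) : homog false x -> homog true y ->
  homog false x' -> homog true y' -> x + y = x' + y' -> x = x' /\ y = y'.
Proof.
move=> hx hy hx' hy' e.
have d : x - x' = y' - y.
  by apply: (addIr x'); rewrite subrK addrAC [y' + _]addrC -e addrK.
have z : x - x' = 0.
  apply: homog_cap; first by rewrite -scaleN1r addrC; exact: homogL.
  by rewrite d -scaleN1r addrC; exact: homogL.
by split; apply/eqP; rewrite -subr_eq0; [rewrite z | rewrite -oppr_eq0 opprB -d z].
Qed.

Lemma npart_id b t : homog b (neval u t) -> neval u (npart b t) = neval u t.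
Proof.
move=> h; have := npart_sum t; have h0 := npart_homog false t.
have h1 := npart_homog true t; case: b h => h.
  by rewrite -[RHS]add0r => /homog_split[] //; exact: homog0.
by rewrite -[RHS]addr0 => /homog_split[] //; exact: homog0.
Qed.

End Parts.

Lemma free_homogP b x : free_homog b x <->
  forall (S : superAlgType F) (u : 'I_r -> S), C (grass_env S) ->
    (forall i, homog true (u i)) -> homog b (free_eval u x).
Proof.
split=> [[t ->] S u CS uo|h].
  by rewrite free_eval_pi //; exact: npart_homog.
exists (repr x); apply: free_ext => S u CS uo; rewrite free_eval_pi //.
by rewrite npart_id //; exact: h.
Qed.

Lemma free_homog0 b : free_homog b 0.
Proof. by exists NZero. Qed.

Lemma free_homogL b k x y :
  free_homog b x -> free_homog b y -> free_homog b (k *: x + y).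
Proof.
move=> /free_homogP hx /free_homogP hy; apply/free_homogP => S u CS uo.
by rewrite !(free_evalE CS uo); apply: homogL; [exact: hx | exact: hy].
Qed.

Lemma free_homog_add x : exists y z,
  [/\ free_homog false y, free_homog true z & x = y + z].
Proof.
exists (fpi (npart false (repr x))), (fpi (npart true (repr x))).
split; [by eexists | by eexists |].
by apply: free_ext => S u CS uo;
  rewrite !(free_evalE CS uo) !free_eval_pi // npart_sum.
Qed.

Lemma free_homog_cap x : free_homog false x -> free_homog true x -> x = 0.
Proof.
move=> /free_homogP h0 /free_homogP h1; apply: free_ext => S u CS uo.
by rewrite (free_evalE CS uo); apply: homog_cap; [exact: h0 | exact: h1].
Qed.

Lemma free_homogM b c x y :
  free_homog b x -> free_homog c y -> free_homog (b (+) c) (x ** y).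
Proof.
move=> /free_homogP hx /free_homogP hy; apply/free_homogP => S u CS uo.
by rewrite (free_evalE CS uo); apply: homogM; [exact: hx | exact: hy].
Qed.

HB.instance Definition _ := NAAlgebra_isSuperAlgebra.Build F freeSuper
  free_homog0 free_homogL free_homog_add free_homog_cap free_homogM.

Definition free_gen (i : 'I_r) : freeSuper := fpi (NVar i).

Lemma free_gen_odd i : homog true (free_gen i).
Proof. by exists (NVar i). Qed.

Lemma neval_free_gen t : neval free_gen t = fpi t.
Proof.
by elim: t => //= [t -> s ->|k t ->|t -> s ->]; apply: free_ext => S u CS uo;
  rewrite (free_evalE CS uo) !free_eval_pi.
Qed.

Lemma freeSuper_universal (S : superAlgType F) (u : 'I_r -> S) :
  C (grass_env S) -> (forall i, homog true (u i)) ->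
  exists p : freeSuper -> S,
    [/\ hom p, forall b x, homog b x -> homog b (p x),
        forall i, p (free_gen i) = u i
      & forall q, hom q -> (forall i, q (free_gen i) = u i) -> q =1 p].
Proof.
move=> CS uo; exists (free_eval u); split.
- by split=> *; rewrite (free_evalE CS uo).
- by move=> b x /free_homogP; apply.
- by move=> i; rewrite free_eval_pi.
- move=> q hq qg x; rewrite -(fpiK x) -neval_free_gen hom_neval //.
  rewrite neval_free_gen free_eval_pi //; congr neval.
  by apply/funext => i /=; exact: qg.
Qed.

Lemma freeSuper_class : is_variety C -> C (grass_env freeSuper).
Proof.
case=> I CI; apply/CI => f If a; apply: val_inj; apply/funext => W.
apply: free_ext => S u CS uo.
pose G : grass_env freeSuper -> gfun S := fun g W' => free_eval u (val g W').
have GP g : grass_pred (G g).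
  have [[s gs] hg] : grass_pred (val g) by case: g => g /= /asboolP.
  split=> [|W']; last by move/free_homogP: (hg W'); apply.
  exists s => W' nz; apply: gs => g0; apply: nz.
  by rewrite /G g0 (free_evalE CS uo).
pose H (g : grass_env freeSuper) : grass_env S :=
  @SubalgElt F (gfun S) (grass_subalg S) (G g) (asboolT (GP g)).
have hH : hom H.
  split=> [g h|k g|g h]; apply: val_inj; apply/funext => W'.
  - by rewrite /= /G !(free_evalE CS uo).
  - by rewrite /= /G !(free_evalE CS uo).
  - rewrite /= /G; set e := free_eval u.
    have e0 : e 0 = 0 by rewrite /e (free_evalE CS uo).
    have eD x y : e (x + y) = e x + e y by rewrite /e (free_evalE CS uo).
    rewrite [LHS](big_morph e eD e0); apply: eq_bigr => T _.
    by rewrite /e !(free_evalE CS uo).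
have /CI/(_ f If (H \o a)) := CS.
by rewrite -hom_neval // => /(congr1 val)/(congr1 (@^~ W)) /=; rewrite /G => ->;
  rewrite (free_evalE CS uo).
Qed.

End FreeSuper.

(* The subalgebra of G(freeSuper C r) generated by the u_i (x) e_(i + r j);
   numbering the u_i and the e_k from 0 rather than from 1 leaves the index
   i + r j unchanged. *)
Definition Gtilde (F : fieldType) (C : algClass F) (r : nat) : naAlgType F :=
  subalg_sort (generated_subalg (fun x : grass_env (freeSuper C r) =>
    exists (i : 'I_r) (j : nat),
      val x = gword [fset (i + r * j)%N]%fset (free_gen C i))).

(* Main.v *)
(* On the square of an algebra of V write R_z w = w z and T_z w = w z + z w.  The identities
   of V give R R = T T = 0 and T_x R_z = - T_z R_x there, so modulo V every polynomial is a
   combination of variables, products of two variables and alternating words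
   [x, y] R T R ..., [x, y] T R T ..., and the identity with index n becomes
   [x, y] T_y (R T)^(n-1) R_x T_x = 0 with distinct variables in the middle.

   Up to sign, a multilinear alternating word depends only on its first two letters and, if
   it ends in T, on its last one, so an identity is a linear relation between functions of
   two or three indices.  Let A be the superalgebra with odd a, b, d, e and even c, where
   b b = c, a c = d, b c = e, a d = d a = c and all other products vanish.  Evaluating
   on the subalgebra of G(A) generated by the e_(2j) (x) a and e_(2j+1) (x) b shows that an
   identity of this subalgebra follows from V and finitely many identities of the infinite
   system.  This subalgebra is an image of the Grassmann algebra of rank 2.
   Conversely, an element of the latter, or of G(A), is modulo the square a sum of two
   elements of square-zero ideals, whereas x occurs three times in the identities.

   For the infinite basis, a graded version of A with a third odd generator, acting only in
   degree n, satisfies the identities with index less than n but not the one with index n. *)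
From HB Require Import structures.
From mathcomp Require Import all_boot all_algebra.
From mathcomp Require Import finmap boolp functions zify ring.
Require Import Defs.

Set Implicit Arguments.
Unset Strict Implicit.
Unset Printing Implicit Defensive.

Import GRing.Theory.
Local Open Scope ring_scope.

(** All kinds of words are treated by one duality. The relations of V write the signed value of a
    multilinear word as a sum of elements attached to keys read off the word: the unordered pair of
    its first letters, each of these letters, each of them paired with the last letter, or the set
    of all three. Hence a combination of words vanishes as soon as, for every key, the signed
    coefficients of the words having that key add up to zero. Conversely, each of these sums is one
    coordinate of one evaluation in the envelope of the five-dimensional algebra, so it is zero for
    an identity of that algebra. The chain identities are needed only for words that begin and end
    with T. There they say that the coboundary of a cochain does not depend on a parameter, which is
    what splits a function of three indices. Only indices bounded by the length of the words occur,
    and this rules out a finite basis. Reduction to multilinear words divides by the factorials of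
    the multiplicities of the letters. Inverting 2 and 3 suffices, because a letter occurring five
    times kills a word. *)

Section LinearCombinations.
Variables (F : fieldType) (M : lmodType F).

(** Reified linear expressions in the atoms of an environment: an equation in a module is reduced to
    equations between coefficients, which [ring] or [field] settles. *)
Inductive lexp :=
  | LVar of nat
  | LZero
  | LAdd of lexp & lexp
  | LOpp of lexp
  | LScale of F & lexp.

Fixpoint leval (env : seq M) (e : lexp) : M :=
  match e with
  | LVar i => nth 0 env i
  | LZero => 0
  | LAdd e1 e2 => leval env e1 + leval env e2
  | LOpp e1 => - leval env e1
  | LScale k e1 => k *: leval env e1
  end.

(** The index test is [Nat.eqb], which [cbn] evaluates on numerals. *)
Fixpoint lcoef (i : nat) (e : lexp) : F :=
  match e with
  | LVar j => if Nat.eqb i j then 1 else 0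
  | LZero => 0
  | LAdd e1 e2 => lcoef i e1 + lcoef i e2
  | LOpp e1 => - lcoef i e1
  | LScale k e1 => k * lcoef i e1
  end.

Lemma lcoefP env e : leval env e = \sum_(i < size env) lcoef i e *: env`_i.
Proof.
elim: e => [j||e1 IH1 e2 IH2|e IH|k e IH] /=.
- have eqbE (i : nat) : Nat.eqb i j = (i == j) by apply/PeanoNat.Nat.eqb_spec/eqP.
  have [jn|jn] := ltnP j (size env); last first.
    rewrite nth_default // big1 // => i _; rewrite eqbE.
    by rewrite ltn_eqF ?scale0r //; apply: leq_trans jn.
  rewrite (bigD1 (Ordinal jn)) //= eqbE eqxx scale1r big1 ?addr0 // => i ij.
  by rewrite eqbE (_ : (i == j :> nat) = false) ?scale0r //; apply: negbTE.
- by rewrite big1 // => i _; rewrite scale0r.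
- by rewrite IH1 IH2 -big_split; apply: eq_bigr => i _; rewrite scalerDl.
- by rewrite IH -sumrN; apply: eq_bigr => i _; rewrite scaleNr.
- by rewrite IH scaler_sumr; apply: eq_bigr => i _; rewrite scalerA.
Qed.

Fixpoint lcoef_eq (n : nat) (e1 e2 : lexp) : Prop :=
  match n with
  | 0 => True
  | m.+1 => lcoef m e1 = lcoef m e2 /\ lcoef_eq m e1 e2
  end.

Lemma leval_eq env e1 e2 : lcoef_eq (size env) e1 e2 -> leval env e1 = leval env e2.
Proof.
have coefE n : lcoef_eq n e1 e2 -> forall i, (i < n)%N -> lcoef i e1 = lcoef i e2.
  elim: n => [|n IHn] //= [e12 /IHn e12'] i; rewrite ltnS leq_eqVlt.
  by case/predU1P=> [->|/e12'].
by move=> /coefE e12; rewrite !lcoefP; apply: eq_bigr => i _; rewrite e12.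
Qed.

End LinearCombinations.

Ltac lm_mem x l :=
  match l with
  | nil => constr:(false)
  | cons ?y ?l' =>
    match constr:(Set) with
    | _ => let _ := match constr:(Set) with _ => constr_eq x y end in constr:(true)
    | _ => lm_mem x l'
    end
  end.
Ltac lm_atoms e l :=
  lazymatch e with
  | GRing.zero => l
  | GRing.add ?a ?b => let l' := lm_atoms a l in lm_atoms b l'
  | GRing.opp ?a => lm_atoms a l
  | GRing.scale _ ?a => lm_atoms a l
  | _ => lazymatch lm_mem e l with
         | true => l
         | false => constr:(cons e l)
         end
  end.
Ltac lm_index x l :=
  match l with
  | cons ?y ?l' =>
    match constr:(Set) with
    | _ => let _ := match constr:(Set) with _ => constr_eq x y end in constr:(O)
    | _ => let n := lm_index x l' in constr:(S n)
    end
  end.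
Ltac lm_reify F e l :=
  lazymatch e with
  | GRing.zero => constr:(LZero F)
  | GRing.add ?a ?b => let x := lm_reify F a l in let y := lm_reify F b l in
                       constr:(LAdd x y)
  | GRing.opp ?a => let x := lm_reify F a l in constr:(LOpp x)
  | GRing.scale ?k ?a => let x := lm_reify F a l in constr:(LScale (F := F) k x)
  | _ => let n := lm_index e l in constr:(LVar F n)
  end.
Ltac lmod_pre F :=
  lazymatch goal with
  | |- @eq ?T ?a ?b =>
    let l0 := constr:(@nil T) in
    let l1 := lm_atoms a l0 in let l := lm_atoms b l1 in
    let x := lm_reify F a l in let y := lm_reify F b l in
    apply: (@leval_eq F _ l x y); rewrite [size _]/=; cbn [lcoef_eq lcoef Nat.eqb]
  end.
Tactic Notation "lmod" constr(F) := lmod_pre F; repeat split; ring.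
Tactic Notation "lmodf" constr(F) := lmod_pre F; repeat split; field.

(** * The operators T and R on the square of an algebra of V *)

(** A hypothesis is used by subtracting its multiple by [k] from the goal. A proof then lists the
    linear combination of hypotheses that gives the claim, and [lmod] checks it. *)
Lemma lceq (F : fieldType) (M : lmodType F) (k : F) (E1 E2 X Y : M) :
  E1 = E2 -> X - k *: (E1 - E2) = Y -> X = Y.
Proof. by move=> ->; rewrite subrr scaler0 subr0. Qed.

Lemma half2 (F : fieldType) (M : lmodType F) (h2 : 2%:R != 0 :> F) (v : M) :
  v + v = 0 -> v = 0.
Proof.
move=> vv; have -> : v = 2%:R^-1 *: (v + v) by lmodf F.
by rewrite vv scaler0.
Qed.

Tactic Notation "lc" uconstr(k) constr(e) := match goal with F : fieldType |- _ => refine (@lceq F _ k _ _ _ _ e _) end.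

Section VTheory.
Variables (F : fieldType) (h2 : 2%:R != 0 :> F) (B : naAlgType F) (VB : V B).
Implicit Types x y z t u v w : B.

Lemma namulNr x y : x ** (- y) = - (x ** y).
Proof. by rewrite -scaleN1r namulZr scaleN1r. Qed.
Lemma namulNl x y : (- x) ** y = - (x ** y).
Proof. by rewrite -scaleN1r namulZl scaleN1r. Qed.
Definition namulE := (@namulDl F B, @namulDr F B, namulNl, namulNr, @namulZl F B,
  @namulZr F B, @namul0r F B, @namulr0 F B).

Definition nassoc x y z := (x ** y) ** z - x ** (y ** z).
Definition brac x y := x ** y - y ** x.

Lemma V_alt x y : nassoc x y y = 0.
Proof.
have := VB (@Ordinal 4 0 isT) (nth 0 [:: x; y]).
by rewrite /= !scaleN1r.
Qed.
Lemma V_metab x y z t : (x ** y) ** (z ** t) = 0.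
Proof. exact: (VB (@Ordinal 4 1 isT) (nth 0 [:: x; y; z; t])). Qed.
Lemma V_jord x y z : (x ** y + y ** x) ** z + z ** (x ** y + y ** x) = 0.
Proof. exact: (VB (@Ordinal 4 2 isT) (nth 0 [:: x; y; z])). Qed.
Lemma V_four x y z t : brac (nassoc x (y ** z) x) t = 0.
Proof.
have := VB (@Ordinal 4 3 isT) (nth 0 [:: x; y; z; t]).
by rewrite /= !scaleN1r.
Qed.
Lemma V_alt2 x y z : nassoc x y z + nassoc x z y = 0.
Proof.
have := V_alt x (y + z).
have := V_alt x y; have := V_alt x z; rewrite /nassoc !namulE => e1 e2 e3.
by rewrite -[RHS]e3 -[LHS]addr0 -[LHS]addr0 -[X in _ + X + _]e1 -[X in _ + X]e2; lmod F.
Qed.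

Lemma brac_sym x y : brac y x = - brac x y.
Proof. by rewrite /brac opprB. Qed.

Definition Top z w := w ** z + z ** w.

Lemma TopD z w w' : Top z (w + w') = Top z w + Top z w'.
Proof. by rewrite /Top !namulE; lmod F. Qed.
Lemma TopZ z k w : Top z (k *: w) = k *: Top z w.
Proof. by rewrite /Top !namulE; lmod F. Qed.
Lemma TopDl z z' w : Top (z + z') w = Top z w + Top z' w.
Proof. by rewrite /Top !namulE; lmod F. Qed.
Lemma TopZl k z w : Top (k *: z) w = k *: Top z w.
Proof. by rewrite /Top !namulE; lmod F. Qed.

(* The properties of the square of an algebra of V which the operator calculus
   uses; in Grassmann envelopes they hold on a larger subspace. *)
Record squarelike (W : B -> Prop) : Prop := {
  sl0 : W 0;
  slL : forall k x y, W x -> W y -> W (k *: x + y);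
  slM : forall x y, W (x ** y);
  sl_metab : forall x y, W x -> W y -> x ** y = 0;
  sl_four : forall x w t, W w -> brac (nassoc x w x) t = 0
}.

Inductive square : B -> Prop :=
  | Sq_mul x y : square (x ** y)
  | Sq_0 : square 0
  | Sq_lin k x y : square x -> square y -> square (k *: x + y).

Lemma square_squarelike : squarelike square.
Proof.
split=> //; try by constructor.
- have h x y v : square v -> (x ** y) ** v = 0.
    elim=> [z t||k a b _ IHa _ IHb]; first exact: V_metab.
      by rewrite namulr0.
    by rewrite !namulE IHa IHb scaler0 addr0.
  move=> x y; elim=> [z t||k a b _ IHa _ IHb] Sy; first exact: h.
    by rewrite namul0r.
  by rewrite !namulE IHa // IHb // scaler0 addr0.
- move=> x w t; elim=> [y z||k a b _ IHa _ IHb]; first exact: V_four.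
    by rewrite /brac /nassoc !namulE; lmod F.
  move: IHa IHb; rewrite /brac /nassoc !namulE => ea eb.
  by lc k ea; lc 1 eb; lmod F.
Qed.

Variables (W : B -> Prop) (SW : squarelike W).

Lemma W_D w w' : W w -> W w' -> W (w + w').
Proof. by move=> Ww Ww'; rewrite -[w]scale1r; exact: (slL SW). Qed.
Lemma W_Z k w : W w -> W (k *: w).
Proof. by move=> Ww; rewrite -[_ *: _]addr0; apply: (slL SW) => //; exact: (sl0 SW). Qed.
Lemma W_R w z : W (w ** z). Proof. exact: (slM SW). Qed.
Lemma W_T w z : W (Top z w). Proof. by apply: W_D; exact: (slM SW). Qed.
Lemma W_brac x y : W (brac x y).
Proof. by rewrite /brac -scaleN1r; apply: W_D; [|apply: W_Z]; exact: (slM SW). Qed.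

(** Right alternativity at [w, x, y] makes the value skew in [x, y]. With [x] or [y] in first place
    it gives [x(wy + yw) = (xw)y] and [y(wx + xw) = (yw)x]; after these substitutions the two Jordan
    identities differ by [(wx)y - (wy)x], so the value is symmetric as well. *)
Lemma opRR w x y : W w -> (w ** x) ** y = 0.
Proof.
move=> Ww; have m a b := sl_metab SW Ww (slM SW a b).
have m' a b := sl_metab SW (slM SW a b) Ww.
have skew : (w ** x) ** y + (w ** y) ** x = 0.
  by have := V_alt2 w x y; rewrite /nassoc !m !subr0.
have e1 := V_alt2 x w y; have e2 := V_alt2 y w x.
have e3 := V_jord w x y; have e4 := V_jord w y x.
move: e1 e2 e3 e4; rewrite /nassoc !m' !namulE => e1 e2 e3 e4.
apply: (half2 h2); lc 1 skew; lc 1 e3; lc (-1) e4.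
by lc (-1) e1; lc 1 e2; lmod F.
Qed.

Lemma opTT w x y : Top y (Top x w) = 0.
Proof. exact: V_jord. Qed.

Lemma opTR_skew w x y : W w -> Top x w ** y + Top y w ** x = 0.
Proof.
move=> Ww; have m a b := sl_metab SW (slM SW a b) Ww.
have e1 := V_alt2 x w y; have e2 := V_alt2 y w x.
have e3 := opTT w x y; have e4 := opTT w y x.
have r1 := opRR x y Ww; have r2 := opRR y x Ww.
move: e1 e2 e3 e4; rewrite /Top /nassoc !m !namulE !r1 !r2 => e1 e2 e3 e4.
by lc 1 e3; lc 1 e2; lmod F.
Qed.

Lemma nassocW x w z : W w -> nassoc x w z = - (Top z w ** x) - Top x (w ** z).
Proof.
move=> Ww; have := opTR_skew x z Ww.
rewrite /Top /nassoc !namulE !(opRR _ _ Ww) => e.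
by lc 1 e; lmod F.
Qed.

(** At equal letters [R_a T_a w] vanishes by skew symmetry, so the fourth identity says that
    [T_a R_a w] commutes with every [t]; by [opTT] it also anticommutes with [t]. Polarizing in [a]
    gives the claim. *)
Lemma op_four w x y z : W w -> Top y (w ** x) ** z + Top x (w ** y) ** z = 0.
Proof.
move=> Ww.
have four a t : Top a (w ** a) ** t = 0.
  have := sl_four SW a t Ww; rewrite (nassocW _ _ Ww).
  set p := Top a w ** a; have p0 : p = 0.
    by apply: (half2 h2); exact: opTR_skew.
  rewrite p0 oppr0 add0r /brac namulNl namulNr => e.
  have e' := opTT (w ** a) a t; rewrite {1}/Top in e'.
  apply: (half2 h2); lc (-1) e; lc 1 e'; lmod F.
have := four (x + y) z; have := four x z; have := four y z.
rewrite /Top !namulE => e1 e2 e3.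
by lc 1 e3; lc (-1) e1; lc (-1) e2; lmod F.
Qed.

Lemma opW w v : W w -> W v -> (w ** v = 0) * (Top v w = 0).
Proof. by move=> Ww Wv; rewrite /Top !(sl_metab SW) // addr0. Qed.

(** The product [xy] is half the sum of the bracket and the Jordan product, and [T_z] kills the
    latter. *)
Lemma bracT x y z : (x ** y) ** z + z ** (x ** y) = 2%:R^-1 *: Top z (brac x y).
Proof.
have e := V_jord x y z; rewrite /Top /brac.
by move: e; rewrite !namulE => e; lc (2%:R^-1) e; lmodf F.
Qed.

(** Right multiples of Jordan products are expressed by brackets, so that words need only start with
    a bracket. The scalars combine the alternativity and Jordan relations for the three cyclic
    arrangements of the letters. *)
Lemma jord_bracR x y z : (y ** z + z ** y) ** x = - (brac x y ** z) - brac x z ** y.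
Proof.
have e1 := V_alt2 x y z; have e2 := V_alt2 y z x; have e3 := V_alt2 z x y.
have f1 := V_jord y z x; have f2 := V_jord x y z; have f3 := V_jord z x y.
move: e1 e2 e3 f1 f2 f3; rewrite /nassoc /brac !namulE => e1 e2 e3 f1 f2 f3.
lc (3%:R / 2%:R) e1; lc (3%:R / 2%:R) f1; lc (- 2%:R^-1) e2; lc (- 2%:R^-1) f3.
by lc (- 2%:R^-1) e3; lc (- 2%:R^-1) f2; lmodf F.
Qed.

(** This is [op_four] for the element [yz + zy], rewritten by [jord_bracR]. It links words with
    different pairs of first letters. *)
Lemma brac_RTR x y z u t :
  Top u (brac x y ** z) ** t + Top u (brac x z ** y) ** t +
  (Top x (brac u y ** z) ** t + Top x (brac u z ** y) ** t) = 0.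
Proof.
have := op_four x u t (W_D (slM SW y z) (slM SW z y)).
rewrite (jord_bracR x) (jord_bracR u) !TopD -!scaleN1r !TopZ !namulE => e.
by lc (-1) e; lmod F.
Qed.

Definition wop (b : bool) z w := if b then Top z w else w ** z.

Fixpoint wfold (b : bool) w (s : seq B) : B :=
  if s is z :: s' then wfold (~~ b) (wop b z w) s' else w.

Lemma wop_lin b z k w w' : wop b z (k *: w + w') = k *: wop b z w + wop b z w'.
Proof. by case: b; rewrite /= ?TopD ?TopZ ?namulE. Qed.

Lemma wop_linl b k z z' w : wop b (k *: z + z') w = k *: wop b z w + wop b z' w.
Proof. by case: b; rewrite /= ?TopDl ?TopZl ?namulE. Qed.

Lemma wopN b z w : wop b z (- w) = - wop b z w.
Proof. by case: b; rewrite /= /Top ?namulNl ?namulNr ?opprD. Qed.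

Lemma wop0 b z : wop b z 0 = 0.
Proof. by case: b; rewrite /= /Top ?namulr0 ?namul0r ?addr0. Qed.

Lemma wopZ b z k w : wop b z (k *: w) = k *: wop b z w.
Proof. by rewrite -[_ *: w]addr0 wop_lin wop0 addr0. Qed.

Lemma wopD b z w w' : wop b z (w + w') = wop b z w + wop b z w'.
Proof. by rewrite -[w]scale1r wop_lin !scale1r. Qed.

Lemma wop_W b z w : W (wop b z w).
Proof. by case: b; [exact: W_T | exact: W_R]. Qed.

Lemma wfold_lin b k w w' s :
  wfold b (k *: w + w') s = k *: wfold b w s + wfold b w' s.
Proof. by elim: s b w w' => //= z s IHs b w w'; rewrite wop_lin IHs. Qed.

Lemma wfold0 b s : wfold b 0 s = 0.
Proof.
by elim: s b => //= z s IHs b; rewrite wop0.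
Qed.

Lemma wfoldD b w w' s : wfold b (w + w') s = wfold b w s + wfold b w' s.
Proof. by rewrite -{1}[w]scale1r wfold_lin scale1r. Qed.

Lemma wfoldN b w s : wfold b (- w) s = - wfold b w s.
Proof. by rewrite -[- w]addr0 -scaleN1r wfold_lin wfold0 addr0 scaleN1r. Qed.

Lemma wfold_cat b w s1 s2 :
  wfold b w (s1 ++ s2) = wfold (b (+) odd (size s1)) (wfold b w s1) s2.
Proof.
by elim: s1 b w => [|z s1 IHs] b w; rewrite ?addbF //= IHs addNb addbN.
Qed.

Lemma wfold_W b w s : W w -> W (wfold b w s).
Proof. by elim: s b w => //= z s IHs b w _; apply: IHs; exact: wop_W. Qed.

(** If T comes first in the pair, this is [opTR_skew]; if R does, the operator after the pair is
    again R and [op_four] applies. The side condition excludes only a pair R T at the end of the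
    word. *)
Lemma wfold_swap b w s1 x y s2 : W w -> b (+) odd (size s1) || (s2 != [::]) ->
  wfold b w (s1 ++ x :: y :: s2) = - wfold b w (s1 ++ y :: x :: s2).
Proof.
move=> Ww; rewrite !wfold_cat; set c := b (+) _; move: (wfold b w s1) (wfold_W b s1 Ww).
move=> {Ww}w Ww; case: c => [_|] /=.
  rewrite -wfoldN; congr wfold.
  by apply/eqP; rewrite -addr_eq0; apply/eqP; exact: opTR_skew.
case: s2 => //= z s2 _; rewrite -wfoldN; congr wfold.
by apply/eqP; rewrite -addr_eq0; apply/eqP; exact: op_four.
Qed.

Lemma nassoc_wop x w z : W w ->
  nassoc x w z = - wop false x (wop true z w) - wop true x (wop false z w).
Proof. exact: nassocW. Qed.

Lemma wop_same b x y w : W w -> wop b x (wop b y w) = 0.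
Proof. by move=> Ww; case: b; [exact: opTT | exact: opRR]. Qed.

End VTheory.

(** * Normal form of polynomials modulo the identities of V *)

Section NormalForm.
Variables (F : fieldType) (h2 : 2%:R != 0 :> F).

Definition word := (option bool * seq nat)%type.

(* [kval (Some b)] is an alternating word of operators applied to a bracket, its first
   operator being T if [b] and R otherwise, where T_z w = w z + z w and R_z w = w z. *)
Definition kval (B : naAlgType F) (k : option bool) (v : seq B) : B :=
  match k, v with
  | None, [:: x] => x
  | None, [:: x; y] => x ** y
  | Some b, x :: y :: z :: s => wfold b (brac x y) (z :: s)
  | _, _ => 0
  end.

Definition wval (B : naAlgType F) (a : nat -> B) (w : word) : B :=
  kval w.1 (map a w.2).

Definition fval (B : naAlgType F) (a : nat -> B) (L : seq (F * word)) : B :=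
  \sum_(p <- L) p.1 *: wval a p.2.

Definition natfun := forall B : naAlgType F, (nat -> B) -> B.

(** The list [L] is the same for all algebras of V, so that coefficient conditions found in one
    algebra can be used in another. *)
Definition nfable (g : natfun) :=
  exists L, forall B : naAlgType F, V B -> forall a : nat -> B, g B a = fval a L.

Lemma nfable_eq (g h : natfun) : (forall B : naAlgType F, V B -> forall a : nat -> B, g B a = h B a) ->
  nfable h -> nfable g.
Proof. by move=> gh [L hL]; exists L => B VB a; rewrite gh // hL. Qed.

Lemma nfable_add (g h : natfun) : nfable g -> nfable h -> nfable (fun B a => g B a + h B a).
Proof.
move=> [L gL] [M hM]; exists (L ++ M) => B VB a.
by rewrite gL // hM // /fval big_cat.
Qed.

Lemma nfable_scale k (g : natfun) : nfable g -> nfable (fun B a => k *: g B a).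
Proof.
move=> [L gL]; exists [seq (k * p.1, p.2) | p <- L] => B VB a.
rewrite gL // /fval big_map scaler_sumr.
by apply: eq_bigr => p _; rewrite scalerA.
Qed.

Lemma nfable_zero : nfable (fun B a => 0).
Proof. by exists [::] => B VB a; rewrite /fval big_nil. Qed.

Lemma nfable_sum (I : Type) (r : seq I) (g : I -> natfun) :
  (forall i, nfable (g i)) -> nfable (fun B a => \sum_(i <- r) g i B a).
Proof.
move=> gi; elim: r => [|i r IHr].
  by apply: nfable_eq nfable_zero => B VB a; rewrite big_nil.
by apply: nfable_eq (nfable_add (gi i) IHr) => B VB a; rewrite big_cons.
Qed.

Lemma nfable_word w : nfable (fun B a => wval a w).
Proof.
by exists [:: (1, w)] => B VB a; rewrite /fval big_seq1 scale1r.
Qed.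

Lemma wval_square (B : naAlgType F) (VB : V B) (a : nat -> B) w :
  (exists i, w = (None, [:: i])) \/ square (wval a w).
Proof.
have sq := square_squarelike VB.
case: w => [[b|] [|i [|j [|z s]]]]; rewrite /wval /=; try by right; constructor.
  by right; apply: (wfold_W sq); apply: (W_T sq) || apply: (wop_W sq).
by left; exists i.
Qed.

Lemma wop_word (B : naAlgType F) (VB : V B) (a : nat -> B) c z b i j y s :
  wop c (a z) (wval a (Some b, [:: i, j, y & s])) =
  if c == b (+) ~~ odd (size s)
  then wval a (Some b, [:: i, j, y & rcons s z]) else 0.
Proof.
have sq := square_squarelike VB.
rewrite /wval /= -[wfold _ _ _]/(wfold b (brac (a i) (a j)) (map a (y :: s))).
case: eqP => [->|].
  rewrite -[wfold _ _ _ in RHS]/(wfold b (brac (a i) (a j)) (map a (y :: rcons s z))).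
  by rewrite -rcons_cons map_rcons -cats1 wfold_cat size_map.
rewrite lastI map_rcons -cats1 wfold_cat size_map size_belast /=.
move=> cb; have -> : c = b (+) odd (size s) by case: c b (odd _) cb => [] [] [].
apply: (wop_same h2 VB sq); apply: (wfold_W sq); exact: (W_brac sq).
Qed.

Lemma nfable_wop c z w : (forall i, w <> (None, [:: i])) ->
  nfable (fun B a => wop c (a z) (wval a w)).
Proof.
have zero : nfable (fun B a => wop c (a z) 0).
  by apply: nfable_eq nfable_zero => B VB a; case: c; rewrite /= /Top ?namulr0 ?namul0r ?addr0.
case: w => [[b|] [|i [|j [|y s]]]] wn //; first 1 last.
- by case: (wn i).
- pose br k i j := nfable_scale k (nfable_word (Some c, [:: i; j; z])).
  case: c {zero} br => br.
    apply: nfable_eq (br 2%:R^-1 i j) => B VB a.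
    by rewrite /wval /= -(bracT h2 VB).
  (* The product of the first two letters is half its bracket plus half the Jordan product; the
     latter becomes two brackets by [jord_bracR]. *)
  pose R k i j l := nfable_scale k (nfable_word (Some false, [:: i; j; l])).
  apply: nfable_eq (nfable_add (R 2%:R^-1 i j z)
    (nfable_add (R (- 2%:R^-1) z i j) (R (- 2%:R^-1) z j i))) => B VB a.
  rewrite /wval /=; have := jord_bracR h2 VB (a z) (a i) (a j).
  rewrite /brac !namulE => e.
  by lc (2%:R^-1) e; lmodf F.
- case e : (c == b (+) ~~ odd (size s)); [
    apply: nfable_eq (nfable_word (Some b, [:: i, j, y & rcons s z]))
  | apply: nfable_eq nfable_zero ] => B VB a;
  by rewrite (wop_word VB) e.
Qed.

Lemma normal_form (f : npoly F nat) : nfable (fun B a => neval a f).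
Proof.
elim: f => [i||f IHf g IHg|k f IHf|f [L fL] g [M gM]] /=.
- exact: (nfable_word (None, [:: i])).
- exact: nfable_zero.
- exact: nfable_add.
- exact: nfable_scale.
have prod w w' : nfable (fun B a => wval a w ** wval a w').
  have [[i wi]|wn] := pselect (exists i, w = (None, [:: i]));
  have [[j wj]|wn'] := pselect (exists i, w' = (None, [:: i])).
  - by rewrite wi wj; apply: nfable_eq (nfable_word (None, [:: i; j])) => B VB a.
  (* Left multiplication by a variable is T minus R. *)
  - have n' b := @nfable_wop b i w' (fun j e => wn' (ex_intro _ j e)).
    apply: nfable_eq (nfable_add (n' true) (nfable_scale (-1) (n' false))) => B VB a.
    by rewrite wi {1}/wval /= /Top; lmod F.
  - rewrite wj; exact: (@nfable_wop false j w (fun j e => wn (ex_intro _ j e))).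
  - apply: nfable_eq nfable_zero => B VB a.
    have sq := square_squarelike VB.
    case: (wval_square VB a w) => // Sw; case: (wval_square VB a w') => // Sw'.
    exact: (sl_metab sq).
apply: nfable_eq (nfable_sum L (fun p => nfable_sum M (fun q =>
  nfable_scale (p.1 * q.1) (prod p.2 q.2)))) => B VB a.
rewrite fL // gM // /fval.
elim: L {fL} => [|p L IHL]; first by rewrite !big_nil namul0r.
rewrite !big_cons namulDl IHL; congr (_ + _).
elim: M {gM IHL} => [|q M IHM]; first by rewrite !big_nil namulr0.
by rewrite !big_cons namulDr IHM namulZl namulZr scalerA.
Qed.

End NormalForm.

(** Only swaps of distinct letters are assumed, since the sign rule [sg_swap] is false for equal
    ones. The head of [s] is moved to the front of [t], one swap at a time. *)
Lemma adjacent_swap_perm (T : eqType) (X : Type) (f : seq T -> X) (s t : seq T) :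
  (forall s1 x y s2, x != y -> f (s1 ++ x :: y :: s2) = f (s1 ++ y :: x :: s2)) ->
  perm_eq s t -> f s = f t.
Proof.
move=> fswap st; rewrite -[s]/([::] ++ s) -[t]/([::] ++ t).
elim: s t [::] st => [|x s IHs] t p st.
  by rewrite perm_sym in st; rewrite (perm_nilP st).
have xt : x \in t by rewrite -(perm_mem st) mem_head.
case/splitPr: xt st => t1 t2 st.
have {}st : perm_eq s (t1 ++ t2).
  by rewrite -(perm_cons x) (perm_trans st) // perm_catC /= perm_cons perm_catC.
have -> : f (p ++ t1 ++ x :: t2) = f (rcons p x ++ t1 ++ t2).
  elim/last_ind: t1 t2 {st} => [|t1 y IHt] t2; first by rewrite cat_rcons.
  rewrite !cat_rcons catA; have [<-|xy] := eqVneq x y; last first.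
    by rewrite fswap 1?eq_sym // -catA IHt cat_rcons.
  by rewrite -catA IHt cat_rcons.
by rewrite -cat_rcons; exact: IHs.
Qed.

(** * Signed words and their dependence on a few letters *)

Section Sign.
Variable F : fieldType.

Fixpoint sg (s : seq nat) : F :=
  if s is x :: s' then (-1) ^+ count (fun y => (y < x)%N) s' * sg s' else 1.

Lemma sg_swap s1 x y s2 : x != y -> sg (s1 ++ x :: y :: s2) = - sg (s1 ++ y :: x :: s2).
Proof.
move=> xy; elim: s1 => [|z s1 IHs] /=; last first.
  rewrite IHs mulrN; congr (- (_ ^+ _ * _)); rewrite !count_cat /=; lia.
rewrite !mulrA -mulNr -!exprD; congr (_ * _).
have [xly|ylx|xy'] := ltngtP x y; last by rewrite xy' eqxx in xy.
  by rewrite add0n add1n addSn exprS mulN1r addnC opprK.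
by rewrite add0n add1n addSn exprS mulN1r addnC.
Qed.

Lemma sg_swap_far s1 x s2 y s3 : uniq (x :: y :: s2) ->
  sg (s1 ++ x :: s2 ++ y :: s3) = - sg (s1 ++ y :: s2 ++ x :: s3).
Proof.
elim: s2 s1 => [|z s2 IHs] s1 /=.
  by rewrite andbT mem_seq1 => xy; rewrite sg_swap.
rewrite !inE !negb_or => /and4P[/and3P[xy xz xs] /andP[yz ys] zs s2u].
rewrite sg_swap // -(cat_rcons z) IHs /= ?inE ?negb_or ?xy ?xs ?ys ?s2u //.
by rewrite cat_rcons opprK [in RHS]sg_swap // opprK.
Qed.

Lemma sg_sq s : sg s * sg s = 1.
Proof.
elim: s => [|x s IHs] /=; first by rewrite mulr1.
by rewrite mulrACA IHs mulr1 -expr2 -exprM mulnC exprM sqrrN expr1n expr1n.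
Qed.

End Sign.

Section Words.
Variables (F : fieldType) (h2 : 2%:R != 0 :> F) (B : naAlgType F) (VB : V B).
Variable y : nat -> B.

(** The sign of the arrangement turns the skew symmetries of words into symmetries, to which
    [adjacent_swap_perm] applies. *)
Definition psi (b : bool) (h : seq nat) : B := sg F h *: kval (Some b) (map y h).

Lemma psiK b h : kval (Some b) (map y h) = sg F h *: psi b h.
Proof. by rewrite /psi scalerA sg_sq scale1r. Qed.

Lemma psi_swap0 b i j s : i != j -> psi b (i :: j :: s) = psi b (j :: i :: s).
Proof.
move=> ij; rewrite /psi (sg_swap F [::]) //= scaleNr -scalerN; congr (_ *: _).
case: s => [|z s] /=; first by rewrite oppr0.
by rewrite -wfoldN; congr wfold; rewrite brac_sym wopN opprK.
Qed.

Lemma psi_swap b i j s1 x z s2 : x != z -> b (+) odd (size s1) || (s2 != [::]) ->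
  psi b [:: i, j & s1 ++ x :: z :: s2] = psi b [:: i, j & s1 ++ z :: x :: s2].
Proof.
move=> xz c; rewrite /psi -[in LHS](cat1s i) -(cat1s j) !catA (sg_swap F) //.
rewrite scaleNr -scalerN; congr (_ *: _).
have sq := square_squarelike VB.
have kE s : s != [::] -> kval (Some b) (map y [:: i, j & s]) = wfold b (brac (y i) (y j)) (map y s).
  by case: s.
rewrite !kE; try by case: (s1).
rewrite !map_cat /= (wfold_swap h2 VB sq) ?opprK //; first exact: (W_brac sq).
by rewrite size_map; case: (s2) c.
Qed.

(** The condition on [b] says that the last operator is R, so the final pair R T excluded in
    [wfold_swap] does not occur. *)
Lemma psi_permR b i j s s' : perm_eq s s' -> b = ~~ odd (size s) ->
  psi b [:: i, j & s] = psi b [:: i, j & s'].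
Proof.
move=> ss' bs.
pose f s := if size s == size s' then psi b [:: i, j & s] else 0.
have := @adjacent_swap_perm _ _ f s s' _ ss'; rewrite /f (perm_size ss') eqxx; apply.
move=> s1 x z s2 xz; rewrite !size_cat /=; case: eqP => // e; apply: psi_swap => //.
case: s2 e => [|t s2] /= e; last by rewrite orbT.
by rewrite bs (perm_size ss') -e addn2 /= negbK orbF; case: (odd _).
Qed.

Lemma psi_permT b i j m m' u : perm_eq m m' ->
  psi b [:: i, j & rcons m u] = psi b [:: i, j & rcons m' u].
Proof.
move=> mm'; apply: (@adjacent_swap_perm _ _ (fun m => psi b [:: i, j & rcons m u])) => //.
move=> s1 x z s2 xz; rewrite -!cats1 -!catA /= psi_swap //.
by rewrite orbC; case: (s2).
Qed.

Variable n : nat.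
Let N := iota 0 n.

(** The common value of the signed words with prescribed first letters, and for [KT] prescribed last
    letter; the increasing order of the other letters is an arbitrary choice. *)
Definition KR b i j := psi b [:: i, j & rem j (rem i N)].
Definition KT b i j u := psi b [:: i, j & rcons (rem u (rem j (rem i N))) u].

Lemma perm_rem2 i j s : perm_eq [:: i, j & s] N -> perm_eq s (rem j (rem i N)).
Proof.
move=> p; rewrite -(perm_cons j) -(perm_cons i).
have iN : i \in N by rewrite -(perm_mem p) mem_head.
have jN : j \in rem i N.
  have u : uniq [:: i, j & s] by rewrite (perm_uniq p) iota_uniq.
  rewrite mem_rem_uniq ?iota_uniq // inE -(perm_mem p) !inE eqxx orbT andbT.
  by case/andP: u; rewrite inE negb_or eq_sym => /andP[].
by rewrite (perm_trans p) // (perm_trans (perm_to_rem iN)) // perm_cons perm_to_rem.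
Qed.

Lemma psi_KR b i j s : perm_eq [:: i, j & s] N -> b = ~~ odd n ->
  psi b [:: i, j & s] = KR b i j.
Proof.
move=> p bn; apply: psi_permR; first exact: perm_rem2.
by have := perm_size p; rewrite size_iota bn => <- /=; rewrite negbK.
Qed.

Lemma psi_KT b i j m u : perm_eq [:: i, j & rcons m u] N ->
  psi b [:: i, j & rcons m u] = KT b i j u.
Proof.
move=> p; apply: psi_permT; have := perm_rem2 p => q.
have uN : u \in rem j (rem i N) by rewrite -(perm_mem q) mem_rcons mem_head.
rewrite -(perm_cons u) -(perm_rcons u) (perm_trans q) //; exact: perm_to_rem.
Qed.

End Words.

(** * Multilinear identities *)

Section Decompositions.
Variables (F : fieldType) (h2 : 2%:R != 0 :> F) (M : lmodType F).

(** A symmetric function on the edges of a complete graph whose alternating sums along four-cycles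
    vanish is a sum of vertex values. On a triangle these are forced: the value at [a] is half of
    [K a b + K a c - K b c]. The value at any further vertex is read off its triangle with [a] and
    [b]. *)
Lemma edge_decomposition (N : seq nat) (K : nat -> nat -> M) : uniq N ->
  (2 < size N)%N ->
  (forall i j, i != j -> K i j = K j i) ->
  (forall x y z u, {subset [:: x; y; z; u] <= N} -> uniq [:: x; y; z; u] ->
     K x y - K x z - K u y + K u z = 0) ->
  exists lam : nat -> M, forall i j, i \in N -> j \in N -> i != j ->
    K i j = lam i + lam j.
Proof.
case: N => [|a [|b [|c N]]] //= uN _ Ks K4.
have [ab ac bc] : [/\ a != b, a != c & b != c].
  by case/and3P: uN; rewrite !inE !negb_or => /and3P[-> -> _] /andP[-> _] _.
set NN := [:: a, b, c & N] in K4 *.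
have [aN bN cN] : [/\ a \in NN, b \in NN & c \in NN].
  by rewrite !inE !eqxx !orbT.
have cyc x y z u : x \in NN -> y \in NN -> z \in NN -> u \in NN ->
    uniq [:: x; y; z; u] -> K x y - K x z - K u y + K u z = 0.
  move=> xN yN zN wN un; apply: K4 => // v.
  by rewrite !inE => /or4P[] /eqP ->.
pose lam i := 2%:R^-1 *: (if i == a then K a b + K a c - K b c
   else if i == b then K a b + K b c - K a c else K i a + K i b - K a b).
exists lam.
have lamab : K a b = lam a + lam b.
  by rewrite /lam !eqxx eq_sym (negbTE ab); lmodf F.
have lama i : i \in NN -> i != a -> i != b -> K i a = lam i + lam a.
  move=> iN ia ib; rewrite /lam !eqxx (negbTE ia) (negbTE ib).
  have [->|ic] := eqVneq i c.
    by rewrite (Ks c a) 1?eq_sym // (Ks c b) 1?eq_sym //; lmodf F.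
  have := cyc i a b c iN aN bN cN.
  rewrite /= !inE !negb_or ia ib ic ab ac bc => /(_ isT).
  rewrite (Ks c a) 1?eq_sym // (Ks c b) 1?eq_sym // => e.
  by lc (2%:R^-1) e; lmodf F.
have lamb i : i \in NN -> i != a -> i != b -> K i b = lam i + lam b.
  move=> iN ia ib; rewrite /lam !eqxx (negbTE ia) (negbTE ib) eq_sym (negbTE ab).
  have [->|ic] := eqVneq i c.
    by rewrite (Ks c a) 1?eq_sym // (Ks c b) 1?eq_sym //; lmodf F.
  have := cyc i a b c iN aN bN cN.
  rewrite /= !inE !negb_or ia ib ic ab ac bc => /(_ isT).
  rewrite (Ks c a) 1?eq_sym // (Ks c b) 1?eq_sym // => e.
  by lc (- 2%:R^-1) e; lmodf F.
move=> i j iN jN ij.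
have [eia|ia] := eqVneq i a.
  have [ejb|jb] := eqVneq j b; first by rewrite eia ejb.
  by rewrite eia in ij *; rewrite Ks // addrC lama // eq_sym.
have [eib|ib] := eqVneq i b.
  have [eja|ja] := eqVneq j a; first by rewrite eib eja Ks 1?eq_sym // addrC.
  by rewrite eib in ij *; rewrite Ks // addrC lamb // eq_sym.
have [eja|ja] := eqVneq j a; first by rewrite eja lama.
have [ejb|jb] := eqVneq j b; first by rewrite ejb lamb.
have u1 : uniq [:: i; j; a; b].
  by rewrite /= !inE !negb_or ij ia ib ja jb ab.
have u2 : uniq [:: i; j; b; a].
  by rewrite /= !inE !negb_or ij ia ib ja jb eq_sym ab.
have e1 := cyc i j a b iN jN aN bN u1; have e2 := cyc i j b a iN jN bN aN u2.
move: e1 e2; rewrite (Ks b a) 1?eq_sym // (Ks a j) 1?eq_sym // (Ks b j) 1?eq_sym // => e1 e2.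
rewrite /lam (negbTE ia) (negbTE ib) (negbTE ja) (negbTE jb).
by lc (2%:R^-1) e1; lc (2%:R^-1) e2; lmodf F.
Qed.

Variables (n : nat) (K : nat -> nat -> nat -> M).
Hypothesis Ksym : forall i j u, i != j -> K i j u = K j i u.

Definition Kskew i j u := K i j u - K i u j.

Definition Ksum y x1 x2 x3 := Kskew y x1 x2 + Kskew y x2 x3 + Kskew y x3 x1.

(* [Kskew y] is read as a 1-cochain whose coboundary does not depend on [y]. *)
Lemma triple_decomposition : (4 < n)%N ->
  (forall x1 x2 x3 y1 y2, all (gtn n) [:: x1; x2; x3; y1; y2] ->
     uniq [:: x1; x2; x3; y1; y2] -> Ksum y1 x1 x2 x3 = Ksum y2 x1 x2 x3) ->
  exists (S : nat -> nat -> nat -> M) (C : nat -> nat -> M),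
   [/\ forall i j u, all (gtn n) [:: i; j; u] -> uniq [:: i; j; u] ->
         K i j u = S i j u + C i u + C j u,
       forall i j u, all (gtn n) [:: i; j; u] -> uniq [:: i; j; u] -> S i j u = S j i u
     & forall i j u, all (gtn n) [:: i; j; u] -> uniq [:: i; j; u] -> S i j u = S i u j].
Proof.
move=> n4 R.
have R' x1 x2 x3 y1 y2 : all (gtn n) [:: x1; x2; x3; y1; y2] ->
    uniq [:: x1; x2; x3; y1] -> uniq [:: x1; x2; x3; y2] ->
    Ksum y1 x1 x2 x3 = Ksum y2 x1 x2 x3.
  have [->//|y12] := eqVneq y1 y2; move=> lt u1 u2; apply: R => //.
  by move: u1 u2 y12; rewrite /= !inE !negb_or; lia.
(* An index different from 0, 1 and [j], hence admissible as the parameter of the coboundary on 0,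
   [j], 1. *)
pose w j := if j == 2%N then 3%N else 2%N.
(* Let [omega] be the common coboundary. The 1-cochain sending [j, u] to
   [omega(0, j, u) - Kskew 0 j u] is closed, hence the coboundary of a function, here obtained as a
   cone from the base point 1; this is the assertion [om]. *)
pose E j := Kskew 0%N j 1%N - Ksum (w j) 0%N j 1%N.
pose C i j : M := if i == 0%N then - E j else if j == 0%N then - E i
  else - E i - Kskew i j 0%N.
have key i j u : all (gtn n) [:: i; j; u] -> uniq [:: i; j; u] ->
    Kskew i j u = C i u + C j u - C i j - C u j.
  move=> /= lt un; have [ij iu ju] : [/\ i != j, i != u & j != u].
    by move: un; rewrite !inE !negb_or => /and3P[/andP[-> ->] -> _].
  rewrite /C; have [i0|i0] := eqVneq i 0%N.
    rewrite -i0 ![_ == i]eq_sym (negbTE ij) (negbTE iu) /Kskew.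
    rewrite (@Ksym u j) 1?eq_sym // (@Ksym u i) 1?eq_sym // (@Ksym j i) 1?eq_sym //.
    by lmod F.
  have [j0|j0] := eqVneq j 0%N.
    by rewrite -j0 [u == j]eq_sym (negbTE ju) /Kskew; lmod F.
  have [u0|u0] := eqVneq u 0%N.
    by rewrite -u0 /Kskew; lmod F.
  have cycl : Kskew u j 0%N - Kskew j u 0%N = Kskew 0%N j u.
    by rewrite /Kskew (@Ksym u j) 1?eq_sym // (@Ksym u 0%N) // (@Ksym j 0%N) //; lmod F.
  have om : Ksum i 0%N j u = E u - E j + Kskew 0%N j u.
    have [j1|j1] := eqVneq j 1%N.
      rewrite (R' _ _ _ _ (w u)) /E; first last.
      + by rewrite /w /= !inE; case: (_ =P 2%N); lia.
      + by rewrite /= !inE; lia.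
      + by rewrite /w /=; case: (_ =P 2%N); lia.
      by rewrite j1 /Ksum /Kskew; lmod F.
    have [u1|u1] := eqVneq u 1%N.
      rewrite (R' _ _ _ _ (w j)) /E; first last.
      + by rewrite /w /= !inE; case: (_ =P 2%N); lia.
      + by rewrite /= !inE; lia.
      + by rewrite /w /=; case: (_ =P 2%N); lia.
      by rewrite u1 /Ksum /Kskew; lmod F.
    (* More than four indices leave one outside 0, 1, [j], [u]; with it as parameter all faces of
       the tetrahedron on these four points are values of one coboundary. *)
    pose v := (if (j != 2) && (u != 2) then 2 else if (j != 3) && (u != 3) then 3 else 4)%N.
    have [vn v0 v1 [vj vu]] : [/\ (v < n)%N, v != 0%N, v != 1%N & v != j /\ v != u].
      rewrite /v; do !case: ifP; move: ju n4; clear; repeat split; lia.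
    rewrite (R' _ _ _ _ v) /E; first last.
    + by rewrite /= !inE; lia.
    + by rewrite /= !inE; lia.
    + by rewrite /=; lia.
    rewrite (R' 0%N u 1%N (w u) v); first last.
    + by rewrite /= !inE; lia.
    + by rewrite /w /= !inE; case: (_ =P 2%N); lia.
    + by rewrite /w /=; case: (_ =P 2%N); lia.
    rewrite (R' 0%N j 1%N (w j) v); first last.
    + by rewrite /= !inE; lia.
    + by rewrite /w /= !inE; case: (_ =P 2%N); lia.
    + by rewrite /w /=; case: (_ =P 2%N); lia.
    (* The face opposite to 0 may be computed with parameter 0 instead, which brings in
       [Kskew 0]. *)
    have e : Ksum v j u 1%N = Ksum 0%N j u 1%N.
      by apply: R'; rewrite /= ?inE; lia.
    by lc 1 e; rewrite /Ksum /Kskew; lmod F.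
  lc 1 om; lc (-1) cycl; rewrite /Ksum /Kskew; lmod F.
exists (fun i j u => K i j u - C i u - C j u), C; split=> i j u lt un.
- by lmod F.
- by rewrite Ksym 1?addrAC //; case/and3P: un; rewrite inE negb_or => /andP[].
- have := key i j u lt un; rewrite /Kskew => e; lc 1 e; lmod F.
Qed.

(** Up to symmetry there are three values, and each is carried by one of its two [C] terms; no
    symmetric part and no relation is required. *)
Lemma triple_decomposition3 :
  exists C : nat -> nat -> M, forall i j u, all (gtn 3) [:: i; j; u] ->
    uniq [:: i; j; u] -> K i j u = C i u + C j u.
Proof.
exists (fun i u => if (i == 0%N) && (u == 2%N) then K 0 1 2
   else if (i == 0%N) && (u == 1%N) then K 0 2 1 else
   if (i == 1%N) && (u == 0%N) then K 1 2 0 else 0).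
move=> i j u /= /and4P[]; rewrite !ltnS => il jl ul _.
case: i il => [|[|[|i]]] // _; case: j jl => [|[|[|j]]] // _;
  case: u ul => [|[|[|u]]] // _ _ /=; rewrite ?addr0 ?add0r // Ksym //.
Qed.

End Decompositions.

(** * Multilinearity of words and polarized relations *)

Section Multilinear.
Variables (F : fieldType) (B : naAlgType F).

Lemma wfoldDz b (w : B) s1 x y s2 :
  wfold b w (s1 ++ (x + y) :: s2) = wfold b w (s1 ++ x :: s2) + wfold b w (s1 ++ y :: s2).
Proof.
rewrite !wfold_cat /= -wfoldD; congr wfold.
by rewrite -[x]scale1r wop_linl !scale1r.
Qed.

Lemma bracDl (x x' y : B) : brac (x + x') y = brac x y + brac x' y.
Proof. by rewrite /brac namulDl namulDr; lmod F. Qed.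
Lemma bracDr (x y y' : B) : brac x (y + y') = brac x y + brac x y'.
Proof. by rewrite /brac namulDl namulDr; lmod F. Qed.

Lemma kvalD k (s1 s2 : seq B) x y :
  kval k (s1 ++ (x + y) :: s2) = kval k (s1 ++ x :: s2) + kval k (s1 ++ y :: s2).
Proof.
case: k => [b|].
  case: s1 => [|u [|v s1]] /=.
  - case: s2 => [|z [|t s2]] /=; rewrite ?addr0 // -wfoldD -[brac x z]scale1r.
    by rewrite bracDl -{1}[brac x z]scale1r !wop_lin !scale1r.
  - case: s2 => [|t s2] /=; rewrite ?addr0 // -wfoldD.
    by rewrite bracDr -{1}[brac u x]scale1r !wop_lin !scale1r.
  - by case: s1 => [|t s1] /=; [exact: (wfoldDz b _ [::]) | exact: (wfoldDz b _ (t :: s1))].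
case: s1 => [|u [|v [|t s1]]] /=; rewrite ?addr0 //.
- by case: s2 => [|z [|t s2]] //=; rewrite ?namulDl ?addr0.
- by case: s2 => [|z s2] //=; rewrite ?namulDr ?addr0.
Qed.

Lemma kval0 k (s1 s2 : seq B) : kval k (s1 ++ 0 :: s2) = 0.
Proof.
by apply: (@addrI _ (kval k (s1 ++ 0 :: s2))); rewrite -kvalD !addr0.
Qed.

End Multilinear.

Section Relations.
Variables (F : fieldType) (h2 : 2%:R != 0 :> F) (B : naAlgType F) (VB : V B).

(* the identity with index [k], see [neval_chain_identity] *)
Definition chainw (k : nat) := forall (x y : B) (Z : seq B), size Z = k.-1.*2 ->
  kval (Some true) [:: x, y, y & Z ++ [:: x; x]] = 0.

Lemma trilinear_polarization (f : B -> B -> B -> B) :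
  (forall x x' y z, f (x + x') y z = f x y z + f x' y z) ->
  (forall x y y' z, f x (y + y') z = f x y z + f x y' z) ->
  (forall x y z z', f x y (z + z') = f x y z + f x y z') ->
  (forall x, f x x x = 0) -> forall x y z,
  f x y z + f y x z + (f x z y + f z y x) + (f y z x + f z x y) = 0.
Proof.
move=> f1 f2 f3 f0 x y z.
have e := f0 (x + y + z); have exy := f0 (x + y); have exz := f0 (x + z).
have eyz := f0 (y + z); have ex := f0 x; have ey := f0 y; have ez := f0 z.
move: e exy exz eyz; rewrite !f1 !f2 !f3 => e exy exz eyz.
by lc 1 e; lc (-1) exy; lc (-1) exz; lc (-1) eyz; lc 1 ex; lc 1 ey; lc 1 ez; lmod F.
Qed.

Lemma chainw_polarized k (x1 x2 x3 y1 y2 : B) Z : chainw k -> size Z = k.-1.*2 ->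
  let f y1 y2 x1 x2 x3 := kval (Some true) [:: x1, y1, y2 & Z ++ [:: x2; x3]] in
  let g x1 x2 x3 := f y1 y2 x1 x2 x3 + f y2 y1 x1 x2 x3 in
  g x1 x2 x3 + g x2 x1 x3 + (g x1 x3 x2 + g x3 x2 x1) + (g x2 x3 x1 + g x3 x1 x2) = 0.
Proof.
move=> ck sZ f g.
have D1 y y' x x' : forall u v, f y y' (x + x') u v = f y y' x u v + f y y' x' u v.
  by move=> u v; exact: (kvalD _ [::]).
have D2 y y' x x' : forall u v, f y y' u (x + x') v = f y y' u x v + f y y' u x' v.
  by move=> u v; exact: (kvalD _ [:: u, y, y' & Z]).
have D3 y y' x x' : forall u v, f y y' u v (x + x') = f y y' u v x + f y y' u v x'.
  move=> u v; have := kvalD (Some true) [:: u, y, y' & Z ++ [:: v]] [::] x x'.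
  by rewrite /= -!catA.
have D4 y y' y'' : forall u v w, f (y + y') y'' u v w = f y y'' u v w + f y' y'' u v w.
  by move=> u v w; exact: (kvalD _ [:: u]).
have D5 y y' y'' : forall u v w, f y'' (y + y') u v w = f y'' y u v w + f y'' y' u v w.
  by move=> u v w; exact: (kvalD _ [:: u; y'']).
apply: trilinear_polarization => [x x' y z|x x' y z|x x' y z|x]; rewrite /g.
- by rewrite !D1 addrACA.
- by rewrite !D2 addrACA.
- by rewrite !D3 addrACA.
have e := ck x (y1 + y2) Z sZ; have e1 := ck x y1 Z sZ; have e2 := ck x y2 Z sZ.
move: e e1 e2; rewrite -!/(f _ _ x x x) !D4 !D5 => e e1 e2.
by lc 1 e; lc (-1) e1; lc (-1) e2; lmod F.
Qed.

Variable y : nat -> B.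
Local Notation psi := (psi y).

(** The relation [brac_RTR] with signs absorbed. It is the four-cycle condition of
    [edge_decomposition] for the cycle with edges [ab], [ac], [dc], [db]. *)
Lemma psi_R4 a b c d s : uniq [:: a; b; c; d] -> s != [::] ->
  psi false [:: a, b, c, d & s] - psi false [:: a, c, b, d & s]
  - psi false [:: d, b, c, a & s] + psi false [:: d, c, b, a & s] = 0.
Proof.
move=> un; case: s => // t s _.
have [ab ac ad [bc bd cd]] : [/\ a != b, a != c, a != d & [/\ b != c, b != d & c != d]].
  by move: un; rewrite /= !inE !negb_or => /and4P[/and3P[-> -> ->] /andP[-> ->] -> _].
have e1 : sg F [:: a, c, b, d, t & s] = - sg F [:: a, b, c, d, t & s].
  by rewrite (sg_swap F [:: a]) 1?eq_sym.
have e2 : sg F [:: d, b, c, a, t & s] = - sg F [:: a, b, c, d, t & s].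
  rewrite (@sg_swap_far F [::] d [:: b; c] a (t :: s)) //.
  by rewrite /= !inE !negb_or; move: ab ac ad bc bd cd; lia.
have e3 : sg F [:: d, c, b, a, t & s] = sg F [:: a, b, c, d, t & s].
  by rewrite (sg_swap F [:: d]) 1?eq_sym // -[RHS]opprK -e2.
rewrite /psi e1 e2 e3.
have kE i j k l : kval (Some false) (map y [:: i, j, k, l, t & s]) =
  wfold true (Top (y l) (brac (y i) (y j) ** y k) ** y t) (map y s) by [].
rewrite !{}kE.
have := brac_RTR h2 VB (square_squarelike VB) (y a) (y b) (y c) (y d) (y t).
set p1 := Top _ _ ** _; set p2 := Top _ _ ** _; set p3 := Top _ _ ** _.
set p4 := Top _ _ ** _ => e.
have : wfold true (p1 + p2 + (p3 + p4)) (map y s) = 0 by rewrite e wfold0.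
by rewrite !wfoldD => e'; lc (sg F [:: a, b, c, d, t & s]) e'; lmod F.
Qed.

(** Exchanging [y1] and [y2] changes the sign of the arrangement, so polarization in [y] equates two
    sums. In terms of the symmetric [K], the sum [g y1 y2] is [Ksum y1 x1 x2 x3]; this is the
    hypothesis of [triple_decomposition]. *)
Lemma psi_chain k x1 x2 x3 y1 y2 Z : chainw k -> size Z = k.-1.*2 ->
  uniq [:: x1, x2, x3, y1, y2 & Z] ->
  let f y1 y2 x1 x2 x3 := psi true [:: x1, y1, y2 & Z ++ [:: x2; x3]] in
  let g y1 y2 := f y1 y2 x1 x3 x2 - f y1 y2 x2 x3 x1 + (f y1 y2 x2 x1 x3 - f y1 y2 x3 x1 x2)
    + (f y1 y2 x3 x2 x1 - f y1 y2 x1 x2 x3) in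
  g y1 y2 = g y2 y1.
Proof.
move=> ck sZ un f g.
have := chainw_polarized (y x1) (y x2) (y x3) (y y1) (y y2) ck (_ : size (map y Z) = _).
rewrite size_map => /(_ sZ).
pose S y1 y2 x1 x2 x3 := sg F [:: x1, y1, y2 & Z ++ [:: x2; x3]].
have fE a b c d e : kval (Some true) [:: y c, y a, y b & map y Z ++ [:: y d; y e]] =
  S a b c d e *: f a b c d e.
  by rewrite -psiK /= map_cat.
cbv beta zeta; rewrite !fE; set s := S y1 y2 x1 x2 x3.
have [x12 x13 x23 y12] : [/\ x1 != x2, x1 != x3, x2 != x3 & y1 != y2].
  by move: un; rewrite /= !inE !negb_or => /and5P[/and5P[-> -> _ _ _] /and4P[-> _ _ _] _ /andP[-> _] _].
have xZ i : i \in [:: x1; x2; x3] -> i \notin [:: y1, y2 & Z].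
  move: un; rewrite -[[:: x1, x2 & _]]/([:: x1; x2; x3] ++ [:: y1, y2 & Z]) cat_uniq.
  by case/and3P=> _ /hasPn h _ xi; apply/negP => /h; rewrite /= xi.
have yZ : uniq [:: y1, y2 & Z] by case/and4P: un.
have Sy c d e : S y2 y1 c d e = - S y1 y2 c d e.
  by apply: (sg_swap F [:: c]); rewrite eq_sym.
have S23 c d e : d != e -> S y1 y2 c e d = - S y1 y2 c d e.
  move=> de; have := @sg_swap F [:: c, y1, y2 & Z] e d [::]; rewrite eq_sym; exact.
have S12 c d e : c \in [:: x1; x2; x3] -> d \in [:: x1; x2; x3] -> c != d ->
    S y1 y2 d c e = - S y1 y2 c d e.
  move=> cx dx cd; apply: (@sg_swap_far F [::] d [:: y1, y2 & Z] c [:: e]).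
  by rewrite -2![_ :: _ :: _]/(_ :: _) cons_uniq cons_uniq inE negb_or eq_sym cd !xZ.
have i1 : x1 \in [:: x1; x2; x3] by rewrite !inE eqxx.
have i2 : x2 \in [:: x1; x2; x3] by rewrite !inE eqxx orbT.
have i3 : x3 \in [:: x1; x2; x3] by rewrite !inE eqxx !orbT.
rewrite !Sy (S12 _ _ x3 i1 i2 x12) (S23 x1 x2 x3 x23).
rewrite (S12 _ _ x1 i2 i3 x23) (S23 x2 x1 x3 x13) (S12 _ _ x3 i1 i2 x12).
rewrite (S12 _ _ x2 i1 i3 x13) (S23 x1 x2 x3 x23) -/s => e.
have ss : s * s = 1 by exact: sg_sq.
have e' : s *: (s *: (g y1 y2 - g y2 y1)) = 0.
  by rewrite [s *: (_ - _)](_ : _ = 0) ?scaler0 // /g; lc (-1) e; lmod F.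
by apply/eqP; rewrite -subr_eq0 -[X in X == _]scale1r -ss -scalerA e'.
Qed.

End Relations.

(** After exchanging the sums, [Phi k] carries the total coefficient of the indices having the key
    [k]. *)
Lemma sum_by_keys (F : fieldType) (M : lmodType F) (I K : eqType)
    (r : seq I) (g : I -> F) (keys : I -> seq K) (Phi : K -> M) :
  (forall i, uniq (keys i)) ->
  (forall i k, i \in r -> k \in keys i -> \sum_(j <- r | k \in keys j) g j = 0) ->
  \sum_(i <- r) g i *: (\sum_(k <- keys i) Phi k) = 0.
Proof.
move=> ku g0; pose U := undup (flatten (map keys r)).
have sumU i : i \in r -> \sum_(k <- keys i) Phi k = \sum_(k <- U | k \in keys i) Phi k.
  move=> ir; rewrite -[RHS]big_filter; apply: perm_big.
  apply: uniq_perm => //; first by rewrite filter_uniq ?undup_uniq.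
  move=> k; rewrite mem_filter; case ki: (k \in keys i) => //=.
  by rewrite mem_undup; apply/esym/flatten_mapP; exists i.
transitivity (\sum_(i <- r) \sum_(k <- U | k \in keys i) g i *: Phi k).
  by rewrite !big_seq; apply: eq_bigr => i ir; rewrite sumU // scaler_sumr.
rewrite (exchange_big_dep predT) //= big1_seq // => k /andP[_].
rewrite mem_undup => /flatten_mapP[i ir ki].
by rewrite -scaler_suml (g0 i) ?scale0r.
Qed.

(** The keys serve the words of shape T..R ([keyP]), R..R ([keyV]), R..T ([keyC]) and T..T ([keyC]
    together with [keyT]). Removing duplicates makes the lists of keys duplicate-free for degenerate
    words too, as [sum_by_keys] requires. *)
Definition keyP (h : seq nat) :=
  [:: (minn (nth 0%N h 0) (nth 0%N h 1), maxn (nth 0%N h 0) (nth 0%N h 1))].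
Definition keyV (h : seq nat) := undup [:: nth 0%N h 0; nth 0%N h 1].
Definition keyC (h : seq nat) :=
  undup [:: (nth 0%N h 0, last 0%N h); (nth 0%N h 1, last 0%N h)].
Definition keyT (h : seq nat) :=
  [:: sort leq [:: nth 0%N h 0; nth 0%N h 1; last 0%N h]].

Definition key_vanish (F : fieldType) (K : eqType) (r : seq (F * seq nat))
    (keys : seq nat -> seq K) :=
  forall p k, p \in r -> k \in keys p.2 ->
    \sum_(q <- r | k \in keys q.2) q.1 * sg F q.2 = 0.

(** * Vanishing of multilinear combinations from sums over keys *)

Section MultilinearPart.
Variables (F : fieldType) (h2 : 2%:R != 0 :> F) (B : naAlgType F) (VB : V B).
Variables (n : nat) (r : seq (F * seq nat)).
Hypotheses (n3 : (2 < n)%N) (rP : forall p, p \in r -> perm_eq p.2 (iota 0 n)).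
Variable y : nat -> B.

Variant rspec : seq nat -> Type :=
  RSpec i j m u of uniq [:: i; j; u] & all (gtn n) [:: i; j; u] &
    perm_eq [:: i, j & rcons m u] (iota 0 n) : rspec [:: i, j & rcons m u].

Lemma rPs p : p \in r -> rspec p.2.
Proof.
move=> /rP; move: p.2 => {p} h pn; have := perm_size pn; rewrite size_iota.
case: h pn => [|i [|j s]] pn //=; try by lia.
case/lastP: s pn => [|m u] pn /= sn; first by lia.
have lt v : v \in [:: i, j & rcons m u] -> (v < n)%N by rewrite (perm_mem pn) mem_iota.
apply: (RSpec _ _ pn).
  have : uniq [:: i, j & rcons m u] by rewrite (perm_uniq pn) iota_uniq.
  rewrite /= !inE !mem_rcons !inE !negb_or rcons_uniq.
  by move=> /and3P[/and3P[-> -> _] /andP[-> _] _].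
by rewrite /= !lt // !inE ?mem_rcons ?inE eqxx ?orbT.
Qed.

Lemma kval_psi b : \sum_(p <- r) p.1 *: kval (Some b) (map y p.2) =
  \sum_(p <- r) (p.1 * sg F p.2) *: psi y b p.2.
Proof. by apply: eq_bigr => p _; rewrite psiK scalerA. Qed.

Lemma sum_keys0 (K : eqType) (keys : seq nat -> seq K) (Phi : K -> B) b :
  (forall h, uniq (keys h)) -> key_vanish r keys ->
  (forall p, p \in r -> psi y b p.2 = \sum_(k <- keys p.2) Phi k) ->
  \sum_(p <- r) p.1 *: kval (Some b) (map y p.2) = 0.
Proof.
move=> ku r0 psiE; rewrite kval_psi big_seq.
under eq_bigr => p pr do rewrite psiE //.
by rewrite -big_seq; apply: (sum_by_keys (keys := fun p => keys p.2)).
Qed.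

Lemma undup2 (K : eqType) (a b : K) (f : K -> B) : a != b ->
  \sum_(k <- undup [:: a; b]) f k = f a + f b.
Proof. by move=> ab; rewrite undup_id /= ?inE ?ab // !big_cons big_nil addr0. Qed.

Lemma perm_extend s : uniq s -> all (gtn n) s ->
  {rest | perm_eq (s ++ rest) (iota 0 n)}.
Proof.
move=> us /allP sn; exists [seq x <- iota 0 n | x \notin s].
apply: uniq_perm; rewrite ?iota_uniq //.
  rewrite cat_uniq us filter_uniq ?iota_uniq // andbT /=.
  by apply/hasPn => x; rewrite mem_filter => /andP[].
move=> x; rewrite mem_cat mem_filter mem_iota add0n /=.
by case xs: (x \in s) => //=; have /= -> := sn x xs.
Qed.

Lemma perm_eq_swap2 (T : eqType) (i j : T) s t :
  perm_eq [:: i, j & s] t -> perm_eq [:: j, i & s] t.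
Proof. by apply: perm_trans; rewrite (perm_cat2r s [:: j; i] [:: i; j]) (perm_catC [:: _] [:: _]). Qed.

Lemma KR_sym b i j : b = ~~ odd n -> i != j -> (i < n)%N -> (j < n)%N ->
  KR y n b i j = KR y n b j i.
Proof.
move=> bn ij iln jln; have [||s pn] := @perm_extend [:: i; j].
- by rewrite /= inE ij.
- by rewrite /= iln jln.
by rewrite -(psi_KR h2 VB y pn) // psi_swap0 // (psi_KR h2 VB y (perm_eq_swap2 pn)).
Qed.

Lemma multilinear_TR : ~~ odd n -> key_vanish r keyP ->
  \sum_(p <- r) p.1 *: kval (Some true) (map y p.2) = 0.
Proof.
move=> on r0; apply: (sum_keys0 (Phi := fun k => KR y n true k.1 k.2) _ r0) => // p.
case/rPs=> i j m u un /= /and4P[iln jln _ _] pn; rewrite /keyP big_seq1 /= (psi_KR h2 VB y pn) ?on //.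
by case: (leqP i j) => // ji; apply: KR_sym; rewrite ?on //; case/and3P: un; rewrite inE negb_or => /andP[].
Qed.

Lemma KR_R4 a b c d : odd n -> all (gtn n) [:: a; b; c; d] -> uniq [:: a; b; c; d] ->
  KR y n false a b - KR y n false a c - KR y n false d b + KR y n false d c = 0.
Proof.
move=> on lt un; have [s pn] := perm_extend un lt.
have s0 : s != [::].
  by apply: contraTneq on => s0; rewrite -(size_iota 0 n) -(perm_size pn) s0.
have kr i j k l : perm_eq [:: i; j; k; l] [:: a; b; c; d] ->
    psi y false [:: i, j, k, l & s] = KR y n false i j.
  move=> ijkl; apply: (psi_KR h2 VB); last by rewrite on.
  by apply: perm_trans pn; rewrite -(perm_cat2r s) in ijkl.
by have := psi_R4 h2 VB y un s0; rewrite !kr //; apply/permP => q /=; ring.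
Qed.

Lemma multilinear_RR : odd n -> key_vanish r keyV ->
  \sum_(p <- r) p.1 *: kval (Some false) (map y p.2) = 0.
Proof.
move=> on r0.
have [||i j ij|a b c d N4 un|lam lamE] := @edge_decomposition F h2 B (iota 0 n) (fun i j =>
  if (i < n)%N && (j < n)%N then KR y n false i j else 0).
- exact: iota_uniq.
- by rewrite size_iota.
- by rewrite andbC; case: ifP => // /andP[jn i_n]; apply: KR_sym; rewrite ?on.
- have lt : all (gtn n) [:: a; b; c; d].
    by apply/allP => x /N4; rewrite mem_iota.
  have /= := lt; move=> /and5P[-> -> -> -> _]; exact: KR_R4.
apply: (sum_keys0 (Phi := lam) _ r0) => [h|p]; first exact: undup_uniq.
case/rPs=> i j m u un /= /and4P[iln jln _ _] pn; rewrite (psi_KR h2 VB y pn) ?on //.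
have ij : i != j by case/and3P: un; rewrite inE negb_or => /andP[].
have := lamE i j; rewrite !mem_iota iln jln /= => -> //.
by rewrite /keyV undup2.
Qed.

Lemma KT_sym b i j u : uniq [:: i; j; u] -> all (gtn n) [:: i; j; u] ->
  KT y n b i j u = KT y n b j i u.
Proof.
move=> un lt; have [s pn] := perm_extend un lt.
have pn' : perm_eq [:: i, j & rcons s u] (iota 0 n).
  by apply: perm_trans pn; rewrite -(cat1s u) -cats1 /= !perm_cons perm_catC.
rewrite -(psi_KT h2 VB y _ pn') psi_swap0; last by case/and3P: un; rewrite inE negb_or => /andP[].
by rewrite (psi_KT h2 VB y _ (perm_eq_swap2 pn')).
Qed.

Lemma KT_R4 a b c d u : ~~ odd n -> all (gtn n) [:: a; b; c; d; u] ->
  uniq [:: a; b; c; d; u] ->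
  KT y n false a b u - KT y n false a c u - KT y n false d b u + KT y n false d c u = 0.
Proof.
move=> on lt un; have [s pn] := perm_extend un lt.
have kr i j k l : perm_eq [:: i; j; k; l] [:: a; b; c; d] ->
    psi y false [:: i, j, k, l & rcons s u] = KT y n false i j u.
  move=> ijkl; apply: (@psi_KT _ h2 _ VB y n false i j [:: k, l & s]).
  apply: perm_trans pn; rewrite (_ : _ ++ s = [:: a; b; c; d] ++ u :: s) //.
  rewrite (_ : [:: i, j & _] = [:: i; j; k; l] ++ rcons s u) //.
  by rewrite perm_cat // perm_rcons.
have un4 : uniq [:: a; b; c; d].
  by move: un; rewrite -[[:: a; b; c; d; u]]/(rcons [:: a; b; c; d] u) rcons_uniq => /andP[].
have := @psi_R4 _ h2 _ VB y a b c d (rcons s u) un4; rewrite !kr //; try (apply/permP => q /=; ring).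
by apply; case: (s).
Qed.

Lemma multilinear_C b (C : nat -> nat -> B) : key_vanish r keyC ->
  (forall i j u, all (gtn n) [:: i; j; u] -> uniq [:: i; j; u] ->
    KT y n b i j u = C i u + C j u) ->
  \sum_(p <- r) p.1 *: kval (Some b) (map y p.2) = 0.
Proof.
move=> r0 KC; apply: (sum_keys0 (Phi := fun k => C k.1 k.2) _ r0) => [h|p].
  exact: undup_uniq.
case/rPs=> i j m u un lt pn; rewrite (psi_KT h2 VB y _ pn) KC //.
rewrite /keyC /= last_rcons undup2 //; apply/eqP => -[ij].
by move: un; rewrite ij /= inE eqxx.
Qed.

Lemma multilinear_RT : ~~ odd n -> key_vanish r keyC ->
  \sum_(p <- r) p.1 *: kval (Some false) (map y p.2) = 0.
Proof.
move=> on r0.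
have dec u : {lam : nat -> B | forall i j, all (gtn n) [:: i; j; u] -> uniq [:: i; j; u] ->
    KT y n false i j u = lam i + lam j}.
  apply: cid; have [un|un] := ltnP u n; last first.
    by exists (fun=> 0) => i j /= /and4P[_ _]; rewrite ltnNge un.
  pose c i j := all (gtn n) [:: i; j; u] && uniq [:: i; j; u].
  have [||i j ij|a b c' d N4 uq|lam lamE] := @edge_decomposition F h2 B (rem u (iota 0 n))
    (fun i j => if c i j then KT y n false i j u else 0).
  - by rewrite rem_uniq ?iota_uniq.
  (* An even [n] above 2 leaves at least three indices besides [u], as [edge_decomposition]
     demands. *)
  - rewrite size_rem ?mem_iota ?size_iota //; move: on n3; clear.
    by case: n => [|[|[|[|m]]]].
  - have -> : c j i = c i j by rewrite /c /= !inE; lia.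
    by case: ifP => // /andP[lt uq]; exact: KT_sym.
  - have lt x : x \in [:: a; b; c'; d] -> (x < n)%N /\ (x != u).
      by move=> /N4; rewrite mem_rem_uniq ?iota_uniq // inE mem_iota => /andP[].
    have [[an au] [bn bu] [cn cu] [dn du]] : [/\ (a < n)%N /\ (a != u),
        (b < n)%N /\ (b != u), (c' < n)%N /\ (c' != u) & (d < n)%N /\ (d != u)].
      by split; apply: lt; rewrite !inE eqxx ?orbT.
    have uq' : uniq [:: a; b; c'; d; u] by move: uq; rewrite /= !inE; lia.
    have cT i j : i \in [:: a; b; c'; d] -> j \in [:: a; b; c'; d] -> i != j -> c i j.
      move=> /lt[i_n iu] /lt[jn ju] ij.
      by rewrite /c /= !inE i_n jn un negb_or ij iu ju.
    have [ab ac db dc] : [/\ a != b, a != c', d != b & d != c'].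
      by move: uq; rewrite /= !inE; split; lia.
    rewrite !cT ?inE ?eqxx ?orbT //; apply: KT_R4 => //.
    by rewrite /= an bn cn dn un.
  exists lam => i j lt uq; move: lt (uq) => /= /and4P[i_n jn _ _].
  rewrite !inE negb_or => /and3P[/andP[ij iu] ju _].
  rewrite -lamE ?mem_rem_uniq ?iota_uniq ?inE ?iu ?ju ?mem_iota //.
  by rewrite /c uq /= i_n jn un.
apply: (multilinear_C (C := fun i u => sval (dec u) i)) => // i j u lt uq.
by case: (dec u) => lam /= ->.
Qed.

(** The length counts three letters [x], two letters [y] and the [2 (k - 1)] letters of [Z] in the
    polarized chain identity. The symmetric part of the decomposition is collected by sorted
    triples, the remainder by pairs. *)
Lemma multilinear_TT k : n = (k.*2 + 3)%N -> (0 < k)%N -> chainw B k ->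
  key_vanish r keyC -> key_vanish r keyT ->
  \sum_(p <- r) p.1 *: kval (Some true) (map y p.2) = 0.
Proof.
move=> nk k0 ck rC rT.
pose c i j u := all (gtn n) [:: i; j; u] && uniq [:: i; j; u].
pose K i j u := if c i j u then KT y n true i j u else 0.
have KE i j u : all (gtn n) [:: i; j; u] -> uniq [:: i; j; u] -> K i j u = KT y n true i j u.
  by rewrite /K /c => -> ->.
have [|||S [C [KSC S1 S2]]] := @triple_decomposition F h2 B n K.
- move=> i j u ij; rewrite /K; have -> : c j i u = c i j u by rewrite /c /= !inE; lia.
  by case: ifP => // /andP[lt uq]; exact: KT_sym.
- by rewrite nk; lia.
- move=> x1 x2 x3 y1 y2 lt un; have [Z pn] := perm_extend un lt.
  have sZ : size Z = k.-1.*2.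
    by have := perm_size pn; rewrite size_iota nk /=; lia.
  have uZ : uniq [:: x1, x2, x3, y1, y2 & Z].
    by have := perm_uniq pn; rewrite iota_uniq => ->.
  have kt d e a b z : perm_eq [:: a; d; e; b; z] [:: x1; x2; x3; y1; y2] ->
      psi y true [:: a, d, e & Z ++ [:: b; z]] = KT y n true a d z.
    move=> p5; have -> : [:: a, d, e & Z ++ [:: b; z]] = [:: a, d & rcons (e :: Z ++ [:: b]) z].
      by rewrite -cats1 /= -catA.
    apply: (psi_KT h2 VB); apply: perm_trans pn.
    rewrite (perm_trans _ (_ : perm_eq ([:: a; d; e; b; z] ++ Z) _)) ?perm_cat //.
    apply/permP => q; rewrite /= -cats1 !(count_cat, =^~ cat_cons) /=; lia.
  have Kin i j u : i \in [:: x1; x2; x3; y1; y2] -> j \in [:: x1; x2; x3; y1; y2] ->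
      u \in [:: x1; x2; x3; y1; y2] -> uniq [:: i; j; u] -> K i j u = KT y n true j i u.
    move=> iin jin uin uq; have ltn : all (gtn n) [:: i; j; u].
      move/allP: lt => lt; have {}lt x : x \in [:: x1; x2; x3; y1; y2] -> (x < n)%N by exact: lt.
      by rewrite /= !lt.
    by rewrite KE //; exact: KT_sym.
  have := psi_chain y ck sZ uZ; cbv beta zeta.
  rewrite !kt; try (apply/permP => q /=; ring).
  have neq : [/\ [/\ x1 != x2, x1 != x3 & x2 != x3],
     [/\ y1 != x1, y1 != x2 & y1 != x3] & [/\ y2 != x1, y2 != x2 & y2 != x3]].
    by move: un; rewrite /= !inE; split; split; lia.
  case: neq => [[a1 a2 a3] [b1 b2 b3] [c1 c2 c3]].
  rewrite /Ksum /Kskew !Kin ?inE ?eqxx ?orbT //=; rewrite ?inE; try lia.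
pose S' k := S (nth 0%N k 0) (nth 0%N k 1) (nth 0%N k 2).
have psiE p : p \in r -> psi y true p.2 =
    \sum_(k <- keyT p.2) S' k + \sum_(k <- keyC p.2) C k.1 k.2.
  case/rPs=> i j m u un lt pn; rewrite (psi_KT h2 VB y _ pn) -KE // KSC //.
  have -> : keyT [:: i, j & rcons m u] = [:: sort leq [:: i; j; u]].
    by rewrite /keyT [nth _ _ 0]/= [nth _ _ 1]/= [last _ _]/= last_rcons.
  have pt : perm_eq [:: i; j; u] (sort leq [:: i; j; u]) by rewrite perm_sym perm_sort.
  move: pt; set t := sort _ _ => pt.
  rewrite /keyC /= last_rcons big_seq1 undup2 -?addrA; last first.
    by apply/eqP => -[ij]; move: un; rewrite ij /= inE eqxx.
  congr (_ + _).
  (* The symmetries of [S] hold on admissible triples only; the default 0 elsewhere makes invariance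
     under swaps unconditional. *)
  pose f s := if [&& size s == 3, all (gtn n) s & uniq s] then S' s else 0.
  have := @adjacent_swap_perm _ _ f [:: i; j; u] t _ pt.
  rewrite /f -(perm_size pt) -(perm_all _ pt) -(perm_uniq pt) lt un /=; apply.
  move=> s1 x z s2 xz; rewrite !size_cat /=.
  have pq : perm_eq (s1 ++ x :: z :: s2) (s1 ++ z :: x :: s2).
    by rewrite perm_cat2l (perm_cat2r s2 [:: x; z] [:: z; x]) (perm_catC [:: _] [:: _]).
  rewrite (perm_all _ pq) (perm_uniq pq); case: and3P => // -[s3 alt au]; rewrite /S'.
  rewrite -(perm_all _ pq) in alt; rewrite -(perm_uniq pq) in au.
  case: s1 s2 s3 alt au {pq} => [|a [|? ?]] [|b [|? ?]] //= s3 alt au; try by lia.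
    exact: S1.
  exact: S2.
rewrite kval_psi big_seq.
under eq_bigr => p pr do rewrite psiE // scalerDr.
rewrite big_split /= -!big_seq.
rewrite (sum_by_keys (keys := fun p => keyT p.2)) ?add0r //.
rewrite (sum_by_keys (keys := fun p => keyC p.2) (fun k => C k.1 k.2)) // => p.
exact: undup_uniq.
Qed.

Lemma multilinear_TT0 : n = 3%N -> key_vanish r keyC ->
  \sum_(p <- r) p.1 *: kval (Some true) (map y p.2) = 0.
Proof.
move=> n_3 rC.
pose c i j u := all (gtn n) [:: i; j; u] && uniq [:: i; j; u].
pose K i j u := if c i j u then KT y n true i j u else 0.
have [|C CE] := @triple_decomposition3 F B K.
  move=> i j u ij; rewrite /K; have -> : c j i u = c i j u by rewrite /c /= !inE; lia.
  by case: ifP => // /andP[lt uq]; exact: KT_sym.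
apply: (multilinear_C (C := C) rC) => i j u lt un.
have lt3 : all (gtn 3) [:: i; j; u] by move: (lt); rewrite n_3.
by rewrite -(CE _ _ _ lt3 un) /K /c lt un.
Qed.

End MultilinearPart.

(** * Reduction to multilinear words by polarization *)

Section Lifts.
Variables (Q : seq nat) (phi : nat -> nat).

(** [phi] tells which variable a fresh letter of [Q] replaces. Substituting for every variable the
    sum of its fresh letters expands the word [t] into the sum of its lifts. *)
Fixpoint lifts (t : seq nat) : seq (seq nat) :=
  if t is i :: t' then
    [seq q :: h | q <- [seq q <- Q | phi q == i], h <- lifts t']
  else [:: [::]].

Lemma lifts_map t h : h \in lifts t -> map phi h = t.
Proof.
elim: t h => [|i t IHt] h /=; first by rewrite inE => /eqP ->.
case/allpairsP=> -[q h'] /= [qQ h't ->] /=; rewrite (IHt h') //.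
by move: qQ; rewrite mem_filter => /andP[/eqP ->].
Qed.

(** The product of the factorials of the multiplicities of the letters. *)
Fixpoint mult (t : seq nat) : nat :=
  if t is i :: t' then (count_mem i t * mult t')%N else 1%N.

(** The first letter of [t] can be lifted to any letter of [Q'] above it, as many as its
    multiplicity; the chosen letter is then removed from [Q']. *)
Lemma count_lifts (Q' t : seq nat) : uniq Q -> uniq Q' -> {subset Q' <= Q} ->
  perm_eq (map phi Q') t -> count (perm_eq ^~ Q') (lifts t) = mult t.
Proof.
move=> uQ; elim: t Q' => [|i t IHt] Q' uQ' sub p.
  by move/perm_size: p; rewrite size_map => /size0nil ->.
have cE q : q \in Q -> phi q == i ->
    count (fun h => perm_eq (q :: h) Q') (lifts t) = ((q \in Q') * mult t)%N.
  move=> qQ /eqP qi; case qQ' : (q \in Q'); last first.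
    rewrite mul0n; apply/eqP; rewrite -leqn0 leqNgt -has_count; apply/hasPn => h _.
    by apply: contraFN qQ' => /perm_mem <-; rewrite mem_head.
  rewrite mul1n -(IHt (rem q Q')) ?rem_uniq //; last 2 first.
  - by move=> z /mem_rem /sub.
  - have qi' : perm_eq (i :: map phi (rem q Q')) (map phi Q').
      by rewrite -qi -map_cons perm_map // perm_sym perm_to_rem.
    by rewrite -(perm_cons i); apply: perm_trans qi' p.
  apply: eq_count => h; have pq := perm_to_rem qQ'.
  by rewrite (perm_sym _ Q') (permPl pq) perm_cons perm_sym.
have countE (A : seq nat) (C : seq (seq nat)) (P : pred (seq nat)) :
    count P [seq q :: h | q <- A, h <- C] = (\sum_(q <- A) count (fun h => P (q :: h)) C)%N.
  elim: A => [|q A IHA]; first by rewrite big_nil.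
  by rewrite /= count_cat count_map IHA big_cons.
rewrite [lifts _]/= countE big_filter big_seq_cond.
under eq_bigr => q /andP[qQ qi] do rewrite cE //.
rewrite -big_seq_cond -big_distrl /=; congr (_ * _)%N; rewrite -/(count_mem i (i :: t)).
have pQ : perm_eq [seq q <- Q | q \in Q'] Q'.
  apply: uniq_perm; rewrite ?filter_uniq // => q; rewrite mem_filter.
  by case qQ: (q \in Q') => //=; rewrite sub.
rewrite -(permP p) count_map -(permP pQ); elim: (Q) => [|q A IHA]; first by rewrite big_nil.
by rewrite big_cons IHA /=; case: (q \in Q') => /=; case: (phi q == i).
Qed.

End Lifts.

Lemma mult_perm t t' : perm_eq t t' -> mult t = mult t'.
Proof.
apply: adjacent_swap_perm => s1 x y s2 xy; elim: s1 => [|z s1 IHs] /=; last first.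
  by rewrite IHs !count_cat /=; lia.
by rewrite !eqxx (eq_sym y x) (negbTE xy) !add0n mulnCA.
Qed.

Section Polarization.
Variables (F : fieldType) (h2 : 2%:R != 0 :> F) (h3 : 3%:R != 0 :> F).

Lemma kval_sum (B : naAlgType F) k (I : Type) (r : seq I) (P : pred I) (y : I -> B) s1 s2 :
  kval k (s1 ++ (\sum_(q <- r | P q) y q) :: s2) = \sum_(q <- r | P q) kval k (s1 ++ y q :: s2).
Proof.
elim: r => [|q r IHr]; first by rewrite !big_nil kval0.
by rewrite !big_cons; case: ifP => // _; rewrite kvalD IHr.
Qed.

Lemma kval_lifts (B : naAlgType F) k (y : nat -> B) Q phi t :
  kval k (map (fun i => \sum_(q <- Q | phi q == i) y q) t) =
  \sum_(h <- lifts Q phi t) kval k (map y h).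
Proof.
rewrite -[map _ t]/([::] ++ _).
transitivity (\sum_(h <- lifts Q phi t) kval k ([::] ++ map y h)) => //.
elim: t [::] => [|i t IHt] s; first by rewrite big_seq1.
rewrite [map _ _]/= kval_sum [lifts _ _ _]/= big_allpairs_dep /= big_filter.
by apply: eq_bigr => q _; rewrite -cat_rcons IHt; apply: eq_bigr => h _; rewrite cat_rcons.
Qed.

Definition lift_list (L : seq (F * word)) (n : nat) (phi : nat -> nat) (k : option bool) :
    seq (F * seq nat) :=
  flatten [seq [seq (p.1, h) | h <- lifts (iota 0 n) phi p.2.2 & perm_eq h (iota 0 n)]
          | p <- L & p.2.1 == k].

Lemma lift_listP L n phi k p : p \in lift_list L n phi k -> perm_eq p.2 (iota 0 n).
Proof.
by case/flatten_mapP => q _ /mapP[h]; rewrite mem_filter => /andP[hQ _] ->.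
Qed.

Lemma sum_lift_list (M : lmodType F) L n phi k (f : seq nat -> M) :
  \sum_(p <- lift_list L n phi k) p.1 *: f p.2 =
  \sum_(p <- L | p.2.1 == k) \sum_(h <- lifts (iota 0 n) phi p.2.2 | perm_eq h (iota 0 n))
     p.1 *: f h.
Proof.
rewrite big_flatten big_map big_filter; apply: eq_bigr => p _.
by rewrite big_map big_filter.
Qed.

(** All factors are at most 4, so their only prime divisors are 2 and 3. *)
Lemma mult_neq0 t : all (fun i => count_mem i t <= 4)%N t -> (mult t)%:R != 0 :> F.
Proof.
have small c : (0 < c <= 4)%N -> c%:R != 0 :> F.
  case: c => [|[|[|[|[|c]]]]] // _; first exact: oner_neq0.
  by rewrite (natrM _ 2 2) mulf_neq0.
suff : forall c : nat -> nat, (forall i, count_mem i t <= c i)%N -> all (fun i => c i <= 4)%N t ->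
    (mult t)%:R != 0 :> F by move=> /(_ (fun i => count_mem i t)); apply.
elim: t => [|i t IHt] c ct /=; first by rewrite oner_neq0.
move=> /andP[ci call]; rewrite natrM mulf_neq0 //.
  by apply: small; rewrite eqxx /=; have /= := ct i; rewrite eqxx; lia.
by apply: (IHt c) => // j; apply: leq_trans (ct j); rewrite /= leq_addl.
Qed.

(** The first two places and the last one absorb at most three occurrences. The other two lie where
    letters may be permuted up to sign, so they can be made adjacent, and adjacent letters
    anticommute. *)
Lemma kval_count5 (B : naAlgType F) (VB : V B) (a : nat -> B) k t i :
  (4 < count_mem i t)%N -> kval k (map a t) = 0.
Proof.
case: k => [b|]; last first.
  case: t => [|x [|z [|u t]]] //=; first by case: (x == i).
  by case: (x == i); case: (z == i).
case: t => [|x [|z t]] //; case/lastP: t => [|m u] c5; first by case: b.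
have [m' pm] : {m' | perm_eq m [:: i, i & m']}.
  have c2 : (1 < count_mem i m)%N.
    by move: c5; rewrite -cats1 /= count_cat /=; do !case: eqP => _; lia.
  have im : i \in m by rewrite -has_pred1 has_count; lia.
  have pm := perm_to_rem im.
  have im' : i \in rem i m.
    by rewrite -has_pred1 has_count; move: c2; rewrite (permP pm) /= eqxx.
  by exists (rem i (rem i m)); rewrite (permPl pm) perm_cons perm_to_rem.
have := psi_permT h2 VB a b x z u pm; rewrite psiK => ->.
suff -> : psi a b [:: x, z & rcons [:: i, i & m'] u] = 0 by rewrite scaler0.
have sq := square_squarelike VB.
rewrite /psi [kval _ _](_ : _ = 0) ?scaler0 //; apply: (half2 h2).
set v := kval _ _; have vN : v = - v.
  apply: (@wfold_swap _ h2 _ VB _ sq b (brac (a x) (a z)) [::] (a i) (a i)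
    (map a (rcons m' u)) (W_brac sq _ _)).
  by rewrite orbC; case: (m').
by rewrite {1}vN addNr.
Qed.

(** Words are grouped by their content [t]. Replacing the entries of [t] by distinct letters and
    then evaluating these at [a \o phi] multiplies the component of content [t] by [mult t], which
    is invertible unless all words of that content vanish. *)
Lemma fval_polarized (B : naAlgType F) (VB : V B) (L : seq (F * word)) :
  (forall n phi k (y : nat -> B), (n <= \max_(p <- L) size p.2.2)%N ->
     \sum_(p <- lift_list L n phi k) p.1 *: kval k (map y p.2) = 0) ->
  forall a : nat -> B, fval a L = 0.
Proof.
move=> L0 a.
have Lt t : \sum_(p <- L | sort leq p.2.2 == t) p.1 *: wval a p.2 = 0.
  have [pt|npt] := boolP (has (fun p => sort leq p.2.2 == t) L); last first.
    by rewrite big1_seq // => p /andP[pt pL]; case/hasP: npt; exists p.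
  have st : (size t <= \max_(p <- L) size p.2.2)%N.
    by case/hasP: pt => p pL /eqP <-; rewrite size_sort; exact: (@leq_bigmax_seq _ _ _ (fun p : F * word => size p.2.2)).
  have [c4|] := boolP (all (fun i => count_mem i t <= 4)%N t); last first.
    case/allPn => i _; rewrite -ltnNge => c5.
    rewrite big1_seq // => p /andP[/eqP pt' _]; rewrite /wval (kval_count5 VB a _ (i := i)) ?scaler0 //.
    by move: c5; rewrite -pt' (permP (permEl (perm_sort _ _))).
  pose n := size t; pose phi := nth 0%N t.
  have mapQ : map phi (iota 0 n) = t by exact: mkseq_nth.
  have kE k : \sum_(p <- L | (sort leq p.2.2 == t) && (p.2.1 == k)) p.1 *: wval a p.2 = 0.
    have := L0 n phi k (a \o phi) st.
    rewrite (sum_lift_list L n phi k (fun h => kval k (map (a \o phi) h))) => e.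
    apply: (scalerI (mult_neq0 c4)); rewrite scaler0 -[RHS]e scaler_sumr.
    under eq_bigl => p do rewrite andbC.
    rewrite big_mkcondr /=; apply: eq_bigr => p /eqP pk.
    case: eqP => [pt'|npt']; last first.
      rewrite big1_seq // => h /andP[hQ hl]; case: npt'.
      have {}hQ : perm_eq p.2.2 t by rewrite -(lifts_map hl) -mapQ perm_map.
      case/hasP: pt => q _ /eqP qt; rewrite -qt; apply/perm_sortP.
      - exact: leq_total.
      - exact: leq_trans.
      - exact: anti_leq.
      by rewrite (permPl hQ) -qt perm_sort.
    have ptp : perm_eq t p.2.2 by rewrite -pt' perm_sort.
    transitivity (\sum_(h <- lifts (iota 0 n) phi p.2.2 | perm_eq h (iota 0 n)) p.1 *: wval a p.2).
      rewrite big_const_seq iter_addr_0 count_lifts ?iota_uniq ?mapQ //.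
      by rewrite scaler_nat (mult_perm ptp).
    rewrite big_seq_cond [RHS]big_seq_cond; apply: eq_bigr => h /andP[hl _]; congr (_ *: _).
    by rewrite /wval pk -[in LHS](lifts_map hl) -map_comp.
  rewrite (bigID (fun p => p.2.1 == None)) /= kE add0r.
  rewrite (bigID (fun p => p.2.1 == Some true)) /=.
  transitivity (\sum_(p <- L | (sort leq p.2.2 == t) && (p.2.1 == Some true)) p.1 *: wval a p.2 +
      \sum_(p <- L | (sort leq p.2.2 == t) && (p.2.1 == Some false)) p.1 *: wval a p.2).
    by congr (_ + _); apply: eq_bigl => -[c [[[|]|] s]] /=; rewrite ?andbT ?andbF.
  by rewrite !kE addr0.
rewrite /fval; pose U := undup (map (fun p : F * word => sort leq p.2.2) L).
transitivity (\sum_(p <- L) \sum_(t <- U | sort leq p.2.2 == t) p.1 *: wval a p.2).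
  rewrite big_seq [RHS]big_seq; apply: eq_bigr => p pL.
  have sU : sort leq p.2.2 \in U by rewrite mem_undup (map_f (fun p : F * word => sort leq p.2.2)).
  rewrite -big_filter (_ : [seq t <- U | _] = [:: sort leq p.2.2]) ?big_seq1 //.
  rewrite -(filter_pred1_uniq (undup_uniq _) sU); apply: eq_filter => t.
  by rewrite /= eq_sym.
rewrite (exchange_big_dep predT) //= big1 // => t _; exact: Lt.
Qed.

End Polarization.

(** * Grassmann envelopes *)

Section GrassmannSigns.
Variable F : fieldType.
Implicit Types S T U : {fset nat}.

(* the coefficient of e_(S u T) in e_S e_T *)
Definition sg2 S T : F := if [disjoint S & T]%fset then (-1) ^+ inversions S T else 0.

Lemma perm_fsetU S T : [disjoint S & T]%fset -> perm_eq (S `|` T)%fset (S ++ T).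
Proof.
move=> /fdisjointP dST; apply: uniq_perm; rewrite ?fset_uniq //.
  rewrite cat_uniq !fset_uniq andbT /=; apply/hasPn => x xT.
  by apply/negP => /dST; rewrite xT.
by move=> x; rewrite inE mem_cat.
Qed.

(** The sign is multiplicative over disjoint unions; the factor [sg2 S T] makes both sides vanish
    when the union is not disjoint. *)
Lemma sg2Ul S T U : sg2 S T * sg2 (S `|` T)%fset U = sg2 S T * (sg2 S U * sg2 T U).
Proof.
rewrite /sg2; case: ifP => [dST|_]; last by rewrite !mul0r.
congr (_ * _); rewrite fdisjointUX; case: ifP => [/andP[-> ->]|].
  by rewrite -exprD; congr (_ ^+ _); rewrite /inversions (perm_big _ (perm_fsetU dST)) big_cat.
by case: [disjoint S & U]%fset => //= [->|_]; rewrite ?mulr0 ?mul0r.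
Qed.

Lemma sg2Ur S T U : sg2 T U * sg2 S (T `|` U)%fset = sg2 T U * (sg2 S T * sg2 S U).
Proof.
rewrite /sg2; case: ifP => [dTU|_]; last by rewrite !mul0r.
congr (_ * _); rewrite fdisjointXU; case: ifP => [/andP[-> ->]|].
  rewrite -exprD; congr (_ ^+ _); rewrite /inversions -big_split; apply: eq_bigr => s _.
  by rewrite (perm_big _ (perm_fsetU dTU)) big_cat.
by case: [disjoint S & T]%fset => //= [->|_]; rewrite ?mulr0 ?mul0r.
Qed.

Lemma sg2C S T : sg2 T S = (-1) ^+ (odd #|` S| && odd #|` T|) * sg2 S T.
Proof.
rewrite -oddM signr_odd /sg2 fdisjoint_sym; case: ifP => [dST|_]; last by rewrite mulr0.
have e : (inversions T S + inversions S T = #|` S| * #|` T|)%N.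
  rewrite /inversions exchange_big -big_split -sum1_size big_distrl /= big_seq [RHS]big_seq.
  apply: eq_bigr => s sS; rewrite mul1n -big_split -sum1_size /= big_seq [RHS]big_seq.
  apply: eq_bigr => t tT; case: ltngtP => // st.
  by move/fdisjointP/(_ _ sS): dST; rewrite st tT.
by rewrite -e exprD -mulrA -exprD addnn -mul2n exprM sqrrN expr1n expr1n mulr1.
Qed.

Variable A : naAlgType F.

Lemma gword_mulE S T (a b : A) : gword S a ** gword T b = sg2 S T *: gword (S `|` T)%fset (a ** b).
Proof. by rewrite gword_mul /sg2; case: ifP => //; rewrite scale0r. Qed.

Lemma gwordD S (a b : A) : gword S (a + b) = gword S a + gword S b.
Proof. by apply/funext => T; rewrite gfunD /gword; case: ifP; rewrite ?addr0. Qed.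
Lemma gwordZ S k (a : A) : gword S (k *: a) = k *: gword S a.
Proof. by apply/funext => T; rewrite gfunZ /gword; case: ifP; rewrite ?scaler0. Qed.
Lemma gword0 S : gword S (0 : A) = 0.
Proof. by apply/funext => T; rewrite /gword; case: ifP. Qed.

(** The coefficient of the union in [e_S e_T e_U], the same for both bracketings. *)
Definition sg3 S T U := sg2 S T * (sg2 S U * sg2 T U).

Lemma gword_mul3l S T U (a b c : A) : (gword S a ** gword T b) ** gword U c =
  sg3 S T U *: gword (S `|` T `|` U)%fset ((a ** b) ** c).
Proof. by rewrite gword_mulE namulZl gword_mulE scalerA sg2Ul. Qed.

Lemma gword_mul3r S T U (a b c : A) : gword S a ** (gword T b ** gword U c) =
  sg3 S T U *: gword (S `|` T `|` U)%fset (a ** (b ** c)).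
Proof.
rewrite gword_mulE namulZr gword_mulE scalerA sg2Ur fsetUA /sg3; congr (_ *: _); ring.
Qed.

Lemma gword_nassoc S T U (a b c : A) : nassoc (gword S a) (gword T b) (gword U c) =
  sg3 S T U *: gword (S `|` T `|` U)%fset (nassoc a b c).
Proof.
rewrite /nassoc gword_mul3l gword_mul3r -scalerBr -scaleN1r -gwordZ -gwordD.
by rewrite scaleN1r.
Qed.

End GrassmannSigns.

Section Spanning.
Variables (F : fieldType) (A : naAlgType F).

Lemma finsupp_gfun_ind (f : gfun A) (P : gfun A -> Prop) : finsupp_gfun f ->
  P 0 -> (forall f g, P f -> P g -> P (f + g)) -> (forall S, P (gword S (f S))) -> P f.
Proof.
case=> s fs P0 PD Pw.
have -> : f = \sum_(S <- undup s) gword S (f S).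
  apply/funext => T; rewrite (big_morph (fun g : gfun A => g T) (fun g h => gfunD g h T) (id1 := 0)) //.
  have [Ts|Ts] := boolP (T \in undup s).
    rewrite (bigD1_seq T) ?undup_uniq //= /gword eqxx big1 ?addr0 // => S ST.
    by rewrite eq_sym (negbTE ST).
  rewrite big1_seq; last first.
    by move=> S /andP[_ Ss]; rewrite /gword; case: eqP Ts => // ->; rewrite Ss.
  by apply/eqP; apply: contraNT Ts => /eqP /fs; rewrite mem_undup.
by elim: (undup s) => [|S r IH]; rewrite ?big_nil // big_cons; apply: PD.
Qed.

End Spanning.

Section Envelopes.
Variables (F : fieldType) (A : superAlgType F).

Lemma grass_ind (P : gfun A -> Prop) : P 0 -> (forall f g, P f -> P g -> P (f + g)) ->
  (forall S a, homog (odd #|` S|) a -> P (gword S a)) ->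
  forall f, grass_pred f -> P f.
Proof. by move=> P0 PD Pw f [fs hf]; apply: finsupp_gfun_ind fs P0 PD _ => S; exact: Pw. Qed.

Lemma grass_pred_gword S (a : A) : homog (odd #|` S|) a -> grass_pred (gword S a).
Proof.
move=> ha; split=> [|T]; last by rewrite /gword; case: eqP => [->|_] //; exact: homog0.
by exists [:: S] => T; rewrite /gword; case: eqP => [-> _|//]; rewrite mem_head.
Qed.

Lemma grassP (x : grass_env A) : grass_pred (val x).
Proof. by case: x => f /= /asboolP. Qed.

End Envelopes.

(* Superalgebras O + C + D with even part C and odd generators O: the product of two
   generators is [beta beta c0]; on C + D right multiplications by generators are
   [rho r : D -> C], and [theta : C -> D] is the operator T. *)
Record famdata (F : fieldType) := FamData {
  famO : lmodType F; famC : lmodType F; famD : lmodType F;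
  beta : famO -> F; rho : famO -> F; c0 : famC;
  theta : famO -> famC -> famD; rr : famD -> famC; ss : famC -> famC;
  beta_lin : forall k x y, beta (k *: x + y) = k * beta x + beta y;
  rho_lin : forall k x y, rho (k *: x + y) = k * rho x + rho y;
  theta_linl : forall k x y c, theta (k *: x + y) c = k *: theta x c + theta y c;
  theta_linr : forall k x c d, theta x (k *: c + d) = k *: theta x c + theta x d;
  rr_lin : forall k x y, rr (k *: x + y) = k *: rr x + rr y;
  rr_theta : forall x c, rr (theta x c) = rho x *: ss c;
  ss_lin : forall k x y, ss (k *: x + y) = k *: ss x + ss y
}.

Section Family.
Variables (F : fieldType) (p : famdata F).

Definition fam := (famO p * famC p * famD p)%type.
HB.instance Definition _ := GRing.Lmodule.on fam.

Definition fmul (x y : fam) : fam :=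
  (0, (beta x.1.1 * beta y.1.1) *: c0 p + rho y.1.1 *: rr x.2 + rho x.1.1 *: rr y.2,
   theta x.1.1 y.1.2).

Lemma fam_eq (x y : fam) : x.1.1 = y.1.1 -> x.1.2 = y.1.2 -> x.2 = y.2 -> x = y.
Proof. by case: x y => [[a b] c] [[a' b'] c'] /= -> -> ->. Qed.

Lemma betaD x y : beta (x + y : famO p) = beta x + beta y.
Proof. by rewrite -[x]scale1r beta_lin scale1r mul1r. Qed.
Lemma beta0 : beta (0 : famO p) = 0.
Proof. by apply: (addrI (beta (0 : famO p))); rewrite -betaD !addr0. Qed.
Lemma betaZ k x : beta (k *: x : famO p) = k * beta x.
Proof. by rewrite -[_ *: _]addr0 beta_lin beta0 addr0. Qed.
Lemma rhoD x y : rho (x + y : famO p) = rho x + rho y.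
Proof. by rewrite -[x]scale1r rho_lin scale1r mul1r. Qed.
Lemma rho0 : rho (0 : famO p) = 0.
Proof. by apply: (addrI (rho (0 : famO p))); rewrite -rhoD !addr0. Qed.
Lemma rhoZ k x : rho (k *: x : famO p) = k * rho x.
Proof. by rewrite -[_ *: _]addr0 rho_lin rho0 addr0. Qed.
Lemma rrD x y : rr (x + y : famD p) = rr x + rr y.
Proof. by rewrite -[x]scale1r rr_lin !scale1r. Qed.
Lemma rr0 : rr (0 : famD p) = 0.
Proof. by apply: (addrI (rr (0 : famD p))); rewrite -rrD !addr0. Qed.
Lemma rrZ k x : rr (k *: x : famD p) = k *: rr x.
Proof. by rewrite -[_ *: _]addr0 rr_lin rr0 addr0. Qed.
Lemma rrN x : rr (- x : famD p) = - rr x.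
Proof. by rewrite -scaleN1r rrZ scaleN1r. Qed.
Lemma thetaDl x y c : theta (x + y : famO p) c = theta x c + theta y c.
Proof. by rewrite -[x]scale1r theta_linl !scale1r. Qed.
Lemma theta0l c : theta (0 : famO p) c = 0.
Proof. by apply: (addrI (theta (0 : famO p) c)); rewrite -thetaDl !addr0. Qed.
Lemma thetaZl k x c : theta (k *: x : famO p) c = k *: theta x c.
Proof. by rewrite -[_ *: x]addr0 theta_linl theta0l addr0. Qed.
Lemma thetaDr x c d : theta (x : famO p) (c + d) = theta x c + theta x d.
Proof. by rewrite -[c]scale1r theta_linr !scale1r. Qed.
Lemma theta0r x : theta (x : famO p) 0 = 0.
Proof. by apply: (addrI (theta (x : famO p) 0)); rewrite -thetaDr !addr0. Qed.
Lemma thetaZr k x c : theta (x : famO p) (k *: c) = k *: theta x c.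
Proof. by rewrite -[_ *: c]addr0 theta_linr theta0r addr0. Qed.

Lemma ssD x y : ss (x + y : famC p) = ss x + ss y.
Proof. by rewrite -[x]scale1r ss_lin !scale1r. Qed.
Lemma ss0 : ss (0 : famC p) = 0.
Proof. by apply: (addrI (ss (0 : famC p))); rewrite -ssD !addr0. Qed.
Lemma ssZ k x : ss (k *: x : famC p) = k *: ss x.
Proof. by rewrite -[_ *: _]addr0 ss_lin ss0 addr0. Qed.

Definition famE := (betaD, beta0, betaZ, rhoD, rho0, rhoZ, rrD, rr0, rrZ, rrN, thetaDl, theta0l,
  thetaZl, thetaDr, theta0r, thetaZr, @rr_theta F p, ssD, ss0, ssZ).

Ltac fam := apply: fam_eq; rewrite /= ?famE; try lmod F.

Lemma fmulDl x y z : fmul (x + y) z = fmul x z + fmul y z. Proof. fam. Qed.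
Lemma fmulDr x y z : fmul x (y + z) = fmul x y + fmul x z. Proof. fam. Qed.
Lemma fmulZl k x y : fmul (k *: x) y = k *: fmul x y. Proof. fam. Qed.
Lemma fmulZr k x y : fmul x (k *: y) = k *: fmul x y. Proof. fam. Qed.

HB.instance Definition _ := Lmodule_isNAAlgebra.Build F fam fmulDl fmulDr fmulZl fmulZr.

Definition fhomog (b : bool) (x : fam) : Prop :=
  if b then x.1.2 = 0 else x.1.1 = 0 /\ x.2 = 0.

Lemma fhomog0 b : fhomog b 0. Proof. by case: b. Qed.
Lemma fhomogL b k x y : fhomog b x -> fhomog b y -> fhomog b (k *: x + y).
Proof.
case: b => /=; first by move=> -> ->; rewrite scaler0 addr0.
by move=> [-> ->] [-> ->]; rewrite !scaler0 !addr0.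
Qed.
Lemma fhomog_add x : exists y z, [/\ fhomog false y, fhomog true z & x = y + z].
Proof.
exists (0, x.1.2, 0), (x.1.1, 0, x.2); split=> //=.
by apply: fam_eq; rewrite /= ?add0r ?addr0.
Qed.
Lemma fhomog_cap x : fhomog false x -> fhomog true x -> x = 0.
Proof. by case=> e1 e2 e3; apply: fam_eq. Qed.
Lemma fhomogM b c x y : fhomog b x -> fhomog c y -> fhomog (b (+) c) (fmul x y).
Proof.
case: b c => -[] /= => [xc yc|xc [yo yd]|[xo xd] yc|[xo xd] [yo yd]].
- by rewrite yc famE.
- by rewrite ?yo ?yd !famE !(mulr0, scale0r, scaler0, addr0).
- by rewrite xo ?xd !famE !(mul0r, scale0r, scaler0, addr0).
- by rewrite xo famE.
Qed.

HB.instance Definition _ := NAAlgebra_isSuperAlgebra.Build F fam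
  fhomog0 fhomogL fhomog_add fhomog_cap fhomogM.

End Family.

Ltac fam F := apply: fam_eq; rewrite /= ?famE; try lmod F.

Section SignsThree.
Variable F : fieldType.
Implicit Types S T U : {fset nat}.
Lemma sg3_swap23 S T U :
  sg3 F S U T = (-1) ^+ (odd #|` T| && odd #|` U|) * sg3 F S T U.
Proof. by rewrite /sg3 (sg2C F T U); ring. Qed.
Lemma sg3_swap12 S T U :
  sg3 F T S U = (-1) ^+ (odd #|` S| && odd #|` T|) * sg3 F S T U.
Proof. by rewrite /sg3 (sg2C F S T); ring. Qed.
End SignsThree.

Section FamilyEnvelope.
Variables (F : fieldType) (h2 : 2%:R != 0 :> F) (p : famdata F).
Let A : superAlgType F := fam p.
Let G : naAlgType F := grass_env A.

Lemma fam_mulE (x y : A) : x ** y = fmul x y. Proof. by []. Qed.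

Lemma fam_nassoc (x y z : A) : nassoc x y z =
  (0, (rho z.1.1 * rho x.1.1) *: ss y.1.2 - (rho x.1.1 * rho y.1.1) *: ss z.1.2,
   - theta x.1.1 ((beta y.1.1 * beta z.1.1) *: c0 p + rho z.1.1 *: rr y.2 + rho y.1.1 *: rr z.2)).
Proof. by rewrite /nassoc !fam_mulE; fam F. Qed.

(** The identities are checked in super form, a sign accompanying every exchange of two odd
    arguments; in the envelope it is compensated by the Grassmann factors. *)
Lemma fam_alt b c (x y z : A) : homog b y -> homog c z ->
  nassoc x y z + (-1) ^+ (b && c) *: nassoc x z y = 0.
Proof.
case: b c => -[] /= => [yc zc|yc [zo zd]|[yo yd] zc|[yo yd] [zo zd]];
by rewrite !fam_nassoc ?yc ?zc ?yo ?yd ?zo ?zd ?famE; fam F.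
Qed.

Lemma fam_metab (x y z t : A) : (x ** y) ** (z ** t) = 0.
Proof. by rewrite !fam_mulE; fam F. Qed.

Lemma fam_jord a b c (x y z : A) : homog a x -> homog b y -> homog c z ->
  (x ** y) ** z + (-1) ^+ (a && b) *: ((y ** x) ** z) +
  (-1) ^+ (c && (a (+) b)) *: (z ** (x ** y) + (-1) ^+ (a && b) *: (z ** (y ** x))) = 0.
Proof.
by case: a b c => -[] [] /= => [xc yc zc|xc yc [zo zd]|xc [yo yd] zc|xc [yo yd] [zo zd]
  |[xo xd] yc zc|[xo xd] yc [zo zd]|[xo xd] [yo yd] zc|[xo xd] [yo yd] [zo zd]];
rewrite !fam_mulE /fmul /= ?xc ?xo ?xd ?yc ?zc ?yo ?yd ?zo ?zd ?famE; fam F.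
Qed.

(** Such elements annihilate the algebra on both sides, which is more than the fourth identity asks
    of associators. *)
Definition fam_ker (x : A) : Prop := [/\ x.1.1 = 0, x.1.2 = 0 & rr x.2 = 0].

Lemma fam_ker_mul (x y : A) : fam_ker x -> x ** y = 0 /\ y ** x = 0.
Proof.
case=> xo xc xd; split; rewrite fam_mulE /fmul ?xo ?xc ?xd.
  by fam F.
by fam F.
Qed.

(** The middle argument is any element without component in O, not only a product: this makes
    [env_square] squarelike. *)
Lemma fam_four a b c (x w z : A) : homog a x -> homog b w -> homog c z -> w.1.1 = 0 ->
  fam_ker (nassoc x w z + (-1) ^+ ((a && b) (+) (a && c) (+) (b && c)) *: nassoc z w x).
Proof.
by case: a b c => -[] [] /= => [xc yc zc|xc yc [zo zd]|xc [yo yd] zc|xc [yo yd] [zo zd]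
  |[xo xd] yc zc|[xo xd] yc [zo zd]|[xo xd] [yo yd] zc|[xo xd] [yo yd] [zo zd]] wo;
rewrite !fam_nassoc; split; rewrite /= ?xc ?xo ?xd ?yc ?zc ?yo ?yd ?zo ?zd ?wo ?famE; lmod F.
Qed.

Implicit Types f g h : gfun A.

Lemma env_alt f g h : grass_pred f -> grass_pred g -> grass_pred h ->
  nassoc f g h + nassoc f h g = 0.
Proof.
move=> Gf Gg Gh.
move: f Gf; apply: grass_ind => [|f1 f2|S a ha]; rewrite /nassoc ?(namulE _); first by lmod F.
  by move=> e1 e2; lc 1 e1; lc 1 e2; lmod F.
move: g Gg; apply: grass_ind => [|f1 f2|T b hb]; rewrite ?(namulE _); first by lmod F.
  by move=> e1 e2; lc 1 e1; lc 1 e2; lmod F.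
move: h Gh; apply: grass_ind => [|f1 f2|U c hc]; rewrite ?(namulE _); first by lmod F.
  by move=> e1 e2; lc 1 e1; lc 1 e2; lmod F.
rewrite -/(nassoc _ _ _) -/(nassoc _ (gword U c) _) !gword_nassoc.
rewrite (sg3_swap23 F S T U) [(S `|` U `|` T)%fset]fsetUAC.
have := congr1 (fun v => sg3 F S T U *: gword (S `|` T `|` U)%fset v) (fam_alt a hb hc).
by rewrite gword0 scaler0 gwordD gwordZ => e; lc 1 e; lmod F.
Qed.

Lemma env_metab f g h k : grass_pred f -> grass_pred g -> grass_pred h -> grass_pred k ->
  (f ** g) ** (h ** k) = 0.
Proof.
move=> Gf Gg Gh Gk.
move: f Gf; apply: grass_ind => [|f1 f2|S a _]; rewrite ?(namulE _) //; first by move=> -> ->; rewrite addr0.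
move: g Gg; apply: grass_ind => [|f1 f2|T b _]; rewrite ?(namulE _) //; first by move=> -> ->; rewrite addr0.
move: h Gh; apply: grass_ind => [|f1 f2|U c _]; rewrite ?(namulE _) //; first by move=> -> ->; rewrite addr0.
move: k Gk; apply: grass_ind => [|f1 f2|R d _]; rewrite ?(namulE _) //; first by move=> -> ->; rewrite addr0.
by rewrite !gword_mulE !(namulE _) gword_mulE fam_metab gword0 !scaler0.
Qed.

Lemma env_jord f g h : grass_pred f -> grass_pred g -> grass_pred h ->
  (f ** g + g ** f) ** h + h ** (f ** g + g ** f) = 0.
Proof.
move=> Gf Gg Gh.
move: f Gf; apply: grass_ind => [|f1 f2|S a ha]; rewrite ?(namulE _); first by lmod F.
  by move=> e1 e2; lc 1 e1; lc 1 e2; lmod F.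
move: g Gg; apply: grass_ind => [|f1 f2|T b hb]; rewrite ?(namulE _); first by lmod F.
  by move=> e1 e2; lc 1 e1; lc 1 e2; lmod F.
move: h Gh; apply: grass_ind => [|f1 f2|U c hc]; rewrite ?(namulE _); first by lmod F.
  by move=> e1 e2; lc 1 e1; lc 1 e2; lmod F.
rewrite !gword_mul3l !gword_mul3r.
have fU : (U `|` S `|` T = S `|` T `|` U)%fset by rewrite -fsetUA fsetUC.
have fU' : (U `|` T `|` S = S `|` T `|` U)%fset by rewrite -fsetUA fsetUC [(T `|` S)%fset]fsetUC.
rewrite fU fU' [(T `|` S)%fset]fsetUC.
have s1 := sg3_swap12 F S T U; have s2 := sg3_swap23 F S T U; have s3 := sg3_swap12 F S U T.
have s4 := sg3_swap12 F T U S; have s5 := sg3_swap23 F T S U.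
have := congr1 (fun v => sg3 F S T U *: gword (S `|` T `|` U)%fset v) (fam_jord ha hb hc).
rewrite gword0 scaler0 !(gwordD, gwordZ) => e; lc 1 e.
rewrite s4 s5 s3 s2 s1 {e s1 s2 s3 s4 s5 fU fU'}.
by case: (odd _) (odd _) (odd _) => [] [] []; lmod F.
Qed.

Lemma sg2_reverse S T U : sg2 F U T * sg2 F U S * sg2 F T S =
  (-1) ^+ ((odd #|` S| && odd #|` T|) (+) (odd #|` S| && odd #|` U|) (+) (odd #|` T| && odd #|` U|))
  * sg3 F S T U.
Proof.
rewrite (sg2C F S T) (sg2C F S U) (sg2C F T U) /sg3.
by case: (odd _) (odd _) (odd _) => [] [] []; ring.
Qed.

Lemma env_four f g w k : grass_pred f -> grass_pred g -> grass_pred k ->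
  grass_pred w -> (forall S, (w S : fam p).1.1 = 0) ->
  let v := nassoc f w g + nassoc g w f in v ** k = 0 /\ k ** v = 0.
Proof.
move=> Gf Gg Gk [wfin wh] wo; rewrite /nassoc /=.
move: f Gf; apply: grass_ind => [|f1 f2|S a ha]; rewrite ?(namulE _).
- by split; lmod F.
- by move=> [e1 e1'] [e2 e2']; split; [lc 1 e1; lc 1 e2|lc 1 e1'; lc 1 e2']; lmod F.
move: g Gg; apply: grass_ind => [|f1 f2|U c hc]; rewrite ?(namulE _).
- by split; lmod F.
- by move=> [e1 e1'] [e2 e2']; split; [lc 1 e1; lc 1 e2|lc 1 e1'; lc 1 e2']; lmod F.
move: k Gk; apply: grass_ind => [|f1 f2|R d hd]; rewrite ?(namulE _).
- by split; lmod F.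
- by move=> [e1 e1'] [e2 e2']; split; [lc 1 e1; lc 1 e2|lc 1 e1'; lc 1 e2']; lmod F.
pattern w; apply: (finsupp_gfun_ind wfin) => [|f1 f2|T]; rewrite ?(namulE _).
- by split; lmod F.
- by move=> [e1 e1'] [e2 e2']; split; [lc 1 e1; lc 1 e2|lc 1 e1'; lc 1 e2']; lmod F.
have ker := fam_four ha (wh T) hc (wo T).
set M := (X in fam_ker X) in ker; have [M1 M2] := fam_ker_mul (d : A) ker.
have vE : nassoc (gword S a) (gword T (w T)) (gword U c) +
  nassoc (gword U c) (gword T (w T)) (gword S a) = sg3 F S T U *: gword (S `|` T `|` U)%fset M.
  have sgE : sg3 F U T S = sg2 F U T * sg2 F U S * sg2 F T S by rewrite /sg3 mulrA.
  rewrite !gword_nassoc sgE sg2_reverse (_ : (U `|` T `|` S = S `|` T `|` U)%fset).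
    by rewrite /M gwordD gwordZ; lmod F.
  by rewrite -fsetUA fsetUC [(T `|` S)%fset]fsetUC.
have e1 : (sg3 F S T U *: gword (S `|` T `|` U)%fset M) ** gword R d = 0.
  by rewrite (namulE _) gword_mulE M1 gword0 !scaler0.
have e2 : gword R d ** (sg3 F S T U *: gword (S `|` T `|` U)%fset M) = 0.
  by rewrite (namulE _) gword_mulE M2 gword0 !scaler0.
move: e1 e2; rewrite -vE /nassoc ?(namulE _) => e1 e2.
by split; [lc 1 e1|lc 1 e2]; lmod F.
Qed.

(** The elements with values in C + D. They contain the square and complement the elements with
    values in O, so every element of the envelope splits accordingly. *)
Definition env_square (x : G) : Prop := forall S, ((val x : gfun A) S : fam p).1.1 = 0.

Lemma valB (x y : G) : val (x - y) = val x - val y.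
Proof. by rewrite -scaleN1r GRing.valD GRing.valZ scaleN1r. Qed.

Lemma valM (x y : G) : val (x ** y) = val x ** val y. Proof. by []. Qed.

Lemma env_squareM (x y : G) : env_square (x ** y).
Proof.
move=> S; rewrite valM /namul /= /gfun_mul.
by elim/big_rec: _ => //= T u _ ->; rewrite scaler0 addr0.
Qed.

Lemma env_square4 (x w t : G) : env_square w ->
  nassoc x w x ** t = 0 /\ t ** nassoc x w x = 0.
Proof.
move=> wo; have [e1 e2] := env_four (grassP x) (grassP x) (grassP t) (grassP w) wo.
have vE : val (nassoc x w x) = nassoc (val x) (val w) (val x) by rewrite /nassoc valB !valM.
split; apply: (half2 h2); apply: val_inj; rewrite GRing.valD valM vE.
  by rewrite -namulDl.
by rewrite -namulDr.
Qed.

Lemma env_V : V G.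
Proof.
case=> -[|[|[|[|i]]]] // lti a; rewrite /V_identity /= ?scaleN1r.
(* The polarized identity at equal arguments is twice the identity. *)
- apply: (half2 h2); apply: val_inj; rewrite GRing.valD valB.
  exact: (env_alt (grassP _) (grassP _) (grassP _)).
- by apply: val_inj; apply: env_metab; exact: grassP.
- apply: val_inj; rewrite GRing.valD !valM !GRing.valD !valM.
  exact: (env_jord (grassP _) (grassP _) (grassP _)).
by have [e1 e2] := env_square4 (a 0%N) (a 3%N) (env_squareM (a 1%N) (a 2%N)); rewrite e1 e2 subrr.
Qed.

Lemma env_squarelike : squarelike env_square.
Proof.
split=> [S|k x y xo yo S|x y|x y xo yo|x w t wo] //.
- by rewrite GRing.valD GRing.valZ /= xo yo scaler0 addr0.
- exact: env_squareM.
- apply: val_inj; apply/funext => S; rewrite valM [LHS]big1 // => T _.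
  rewrite [_ ** _](_ : _ = 0) ?scaler0 //.
  by rewrite fam_mulE /fmul xo yo; fam F.
by have [e1 e2] := env_square4 x t wo; rewrite /brac e1 e2 subrr.
Qed.

End FamilyEnvelope.

(** * Chain identities as operator words *)

Section ChainWords.
Variables (F : fieldType) (h2 : 2%:R != 0 :> F) (B : naAlgType F) (VB : V B).
Implicit Types (x y z w : B) (Z s : seq B).

(** The letters from the inside outwards. In both terms of [nassocW] the right argument of the
    associator acts before the left one. *)
Fixpoint chain_vars (a : nat -> B) (n k : nat) : seq B :=
  if k is k'.+1 then chain_vars a n k' ++ [:: a (n + k)%N; a (n - k)%N] else [::].

Lemma size_chain_vars a n k : size (chain_vars a n k) = k.*2.
Proof. by elim: k => //= k IHk; rewrite size_cat IHk /= addn2. Qed.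

(** Of the two words one ends in R and the other in T. Since R R = T T = 0, of the two terms
    produced by a further associator each word keeps just one, with the sign -1. *)
Lemma neval_chain (a : nat -> B) n k :
  neval a (chain F n k) = (-1) ^+ k *: (wfold false (brac (a 0%N) (a n)) (a n :: chain_vars a n k)
    - 2%:R^-1 *: wfold true (brac (a 0%N) (a n)) (a n :: chain_vars a n k)).
Proof.
have sq := square_squarelike VB.
elim: k => [|k IHk].
  rewrite /= !scaleN1r scale1r -(bracT h2 VB) /brac; have := jord_bracR h2 VB (a n) (a 0%N) (a n).
  rewrite /brac !(namulE _) => e; by lc 1 e; lmodf F.
have stepE : neval a (chain F n k.+1) =
    nassoc (a (n - k.+1)%N) (neval a (chain F n k)) (a (n + k.+1)%N) by rewrite /= !scaleN1r.
rewrite stepE IHk {stepE IHk}; set br := brac _ _; set y := a (n - _)%N; set z := a (n + _)%N.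
have sqb : square br by exact: (W_brac sq).
set s := a n :: chain_vars a n k; have os : odd (size s) by rewrite /= size_chain_vars odd_double.
rewrite -[a n :: chain_vars a n k.+1]/(s ++ [:: z; y]) !wfold_cat os.
set u := wfold false br s; set v := wfold true br s; have w2 b w t t' : wfold b w [:: t; t'] = wop (~~ b) t' (wop b t w) by [].
rewrite !{}w2 ![_ (+) _]/= ![~~ _]/=.
have [Su Sv] : square u /\ square v by split; apply: (wfold_W sq).
have uR t : wop false t u = 0.
  rewrite /u /s lastI -cats1 wfold_cat size_belast.
  have -> : false (+) odd (size (chain_vars a n k)) = false by rewrite size_chain_vars odd_double.
  by apply: (wop_same h2 VB sq); apply: (wfold_W sq).
have vT t : wop true t v = 0.
  rewrite /v /s lastI -cats1 wfold_cat size_belast.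
  have -> : true (+) odd (size (chain_vars a n k)) = true by rewrite size_chain_vars odd_double.
  by apply: (wop_same h2 VB sq); apply: (wfold_W sq).
have Suv : square ((-1) ^+ k *: (u - 2%:R^-1 *: v)).
  by apply: (W_Z sq); apply: (W_D sq) => //; rewrite -scaleN1r scalerA; apply: (W_Z sq).
rewrite (nassoc_wop h2 VB sq) //.
have -> : wop true z ((-1) ^+ k *: (u - 2%:R^-1 *: v)) = (-1) ^+ k *: wop true z u.
  by rewrite wopZ wopD wopN wopZ vT scaler0 subr0.
have -> : wop false z ((-1) ^+ k *: (u - 2%:R^-1 *: v)) = - ((-1) ^+ k / 2%:R) *: wop false z v.
  by rewrite wopZ wopD wopN wopZ uR; lmod F.
by rewrite !wopZ exprS; lmod F.
Qed.

Definition chain_word x y Z := kval (Some true) [:: x, y, y & Z ++ [:: x; x]].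

(** With equal outer letters [R_x T_x] vanishes on the square, and [T_x R_x] kills the word ending
    in R; the other word survives. *)
Lemma neval_chain_identity (a : nat -> B) n : (0 < n)%N ->
  neval a (chain_identity F n) =
  ((-1) ^+ n.-1 * 2%:R^-1) *: chain_word (a 0%N) (a n) (chain_vars a n n.-1).
Proof.
move=> n0; have sq := square_squarelike VB.
have -> : neval a (chain_identity F n) =
    nassoc (a 0%N) (neval a (chain F n n.-1)) (a 0%N) by rewrite /= !scaleN1r.
rewrite neval_chain; move: n.-1 => k {n0}; rewrite /chain_word [kval _ _]/=.
set x := a 0%N; set br := brac _ _.
rewrite -[wfold _ _ _ in RHS]/(wfold true br ((a n :: chain_vars a n k) ++ [:: x; x])).
set s := a n :: chain_vars a n k; have os : odd (size s) by rewrite /= size_chain_vars odd_double.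
rewrite wfold_cat os; set u := wfold false br s; set v := wfold true br s.
have w2 b w t t' : wfold b w [:: t; t'] = wop (~~ b) t' (wop b t w) by [].
rewrite !{}w2 [_ (+) _]/= ![~~ _]/=.
have sqb : square br by exact: (W_brac sq).
have [Su Sv] : square u /\ square v by split; apply: (wfold_W sq).
have Suv : square ((-1) ^+ k *: (u - 2%:R^-1 *: v)).
  by apply: (W_Z sq); apply: (W_D sq) => //; rewrite -scaleN1r scalerA; apply: (W_Z sq).
rewrite (nassoc_wop h2 VB sq) //.
have uR : wop false x u = 0.
  rewrite /u /s lastI -cats1 wfold_cat size_belast.
  have -> : false (+) odd (size (chain_vars a n k)) = false by rewrite size_chain_vars odd_double.
  by apply: (wop_same h2 VB sq); apply: (wfold_W sq).
have TR w : square w -> wop false x (wop true x w) = 0.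
  by move=> Sw; apply: (half2 h2); exact: (opTR_skew h2 VB sq).
rewrite TR //.
have -> : wop false x ((-1) ^+ k *: (u - 2%:R^-1 *: v)) = - ((-1) ^+ k / 2%:R) *: wop false x v.
  by rewrite wopZ wopD wopN wopZ uR; lmod F.
by rewrite wopZ; lmod F.
Qed.

Lemma chainw_satisfies n : (0 < n)%N -> chainw B n -> satisfies B (chain_identity F n).
Proof.
move=> n0 cw a; rewrite neval_chain_identity // /chain_word cw ?scaler0 //.
by rewrite size_chain_vars.
Qed.

Lemma satisfies_chainw n : (0 < n)%N -> satisfies B (chain_identity F n) -> chainw B n.
Proof.
move=> n0 sat x y Z sZ.
(* The inverse of [chain_vars]: variable [n + k] receives entry [2 (k - 1)] of [Z], and variable
   [n - k] the entry after it. *)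
pose a m := if m == 0%N then x else if m == n then y else
  if (n < m)%N then nth 0 Z (m - n).-1.*2 else nth 0 Z (n - m).-1.*2.+1.
have := sat a; rewrite neval_chain_identity //.
have -> : a 0%N = x by [].
have -> : a n = y by rewrite /a eqxx; case: eqP n0 => // ->.
have -> : chain_vars a n n.-1 = Z.
  have Zk k : (k <= n.-1)%N -> chain_vars a n k = take k.*2 Z.
    elim: k => [|k IHk] kn; first by rewrite take0.
    rewrite /= IHk ?(ltnW kn) //.
    have k2 : (k.*2.+1 < size Z)%N by rewrite sZ -doubleS leq_double.
    rewrite doubleS (take_nth 0 k2) (take_nth 0 (ltnW k2)) -!cats1 -catA /=.
    congr (_ ++ [:: _; _]); rewrite /a.
      have -> : (n + k.+1 == 0)%N = false by lia.
      have -> : (n + k.+1 == n)%N = false by lia.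
      have -> : (n < n + k.+1)%N by lia.
      by congr nth; lia.
    have -> : (n - k.+1 == 0)%N = false by lia.
    have -> : (n - k.+1 == n)%N = false by lia.
    have -> : (n < n - k.+1)%N = false by lia.
    by congr nth; lia.
  by rewrite Zk // -sZ take_size.
move=> /eqP; rewrite scaler_eq0 => /orP[|/eqP //].
by rewrite mulf_eq0 signr_eq0 invr_eq0 (negbTE h2).
Qed.

Variables (W : B -> Prop) (SW : squarelike W).

Lemma wfold_dup b w s1 x s2 s3 : W w -> s3 != [::] ->
  wfold b w (s1 ++ x :: s2 ++ x :: s3) = 0.
Proof.
move=> Ww s30; elim: s2 s1 => [|z s2 IHs] s1; last first.
  rewrite cat_cons (wfold_swap h2 VB SW) //; last by rewrite orbC; case: (s2).
  by rewrite -cat_rcons IHs oppr0.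
apply: (half2 h2); have := @wfold_swap F h2 B VB W SW b w s1 x x s3 Ww.
by rewrite s30 orbT => /(_ isT) {1}->; rewrite addNr.
Qed.

Lemma wop_W0 b x w : W x -> W w -> wop b x w = 0.
Proof. by move=> Wx Ww; case: b; rewrite /= !(opW SW). Qed.

(** As a later letter an element of W acts by zero. As the first letter it gives [2 T_y R_y x1],
    because [T_y T_y = 0], and by [op_four] the R that follows kills this. *)
Lemma chain_word_W x x1 y Z : ~~ odd (size Z) -> W x1 ->
  chain_word (x + x1) y Z = chain_word x y Z.
Proof.
move=> oZ Wx1.
have wz b w s1 s2 v : W w -> W v -> wfold b w (s1 ++ v :: s2) = 0.
  by move=> Ww Wv; rewrite wfold_cat /= wop_W0 ?wfold0 //; apply: (wfold_W SW).
have kz u v t s1 s2 : W v -> kval (Some true) ([:: u, t & s1] ++ v :: s2) = 0.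
  move=> Wv; case: s1 => [|z s1]; first exact: (wz _ _ [::]) (W_brac SW _ _) _.
  exact: (wz _ _ (z :: s1)) (W_brac SW _ _) _.
have k0 s : s != [::] -> kval (Some true) [:: x1, y, y & s] = 0.
  case: s => // z s _; rewrite /= [Top y _](_ : _ = 2%:R *: Top y (x1 ** y)); last first.
    have := opTT VB x1 y y; rewrite /brac /Top !(namulE _) => e.
    by lc (-1) e; lmod F.
  have := op_four h2 VB SW y y z Wx1 => /(half2 h2) e.
  by rewrite namulZl e scaler0 wfold0.
rewrite /chain_word; set s := [:: x + x1; x + x1].
rewrite (kvalD _ [::]) [X in _ + X]k0 ?addr0; last by rewrite /s; case: (Z).
rewrite [[::] ++ _]/= /s (kvalD _ [:: x, y, y & Z]) [X in _ + X](kz x x1 y (y :: Z)) // addr0.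
have := kvalD (Some true) [:: x, y, y & Z ++ [:: x]] [::] x x1.
rewrite /= -!catA /= => ->; rewrite [X in _ + X](_ : _ = 0) ?addr0 //.
by have := kz x x1 y (y :: Z ++ [:: x]) [::] Wx1; rewrite /= -catA.
Qed.

Record square_zero_ideal (J : B -> Prop) : Prop := {
  szD : forall u v, J u -> J v -> J (u + v);
  szN : forall u, J u -> J (- u);
  szMl : forall u v, J u -> J (u ** v);
  szMr : forall u v, J u -> J (v ** u);
  szM0 : forall u v, J u -> J v -> u ** v = 0
}.

Section SquareZero.
Variables (J : B -> Prop) (SJ : square_zero_ideal J).

Lemma sz_wop b z w : J w -> J (wop b z w).
Proof.
move=> Jw; case: b; last exact: (szMl SJ).
by apply: (szD SJ); [exact: (szMl SJ)|exact: (szMr SJ)].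
Qed.

Lemma sz_wfold b w s : J w -> J (wfold b w s).
Proof. by elim: s b w => //= z s IHs b w Jw; apply: IHs; exact: sz_wop. Qed.

Lemma sz_wop2 b z w : J z -> J (wop b z w).
Proof.
move=> Jz; case: b; last exact: (szMr SJ).
by apply: (szD SJ); [exact: (szMr SJ)|exact: (szMl SJ)].
Qed.

Lemma sz_wop0 b z w : J z -> J w -> wop b z w = 0.
Proof. by move=> Jz Jw; case: b; rewrite /= /Top !(szM0 SJ) // addr0. Qed.

Lemma sz_brac x y : J x -> J (brac x y).
Proof. by move=> Jx; apply: (szD SJ); [exact: (szMl SJ)|apply: (szN SJ); exact: (szMr SJ)]. Qed.

(** The first letter taken from [J] moves the word into [J], where the second one acts by zero. *)
Lemma sz_chain_word u v w y Z : [\/ J u /\ J v, J u /\ J w | J v /\ J w] ->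
  kval (Some true) [:: u, y, y & Z ++ [:: v; w]] = 0.
Proof.
have E : kval (Some true) [:: u, y, y & Z ++ [:: v; w]] =
    wfold true (brac u y) ((y :: Z) ++ [:: v; w]) by [].
rewrite E wfold_cat; set c := _ (+) _.
have -> b t : wfold b t [:: v; w] = wop (~~ b) w (wop b v t) by [].
case=> -[J1 J2].
- rewrite [wop c _ _]sz_wop0 ?wop0 //; apply: sz_wfold; exact: sz_brac.
- by rewrite sz_wop0 //; apply: sz_wop; apply: sz_wfold; exact: sz_brac.
by rewrite sz_wop0 //; exact: sz_wop2.
Qed.

End SquareZero.

(** There are three places for [x] and two ideals, so each of the eight terms has two places in the
    same ideal. *)
Lemma chain_word_ideals (J1 J2 : B -> Prop) x1 x2 y Z :
  square_zero_ideal J1 -> square_zero_ideal J2 -> J1 x1 -> J2 x2 ->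
  chain_word (x1 + x2) y Z = 0.
Proof.
move=> S1 S2 j1 j2; rewrite /chain_word; set x := x1 + x2.
have D1 := kvalD (Some true) [::] [:: y, y & Z ++ [:: x; x]] x1 x2.
have D2 u : kval (Some true) [:: u, y, y & Z ++ [:: x; x]] = _ :=
  kvalD (Some true) [:: u, y, y & Z] [:: x] x1 x2.
have D3 u v : kval (Some true) [:: u, y, y & Z ++ [:: v; x]] =
    kval (Some true) [:: u, y, y & Z ++ [:: v; x1]] + kval (Some true) [:: u, y, y & Z ++ [:: v; x2]].
  by have := kvalD (Some true) [:: u, y, y & Z ++ [:: v]] [::] x1 x2; rewrite /= -!catA.
rewrite [LHS]D1 ![[::] ++ _]/= !D2 ![_ ++ _]/= !D3.
have a1 w := @sz_chain_word _ S1 x1 x1 w y Z (Or31 _ _ (conj j1 j1)).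
have a2 v := @sz_chain_word _ S1 x1 v x1 y Z (Or32 _ _ (conj j1 j1)).
have a3 u := @sz_chain_word _ S1 u x1 x1 y Z (Or33 _ _ (conj j1 j1)).
have b1 w := @sz_chain_word _ S2 x2 x2 w y Z (Or31 _ _ (conj j2 j2)).
have b2 v := @sz_chain_word _ S2 x2 v x2 y Z (Or32 _ _ (conj j2 j2)).
have b3 u := @sz_chain_word _ S2 u x2 x2 y Z (Or33 _ _ (conj j2 j2)).
by rewrite a1 a2 a3 a1 b1 b2 b3 b1 !addr0.
Qed.

Lemma chainw_decomposition n : (forall x, exists J1 J2 x1 x2 w,
    [/\ square_zero_ideal J1, square_zero_ideal J2, J1 x1, J2 x2 & W w /\ x = x1 + x2 + w]) ->
  chainw B n.
Proof.
move=> dec x y Z sZ; have [J1 [J2 [x1 [x2 [w [S1 S2 j1 j2 [Ww ->]]]]]]] := dec x.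
rewrite -/(chain_word _ _ _) chain_word_W ?sZ ?odd_double //.
exact: chain_word_ideals S1 S2 j1 j2.
Qed.

End ChainWords.

(** * The Grassmann algebra of rank 2 *)

Lemma rceq (R : comPzRingType) (k E1 E2 X Y : R) : E1 = E2 -> X - k * (E1 - E2) = Y -> X = Y.
Proof. by move=> ->; rewrite subrr mulr0 subr0. Qed.

Tactic Notation "rc" uconstr(k) constr(e) :=
  match goal with F : fieldType |- _ => refine (@rceq F k _ _ _ _ e _) end.

Section OddMultiples.
Variables (F : fieldType) (h2 : 2%:R != 0 :> F) (A : naAlgType F) (l : seq (F * {fset nat})).
Hypothesis l_odd : all (fun q => odd #|` q.2|) l.
Implicit Types S T : {fset nat}.

(* the product of the odd element g = sum_(c, U) c e_U and the word e_S (x) a *)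
Definition odd_mul S (a : A) : gfun A :=
  \sum_(q <- l) (q.1 * sg2 F q.2 S) *: gword (q.2 `|` S)%fset a.

(** The multiples of [g] in the whole tensor product. No parity is imposed on [S] and [a], so the
    ideal can be pulled back to any algebra embedded there. *)
Inductive odd_ideal : gfun A -> Prop :=
  | OI_0 : odd_ideal 0
  | OI_add f g : odd_ideal f -> odd_ideal g -> odd_ideal (f + g)
  | OI_gen S a : odd_ideal (odd_mul S a).

Lemma odd_mulr S T (a b : A) :
  odd_mul S a ** gword T b = odd_mul (S `|` T)%fset (sg2 F S T *: (a ** b)).
Proof.
rewrite /odd_mul; elim: (l) => [|q r IH]; first by rewrite !big_nil namul0r.
rewrite !big_cons namulDl IH; congr (_ + _).
rewrite namulZl gword_mulE !scalerA gwordZ scalerA fsetUA; congr (_ *: _).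
have e1 := sg2Ul F q.2 S T; have e2 := sg2Ur F q.2 S T.
by rc (q.1) e1; rc (- q.1) e2; ring.
Qed.

Lemma odd_mull S T (a b : A) : gword T b ** odd_mul S a =
  odd_mul (T `|` S)%fset (((-1) ^+ (odd #|` T|) * sg2 F T S) *: (b ** a)).
Proof.
rewrite /odd_mul; elim: (l) l_odd => [|q r IH]; first by rewrite !big_nil namulr0.
move=> /= /andP[qo /IH {}IH]; rewrite !big_cons namulDr IH; congr (_ + _).
rewrite namulZr gword_mulE !scalerA gwordZ scalerA.
have -> : (T `|` (q.2 `|` S) = q.2 `|` (T `|` S))%fset by rewrite fsetUCA.
congr (_ *: _); have e0 := sg2C F q.2 T; rewrite qo /= in e0.
have e1 := sg2Ur F T q.2 S; have e2 := sg2Ur F q.2 T S.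
rc q.1 e1; rc (- (q.1 * (-1) ^+ odd #|` T|)) e2.
by rc (q.1 * sg2 F q.2 S * sg2 F T S) e0; ring.
Qed.

(** The product contains [g] twice, and an odd element has square zero: exchanging the two terms of
    [g] in the double sum changes the sign of the coefficient. *)
Lemma odd_mulM S T (a b : A) : odd_mul S a ** odd_mul T b = 0.
Proof.
pose c i j := sg2 F i S * sg2 F j T * (sg2 F i j *
  sg2 F i T * (sg2 F S j * sg2 F S T)).
pose t (q r : F * {fset nat}) : gfun A := (q.1 * r.1 * c q.2 r.2) *:
  gword (q.2 `|` S `|` (r.2 `|` T))%fset (a ** b).
have -> : odd_mul S a ** odd_mul T b = \sum_(q <- l) \sum_(r <- l) t q r.
  rewrite {1}/odd_mul; elim: {1 2}l => [|q s IH]; first by rewrite !big_nil namul0r.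
  rewrite !big_cons namulDl IH; congr (_ + _); rewrite /odd_mul.
  elim: (l) => [|r u IHu]; first by rewrite !big_nil namulr0.
  rewrite !big_cons namulDr IHu; congr (_ + _).
  rewrite namulZl namulZr gword_mulE !scalerA /t; congr (_ *: _); rewrite /c.
  have e1 := sg2Ul F q.2 S (r.2 `|` T)%fset.
  have e2 := sg2Ur F q.2 r.2 T.
  have e3 := sg2Ur F S r.2 T.
  rc (q.1 * r.1 * sg2 F r.2 T) e1.
  rc (q.1 * r.1 * sg2 F q.2 S * sg2 F S (r.2 `|` T)%fset) e2.
  rc (q.1 * r.1 * sg2 F q.2 S * sg2 F q.2 r.2 *
    sg2 F q.2 T) e3; ring.
apply: (half2 h2); rewrite {1}exchange_big -big_split big1_seq //= => q ql.
rewrite -big_split big1_seq //= => r rl; rewrite /t.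
have -> : (r.2 `|` S `|` (q.2 `|` T) = q.2 `|` S `|` (r.2 `|` T))%fset.
  apply/fsetP => z; rewrite !inE.
  by case: (z \in r.2); case: (z \in S); case: (z \in q.2); case: (z \in T).
rewrite -scalerDl [X in X *: _](_ : _ = 0) ?scale0r // /c.
rewrite (sg2C F q.2 r.2) (sg2C F q.2 S).
have odd_l (s : F * {fset nat}) : s \in l -> odd #|` s.2|.
  by move: l_odd; elim: (l) => //= u m IH /andP[uo /IH mo]; rewrite inE => /orP[/eqP ->|/mo].
by rewrite (sg2C F r.2 S) !odd_l //=; ring.
Qed.

Lemma odd_idealN f : odd_ideal f -> odd_ideal (- f).
Proof.
elim=> [|g h _ IHg _ IHh|S a]; first by rewrite oppr0; constructor.
  by rewrite opprD; constructor.
suff -> : - odd_mul S a = odd_mul S (- a) by constructor.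
rewrite /odd_mul -sumrN; apply: eq_bigr => q _.
by rewrite -[in RHS]scaleN1r gwordZ scalerA mulrN1 scaleNr.
Qed.

Lemma odd_idealMl f g : odd_ideal f -> finsupp_gfun g -> odd_ideal (f ** g).
Proof.
move=> Jf fg; pattern g; apply: (finsupp_gfun_ind fg) => [|g1 g2|T].
- by rewrite namulr0; constructor.
- by rewrite namulDr; constructor.
elim: Jf => [|f1 f2 _ IH1 _ IH2|S a]; first by rewrite namul0r; constructor.
  by rewrite namulDl; constructor.
by rewrite odd_mulr; constructor.
Qed.

Lemma odd_idealMr f g : odd_ideal f -> finsupp_gfun g -> odd_ideal (g ** f).
Proof.
move=> Jf fg; pattern g; apply: (finsupp_gfun_ind fg) => [|g1 g2|T].
- by rewrite namul0r; constructor.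
- by rewrite namulDl; constructor.
elim: Jf => [|f1 f2 _ IH1 _ IH2|S a]; first by rewrite namulr0; constructor.
  by rewrite namulDr; constructor.
by rewrite odd_mull; constructor.
Qed.

Lemma odd_idealM0 f g : odd_ideal f -> odd_ideal g -> f ** g = 0.
Proof.
move=> Jf Jg; elim: Jf => [|f1 f2 _ IH1 _ IH2|S a]; first by rewrite namul0r.
  by rewrite namulDl IH1 IH2 addr0.
elim: Jg => [|g1 g2 _ IH1 _ IH2|T b]; first by rewrite namulr0.
  by rewrite namulDr IH1 IH2 addr0.
exact: odd_mulM.
Qed.

Lemma odd_ideal_square_zero (B : naAlgType F) (p : B -> gfun A) : hom p -> injective p ->
  (forall x, finsupp_gfun (p x)) -> square_zero_ideal (fun x : B => odd_ideal (p x)).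
Proof.
move=> [pD pZ pM] pI pf; split=> [u v Ju Jv|u Ju|u v Ju|u v Ju|u v Ju Jv].
- by rewrite pD; constructor.
- by rewrite -scaleN1r pZ scaleN1r; exact: odd_idealN.
- by rewrite pM; apply: odd_idealMl.
- by rewrite pM; apply: odd_idealMr.
by apply: pI; rewrite pM (odd_idealM0 Ju Jv) -(scale0r (0 : B)) pZ scale0r.
Qed.

Lemma odd_mul_empty a : odd_mul fset0 a = \sum_(q <- l) q.1 *: gword q.2 a.
Proof.
apply: eq_bigr => q _; rewrite fsetU0 /sg2 fdisjointX0 /inversions.
by rewrite big1_seq ?expr0 ?mulr1 // => s _; rewrite big_nil.
Qed.

End OddMultiples.

Section Transfer.
Variable F : fieldType.

Lemma hom_val (A : naAlgType F) (D : subalg A) : hom (val : subalg_sort D -> A).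
Proof. by split=> [x y|k x|x y] //; rewrite ?GRing.valD ?GRing.valZ. Qed.

Lemma satisfies_subalg (A : naAlgType F) (D : subalg A) f :
  satisfies A f -> satisfies (subalg_sort D) f.
Proof.
by move=> Af a; apply: val_inj; rewrite (hom_neval a f (hom_val D)) Af.
Qed.

Lemma V_subalg (A : naAlgType F) (D : subalg A) : V A -> V (subalg_sort D).
Proof. by move=> VA i; apply: satisfies_subalg; exact: VA. Qed.

End Transfer.

Section Gtilde.
Variables (F : fieldType) (h2 : 2%:R != 0 :> F).
Local Notation Fr := (freeSuper (@V F) 2).
Local Notation Gt := (Gtilde (@V F) 2).

Lemma Gtilde_V : V Gt.
Proof. apply: V_subalg; apply: freeSuper_class; exact: V_is_variety. Qed.

Definition gval (x : Gt) : gfun Fr := val (val x).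

Lemma gvalD x y : gval (x + y) = gval x + gval y.
Proof. by rewrite /gval !GRing.valD. Qed.
Lemma gvalM x y : gval (x ** y) = gval x ** gval y.
Proof. by []. Qed.
Lemma gval_inj : injective gval.
Proof. by move=> x y e; apply: val_inj; apply: val_inj. Qed.

Lemma gval_finsupp x : finsupp_gfun (gval x).
Proof. by case: (grassP (val x)). Qed.

Lemma gval_hom : hom gval.
Proof.
by split=> [|k x|]; [exact: gvalD|rewrite /gval !GRing.valZ|exact: gvalM].
Qed.

Definition lin_part (i : 'I_2) (x : Gt) : Prop :=
  exists2 l, all (fun q => odd #|` q.2|) l & gval x = odd_mul l fset0 (free_gen (@V F) i).

Definition decomposed (z : Gt) : Prop := exists x1 x2 w,
  [/\ lin_part ord0 x1, lin_part ord_max x2, square w & z = x1 + x2 + w].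

Lemma lin_part0 i : lin_part i 0.
Proof. by exists [::] => //; rewrite /odd_mul big_nil. Qed.

Lemma lin_partL i k x y : lin_part i x -> lin_part i y -> lin_part i (k *: x + y).
Proof.
move=> [l lo lx] [m mo my]; exists ([seq (k * q.1, q.2) | q <- l] ++ m).
  by rewrite all_cat all_map mo andbT.
rewrite gvalD /odd_mul big_cat big_map /= -/(odd_mul m _ _) -my; congr (_ + _).
have -> : gval (k *: x) = k *: gval x by rewrite /gval !GRing.valZ.
rewrite lx /odd_mul scaler_sumr.
by apply: eq_bigr => q _; rewrite scalerA mulrA.
Qed.

Lemma decomposedP (z : Gt) : decomposed z.
Proof.
(* The components must themselves lie in the subalgebra, so the induction produces an element of it
   above [x] together with its decomposition. *)
suff dec x : generated (fun x : grass_env Fr => exists (i : 'I_2) (j : nat),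
      val x = gword [fset (i + 2 * j)%N]%fset (free_gen (@V F) i)) x ->
    exists2 z : Gt, val z = x & decomposed z.
  have /asboolP /dec[z' e d] := subalg_valP z.
  by have -> : z = z' by apply: val_inj; rewrite e.
elim=> {z x} [x|| k x y _ [x' <- [x1 [x2 [w [L1 L2 Sw ->]]]]] _ [y' <- [y1 [y2 [v [M1 M2 Sv ->]]]]]
  |x y _ [x' <- _] _ [y' <- _]].
- move=> gx; have [i [j xE]] := gx.
  have Gx : subalg_mem (generated_subalg (fun x : grass_env Fr => exists (i : 'I_2) (j : nat),
      val x = gword [fset (i + 2 * j)%N]%fset (free_gen (@V F) i))) x.
    by apply/asboolP; exact: Gen_in.
  pose z : Gt := SubalgElt Gx; exists z => //.
  have Lz : lin_part i z.
    exists [:: (1, [fset (i + 2 * j)%N]%fset)]; first by rewrite /= cardfs1.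
    by rewrite odd_mul_empty big_seq1 scale1r.
  have [i0|i1] : i = ord0 \/ i = ord_max.
    by case: i {xE Lz} => -[|[|m]] // lm; [left|right]; apply: val_inj.
    exists z, 0, 0; split; rewrite ?addr0 //; [by rewrite -i0|exact: lin_part0|exact: Sq_0].
  exists 0, z, 0; split; rewrite ?addr0 ?add0r //; [exact: lin_part0|by rewrite -i1|exact: Sq_0].
- exists 0 => //; exists 0, 0, 0; rewrite !addr0.
  by split=> //; [exact: lin_part0|exact: lin_part0|exact: Sq_0].
- exists (k *: (x1 + x2 + w) + (y1 + y2 + v)); first by rewrite GRing.valD GRing.valZ.
  exists (k *: x1 + y1), (k *: x2 + y2), (k *: w + v); split; try exact: lin_partL.
    exact: Sq_lin.
  by lmod F.
exists (x' ** y') => //; exists 0, 0, (x' ** y'); rewrite !add0r.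
by split=> //; [exact: lin_part0|exact: lin_part0|exact: Sq_mul].
Qed.

Lemma Gtilde_chain n : (0 < n)%N -> satisfies Gt (chain_identity F n).
Proof.
move=> n0; apply: (chainw_satisfies h2 Gtilde_V n0).
apply: (chainw_decomposition h2 Gtilde_V (square_squarelike Gtilde_V)) => x.
have [x1 [x2 [w [[l lo lx] [m mo mx] Sw ->]]]] := decomposedP x.
exists (fun x => odd_ideal l (gval x)), (fun x => odd_ideal m (gval x)), x1, x2, w; split=> //.
- exact: odd_ideal_square_zero gval_hom gval_inj gval_finsupp.
- exact: odd_ideal_square_zero gval_hom gval_inj gval_finsupp.
- by rewrite lx; constructor.
by rewrite mx; constructor.
Qed.

Variables (S : superAlgType F) (u : 'I_2 -> S).
Hypotheses (VS : V (grass_env S)) (uo : forall i, homog true (u i)).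

Definition odd_gens (x : grass_env S) : Prop :=
  exists (i : 'I_2) (j : nat), val x = gword [fset (i + 2 * j)%N]%fset (u i).

(** Evaluation of the free superalgebra at [u], applied to coefficients, maps the Grassmann algebra
    of rank 2 onto the subalgebra generated by [odd_gens]. *)
Lemma Gtilde_generated f (a : nat -> grass_env S) : satisfies Gt f ->
  (forall i, generated odd_gens (a i)) -> neval a f = 0.
Proof.
move=> sat ga; pose e := free_eval (C := @V F) u.
have e0 : e 0 = 0 by rewrite /e (free_evalE VS uo).
have eD x y : e (x + y) = e x + e y by rewrite /e (free_evalE VS uo).
have eZ k x : e (k *: x) = k *: e x by rewrite /e (free_evalE VS uo).
have eM x y : e (x ** y) = e x ** e y by rewrite /e (free_evalE VS uo).
pose push (g : grass_env Fr) : gfun S := fun W => e (val g W).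
have pushP g : grass_pred (push g).
  have [[s gs] hg] := grassP g.
  split=> [|W]; last by move/free_homogP: (hg W); apply.
  by exists s => W nz; apply: gs => g0; apply: nz; rewrite /push g0 e0.
pose p (z : Gt) : grass_env S := SubalgElt (asboolT (pushP (val z)) : subalg_mem (grass_subalg S) _).
have hp : hom p.
  split=> [x y|k x|x y]; apply: val_inj; apply/funext => W.
  - by rewrite GRing.valD /= /push !GRing.valD gfunD eD.
  - by rewrite GRing.valZ /= /push !GRing.valZ gfunZ eZ.
  - rewrite /= /push [LHS](big_morph e eD e0); apply: eq_bigr => T _.
    by rewrite eZ eM.
have lift x : generated odd_gens x -> exists z, p z = x.
  elim=> {x} [x [i [j xE]]||k x y _ [x' <-] _ [y' <-]|x y _ [x' <-] _ [y' <-]].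
  - have hg : grass_pred (gword [fset (i + 2 * j)%N]%fset (free_gen (@V F) i)).
      by apply: grass_pred_gword; rewrite cardfs1; exact: free_gen_odd.
    pose g : grass_env Fr := SubalgElt (asboolT hg : subalg_mem (grass_subalg Fr) _).
    have gg : subalg_mem (generated_subalg (fun x : grass_env Fr => exists (i : 'I_2) (j : nat),
        val x = gword [fset (i + 2 * j)%N]%fset (free_gen (@V F) i))) g.
      by apply/asboolP; apply: Gen_in; exists i, j.
    exists (SubalgElt gg); apply: val_inj; rewrite xE /=; apply/funext => W.
    rewrite /push /= /gword; case: eqP => // _.
    by rewrite /e free_eval_pi.
  - exists 0; have [_ pZ _] := hp; rewrite -(scale0r (0 : Gt)) pZ scale0r //.
  - by exists (k *: x' + y'); have [pD pZ _] := hp; rewrite pD pZ.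
  - by exists (x' ** y'); have [_ _ pM] := hp; rewrite pM.
have [b bE] := choice (fun i => lift _ (ga i)).
have -> : a = p \o b by apply/funext => i /=; rewrite bE.
by rewrite -(hom_neval b f hp) sat; have [_ pZ _] := hp; rewrite -(scale0r (0 : Gt)) pZ scale0r.
Qed.

End Gtilde.

(** * Identities of the five-dimensional superalgebra *)

Section FiveDim.
Variable F : fieldType.

(** Coordinates are ordered [a, b] in O and [d, e] in D, so [beta] and [rho] are the projections to
    [b] and to [a], and [rr] is the projection to [d]. *)
Definition five_data : famdata F.
refine (@FamData F (F^o * F^o)%type F^o (F^o * F^o)%type
  (fun o => o.2) (fun o => o.1) 1 (fun o c => (o.1 * c, o.2 * c)) (fun d => d.1) id
  _ _ _ _ _ _ _).
- by [].
- by [].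
- by move=> k x y c /=; congr (_, _) => /=; rewrite mulrDl -scalerAl.
- by move=> k x c d /=; congr (_, _) => /=; rewrite mulrDr -scalerAr.
- by [].
- by [].
- by [].
Defined.

Definition five : superAlgType F := fam five_data.

Definition mk5 (a b c d e : F) : five := ((a, b), c, (d, e)).

Lemma mk5M a b c d e a' b' c' d' e' :
  mk5 a b c d e ** mk5 a' b' c' d' e' =
  mk5 0 0 (b * b' + a' * d + a * d') (a * c') (b * c').
Proof.
apply: fam_eq => //=; rewrite /GRing.scale /= mulr1 //.
Qed.

Lemma five_eq (x y : five) : x.1.1.1 = y.1.1.1 -> x.1.1.2 = y.1.1.2 -> x.1.2 = y.1.2 ->
  x.2.1 = y.2.1 -> x.2.2 = y.2.2 -> x = y.
Proof. by case: x y => [[[? ?] ?] [? ?]] [[[? ?] ?] [? ?]] /= -> -> -> -> ->. Qed.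

Lemma five_dim : has_dim (fun _ : five => True) 5.
Proof.
exists (fun i : 'I_5 => mk5 (i == 0%N :> nat)%:R (i == 1%N :> nat)%:R (i == 2%N :> nat)%:R
  (i == 3%N :> nat)%:R (i == 4%N :> nat)%:R); split=> // x _.
pose i1 : 'I_5 := lift ord0 ord0; pose i2 : 'I_5 := lift ord0 (lift ord0 ord0).
pose i3 : 'I_5 := lift ord0 (lift ord0 (lift ord0 ord0)).
pose i4 : 'I_5 := lift ord0 (lift ord0 (lift ord0 (lift ord0 ord0))).
have sumE (c : {ffun 'I_5 -> F}) : \sum_i c i *: mk5 (i == 0%N :> nat)%:R (i == 1%N :> nat)%:R
   (i == 2%N :> nat)%:R (i == 3%N :> nat)%:R (i == 4%N :> nat)%:R =
   mk5 (c ord0) (c i1) (c i2) (c i3) (c i4).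
  rewrite !big_ord_recl big_ord0 /mk5.
  by congr (_, _, _, (_, _)); rewrite /= /GRing.scale /= !(mulr0, mulr1, addr0, add0r).
exists [ffun i : 'I_5 => nth 0 [:: x.1.1.1; x.1.1.2; x.1.2; x.2.1; x.2.2] i]; split.
  by rewrite sumE !ffunE /=; case: x => [[[? ?] ?] [? ?]].
move=> c; rewrite sumE => ->; apply/ffunP => i; rewrite ffunE /=.
by case: i => -[|[|[|[|[|i]]]]] //= lti; congr (c _); apply: val_inj.
Qed.

Lemma five_even_dim : has_dim (fun x : five => homog false x) 1.
Proof.
exists (fun=> mk5 0 0 1 0 0); split=> [_|x [xo xd]]; first by split.
exists [ffun=> x.1.2]; split=> [|c].
  rewrite big_ord1 ffunE; apply: fam_eq; rewrite ?xo ?xd //=.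
  + by rewrite scaler0.
  + by rewrite /GRing.scale /= mulr1.
  by rewrite scaler0.
rewrite big_ord1 => ->; apply/ffunP => i; rewrite ffunE (ord1 i) /=.
by rewrite /GRing.scale /= mulr1.
Qed.

Definition ga := mk5 1 0 0 0 0.
Definition gb := mk5 0 1 0 0 0.

Lemma five_generated (x : five) : generated (fun z => z = ga \/ z = gb) x.
Proof.
have Ga : generated (fun z => z = ga \/ z = gb) ga by apply: Gen_in; left.
have Gb : generated (fun z => z = ga \/ z = gb) gb by apply: Gen_in; right.
have Gc := Gen_mul Gb Gb; have Gd := Gen_mul Ga Gc; have Ge := Gen_mul Gb Gc.
have -> : x = x.1.1.1 *: ga + (x.1.1.2 *: gb + (x.1.2 *: (gb ** gb) +
    (x.2.1 *: (ga ** (gb ** gb)) + (x.2.2 *: (gb ** (gb ** gb)) + 0)))).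
  case: x => [[[a b] c] [d e]]; rewrite /ga /gb !mk5M.
  by rewrite addr0; apply: five_eq; rewrite /= /GRing.scale /=; ring.
do 5 (apply: Gen_lin; first by []); exact: Gen_0.
Qed.

End FiveDim.

(** * Isolating multilinear words by their supports *)

Section Supports.
Variables (F : fieldType) (A : naAlgType F) (E : nat -> {fset nat}) (l : nat -> A).
Hypothesis E_disjoint : forall q r, q != r -> [disjoint E q & E r]%fset.
Hypothesis E_neq0 : forall q, E q != fset0.

(** The Grassmann factor of a word in the test elements: its only possible index set is the union of
    the supports of its letters, and a repeated letter gives zero. *)
Definition supported (h : seq nat) (x : gfun A) := forall W, x W <> 0 ->
  uniq h /\ forall i, (i \in W) = has (fun q => i \in E q) h.

Lemma supported0 h : supported h 0. Proof. by move=> W []. Qed.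

Lemma supportedD h x y : supported h x -> supported h y -> supported h (x + y).
Proof.
move=> hx hy W nz; have [x0|/eqP/hx//] := eqVneq (x W) 0.
by apply: hy => y0; apply: nz; rewrite gfunD x0 y0 addr0.
Qed.

Lemma supportedZ h k x : supported h x -> supported h (k *: x).
Proof. by move=> hx W nz; apply: hx => x0; apply: nz; rewrite gfunZ x0 scaler0. Qed.

Lemma supportedN h x : supported h x -> supported h (- x).
Proof. by rewrite -scaleN1r; exact: supportedZ. Qed.

Lemma supported_perm h h' x : perm_eq h h' -> supported h x -> supported h' x.
Proof.
move=> p hx W /hx[u e]; rewrite -(perm_uniq p); split=> // i.
by rewrite e; apply: perm_has.
Qed.

Lemma has_index h q i : i \in E q -> has (fun r => i \in E r) h = (q \in h).
Proof.
move=> iq; apply/hasP/idP => [[r rh ir]|qh]; last by exists q.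
have [->//|qr] := eqVneq q r.
by move: (E_disjoint qr) => /fdisjointP /(_ _ iq); rewrite ir.
Qed.

Lemma supportedM h h' x y : supported h x -> supported h' y -> supported (h ++ h') (x ** y).
Proof.
move=> hx hy W nz.
have [T [TW xT yT]] : exists T, [/\ (T `<=` W)%fset, x T <> 0 & y (W `\` T)%fset <> 0].
  apply: contrapT => no; apply: nz; rewrite /namul /= /gfun_mul big1_seq // => T /andP[_].
  rewrite fpowersetE => TW; have [x0|xT] := eqVneq (x T) 0; first by rewrite x0 namul0r scaler0.
  have [y0|yT] := eqVneq (y (W `\` T)%fset) 0; first by rewrite y0 namulr0 scaler0.
  by case: no; exists T; split=> //; apply/eqP.
have [uh eh] := hx _ xT; have [uh' eh'] := hy _ yT; split=> [|i]; last first.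
  rewrite has_cat -eh -eh' inE.
  by case iT : (i \in T) => //=; exact: (fsubsetP TW).
rewrite cat_uniq uh uh' andbT; apply/hasPn => q qh'; apply/negP => qh.
have /fset0Pn[i iq] := E_neq0 q.
have := eh' i; rewrite inE eh !(has_index _ iq) qh qh' => /esym.
by [].
Qed.

Lemma supported_gword q : supported [:: q] (gword (E q) (l q)).
Proof.
move=> W; rewrite /gword; case: eqP => // -> _; split=> // i.
by rewrite /= orbF.
Qed.

Local Notation yg := (fun q => gword (E q) (l q)).

Lemma supported_kval k h : supported h (kval k (map yg h)).
Proof.
have sT b z q s : supported s z -> supported (rcons s q) (wop b (yg q) z).
  move=> sz; have s1 : supported (rcons s q) (z ** yg q).
    by rewrite -cats1; apply: supportedM => //; exact: supported_gword.
  case: b => //; apply: supportedD => //.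
  apply: (@supported_perm (q :: s)); first by rewrite perm_sym perm_rcons.
  by rewrite -cat1s; apply: supportedM => //; exact: supported_gword.
have sF b z s t : supported s z -> supported (s ++ t) (wfold b z (map yg t)).
  elim: t s b z => [|q t IH] s b z sz; first by rewrite cats0.
  by rewrite -cat_rcons; apply: IH; exact: sT.
case: k => [b|]; case: h => [|i [|j [|q t]]] //=; try exact: supported0.
- apply: (sF (~~ b) _ [:: i; j; q]); apply: (sT b _ q [:: i; j]).
  apply: supportedD; last apply: supportedN.
    by apply: (supportedM (h := [:: i]) (h' := [:: j])); exact: supported_gword.
  apply: (@supported_perm [:: j; i]); first by rewrite (perm_catC [:: j] [:: i]).
  by apply: (supportedM (h := [:: j]) (h' := [:: i])); exact: supported_gword.
- exact: supported_gword.
- by apply: (supportedM (h := [:: i]) (h' := [:: j])); exact: supported_gword.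
Qed.

Lemma kval_top n (U : {fset nat}) k h : (forall i, (i \in U) = has (fun q => i \in E q) (iota 0 n)) ->
  all (gtn n) h -> ~~ perm_eq h (iota 0 n) -> kval k (map yg h) U = 0.
Proof.
move=> UE hn; apply: contraNeq => /eqP /supported_kval[uh eh].
apply: uniq_perm; rewrite ?iota_uniq // => q.
have /fset0Pn[i iq] := E_neq0 q.
by have := UE i; rewrite eh !(has_index _ iq).
Qed.

End Supports.

Lemma kval_hom (F : fieldType) (A B : naAlgType F) (p : A -> B) k v : hom p ->
  p (kval k v) = kval k (map p v).
Proof.
case=> pD pZ pM; have p0 : p 0 = 0 by rewrite -(scale0r (0 : A)) pZ scale0r.
have pB x y : p (x - y) = p x - p y by rewrite -!scaleN1r pD pZ.
have pw b z w : p (wop b z w) = wop b (p z) (p w) by case: b; rewrite /= /Top ?pD !pM.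
have pf b w s : p (wfold b w s) = wfold b (p w) (map p s).
  by elim: s b w => //= z s IHs b w; rewrite IHs pw.
case: k => [b|]; case: v => [|x [|y [|z s]]] //=.
by rewrite pf pw /brac pB !pM.
Qed.

(** * Evaluations in the five-dimensional superalgebra *)

Section Star.
Variables (F : fieldType) (h2 : 2%:R != 0 :> F).
Let A := five F.
Let C : naAlgType F := grass_env A.

Definition five_u (i : 'I_2) : A := if i == ord0 then ga F else gb F.

(** Implied both by being an identity of the Grassmann algebra of rank 2 and by being one of the
    full envelope, so one argument serves both varieties. *)
Definition testable (f : npoly F nat) := forall a : nat -> C,
  (forall i, generated (odd_gens five_u) (a i)) -> neval a f = 0.

Variables (f : npoly F nat) (L : seq (F * word)).
Hypotheses (tf : testable f)
  (fL : forall B : naAlgType F, V B -> forall a : nat -> B, neval a f = fval a L).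
Variables (n : nat) (phi : nat -> nat) (E : nat -> {fset nat}) (l : nat -> A).
Hypothesis E_disjoint : forall q r, q != r -> [disjoint E q & E r]%fset.
Hypothesis E_neq0 : forall q, E q != fset0.
Hypothesis El : forall q, exists2 x : C, generated (odd_gens five_u) x & val x = gword (E q) (l q).
Variable U : {fset nat}.
Hypothesis UE : forall i, (i \in U) = has (fun q => i \in E q) (iota 0 n).
Variable psi : A -> F.
Hypotheses (psiD : forall x y, psi (x + y) = psi x + psi y)
  (psiZ : forall k x, psi (k *: x) = k * psi x).

Local Notation yg := (fun q => gword (E q) (l q)).
Local Notation LL := (lift_list L n phi).

Definition top_coef k h := psi (kval k (map yg h) U).

(** Each variable is replaced by the sum of the test elements of its fresh letters, and the
    coefficient at the union of all supports is read through [psi]. By [kval_top] only lifts using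
    every letter once contribute. *)
Lemma star : \sum_(p <- LL None) p.1 * top_coef None p.2 +
  (\sum_(p <- LL (Some true)) p.1 * top_coef (Some true) p.2 +
   \sum_(p <- LL (Some false)) p.1 * top_coef (Some false) p.2) = 0.
Proof.
have [y yP] := choice (fun q => let: ex_intro2 x gx xE := El q in ex_intro (fun x => _ /\ _) x (conj gx xE)).
pose a i : C := \sum_(q <- iota 0 n | phi q == i) y q.
have ga i : generated (odd_gens five_u) (a i).
  rewrite /a; elim: (iota 0 n) => [|q s IH]; first by rewrite big_nil; exact: Gen_0.
  rewrite big_cons; case: ifP => // _.
  by rewrite -[y q]scale1r; apply: Gen_lin => //; case: (yP q).
have psi0 : psi 0 = 0 by rewrite -(scale0r (0 : A)) psiZ mul0r.
pose cf (x : C) : F := psi ((val x : gfun A) U).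
have cfD x z : cf (x + z) = cf x + cf z by rewrite /cf GRing.valD gfunD psiD.
have cfZ k x : cf (k *: x) = k * cf x by rewrite /cf GRing.valZ gfunZ psiZ.
have cf0 : cf 0 = 0 by rewrite -(scale0r (0 : C)) cfZ mul0r.
have cfk k h : cf (kval k (map y h)) = top_coef k h.
  rewrite /cf (kval_hom _ _ (hom_val _)) -map_comp /top_coef (_ : map _ h = map yg h) //.
  by apply: eq_map => q /=; case: (yP q).
have := tf ga; rewrite (fL (@env_V F h2 (five_data F))) => /(congr1 cf).
rewrite cf0 /fval (big_morph cf cfD cf0).
have step (p : F * word) : cf (p.1 *: wval a p.2) =
    \sum_(h <- lifts (iota 0 n) phi p.2.2 | perm_eq h (iota 0 n)) p.1 * top_coef p.2.1 h.
  rewrite cfZ /wval kval_lifts (big_morph cf cfD cf0) big_distrr /= [RHS]big_mkcond.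
  rewrite big_seq [RHS]big_seq; apply: eq_bigr => h hl; rewrite cfk; case: ifPn => // np.
  rewrite /top_coef (kval_top l E_disjoint E_neq0 p.2.1 UE _ np) ?psi0 ?mulr0 //.
  elim: (p.2.2) h hl {np} => [|i t IHt] h /=; first by rewrite inE => /eqP ->.
  case/allpairsP => -[q h'] /= [qQ h't ->] /=; rewrite IHt // andbT.
  by move: qQ; rewrite mem_filter mem_iota => /andP[].
under eq_bigr => p _ do rewrite step.
have LLE k := @sum_lift_list F F^o L n phi k (top_coef k).
move=> e; rewrite -[RHS]e (bigID (fun p : F * word => p.2.1 == None)) /=; congr (_ + _).
  by rewrite [LHS]LLE; apply: eq_bigr => p /eqP ->.
rewrite (bigID (fun p : F * word => p.2.1 == Some true)) /=; congr (_ + _).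
  rewrite [LHS]LLE; apply: eq_big => [[c [[[|]|] s]]|p /eqP ->] //=.
rewrite [LHS]LLE; apply: eq_big => [[c [[[|]|] s]]|p /eqP ->] //=.
Qed.

End Star.

Section TestElements.
Variables (F : fieldType).
Let A := five F.
Let C : naAlgType F := grass_env A.
Variables (isb : pred nat) (i0 : nat) (spd : bool).

(** In [odd_gens] even indices carry [a] and odd ones [b]. The shift by 6 leaves room for the
    special letter, and monotonicity in [q] makes the Grassmann signs those of [sg]. *)
Definition tpos q := (2 * q + 6 + isb q)%N.
(** The special letter [i0] takes the value [c = bb], made with indices 1 and 3, or [d = a(bb)],
    made with 0, 1 and 3. An [i0] that does not occur switches it off. *)
Definition tE0 : {fset nat} := if spd then [fset 0%N; 1%N; 3%N]%fset else [fset 1%N; 3%N]%fset.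
Definition tE q : {fset nat} := if q == i0 then tE0 else [fset tpos q]%fset.
Definition letter (x : bool) : A := if x then gb F else ga F.
Definition tl q : A :=
  if q == i0 then (if spd then mk5 0 0 0 1 0 else mk5 0 0 1 0 0) else letter (isb q).

Lemma tE0P i : i \in tE0 -> (i < 6)%N.
Proof. by rewrite /tE0; case: spd; rewrite !inE; lia. Qed.

Lemma tpos_inj q r : tpos q = tpos r -> q = r.
Proof. by rewrite /tpos; case: (isb q) (isb r) => [] []; lia. Qed.

Lemma tE_disjoint q r : q != r -> [disjoint tE q & tE r]%fset.
Proof.
move=> qr; apply/fdisjointP => i; rewrite /tE.
case: eqP => [qi|_]; case: eqP => [ri|_]; first by rewrite qi ri eqxx in qr.
- by move=> /tE0P i6; rewrite inE /tpos; apply/eqP; lia.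
- by rewrite inE => /eqP ->; apply/negP => /tE0P; rewrite /tpos; lia.
by rewrite !inE => /eqP ->; apply: contra qr => /eqP /tpos_inj ->.
Qed.

Lemma tE_neq0 q : tE q != fset0.
Proof.
apply/fset0Pn; rewrite /tE; case: eqP => _; last by exists (tpos q); rewrite inE.
by exists 1%N; rewrite /tE0; case: spd; rewrite !inE eqxx ?orbT.
Qed.

Lemma sg2_1 i j : i != j -> sg2 F [fset i]%fset [fset j]%fset = (-1) ^+ (j < i)%N.
Proof.
move=> ij; rewrite /sg2 fdisjoint1X inE ij /inversions.
by rewrite big_seq_fset1 big_seq_fset1.
Qed.

Lemma sg2_below (S : {fset nat}) j : {in S, forall i, (i < j)%N} -> sg2 F S [fset j]%fset = 1.
Proof.
move=> Sj; rewrite /sg2 fdisjointX1; have -> : j \notin S.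
  by apply/negP => /Sj; rewrite ltnn.
rewrite /inversions big1_seq // => i /andP[_ iS].
by rewrite big_seq_fset1 ltnNge ltnW // Sj.
Qed.

Lemma tE_gen q : exists2 x : C, generated (odd_gens (@five_u F)) x & val x = gword (tE q) (tl q).
Proof.
have base (x : bool) j : exists2 z : C, generated (odd_gens (@five_u F)) z &
    val z = gword [fset (2 * j + x)%N]%fset (letter x).
  have hg : grass_pred (gword [fset (2 * j + x)%N]%fset (letter x)).
    by apply: grass_pred_gword; rewrite cardfs1; case: x.
  exists (SubalgElt (asboolT hg : subalg_mem (grass_subalg A) _)) => //.
  apply: Gen_in; exists (if x then ord_max else ord0), j; rewrite [val _]/= addnC.
  by case: x {hg}.
rewrite /tE /tl; case: eqP => _; last first.
  by have := base (isb q) (q + 3)%N; rewrite /tpos mulnDr.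
have [b1 g1 e1] := base true 0%N; have [b3 g3 e3] := base true 1%N.
have [a0 g0 e0] := base false 0%N.
have cE : gword [fset 1%N]%fset (gb F) ** gword [fset 3%N]%fset (gb F) =
    gword [fset 1%N; 3%N]%fset (mk5 0 0 1 0 0 : A).
  rewrite gword_mulE sg2_1 // expr0 scale1r /gb mk5M.
  by congr (gword _ (mk5 _ _ _ _ _)); ring.
rewrite /tE0; case: spd; last first.
  by exists (b1 ** b3); [exact: Gen_mul|rewrite /= e1 e3 cE].
exists (a0 ** (b1 ** b3)); first by apply: Gen_mul => //; exact: Gen_mul.
rewrite /= e1 e3 cE e0 gword_mulE.
have -> : sg2 F [fset (2 * 0 + false)%N]%fset [fset 1%N; 3%N]%fset = 1.
  rewrite /sg2 fdisjoint1X !inE /= /inversions big_seq_fset1 big1 ?expr0 // => i _.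
rewrite scale1r /letter /ga mk5M fsetUA.
by congr (gword _ (mk5 _ _ _ _ _)); ring.
Qed.

Lemma brac_gword S T (z w : A) : brac (gword S z) (gword T w) = sg2 F S T *:
  gword (S `|` T)%fset (z ** w - (-1) ^+ (odd #|` S| && odd #|` T|) *: (w ** z)).
Proof.
rewrite /brac !gword_mulE (sg2C F S T) [(T `|` S)%fset]fsetUC.
by rewrite -!scaleN1r gwordD !gwordZ; lmod F.
Qed.

(** The operators R and T once the Grassmann factors are split off; [p] is the parity of [z], and
    the letter is odd. *)
Definition aop (b p : bool) (z : A) (x : bool) : A :=
  if b then z ** letter x + (-1) ^+ p *: (letter x ** z) else z ** letter x.

Arguments aop : simpl never.

Fixpoint afold (b p : bool) (z : A) (s : seq bool) : A :=
  if s is x :: s' then afold (~~ b) (~~ p) (aop b p z x) s' else z.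

Lemma wop_gword b S (z : A) j x : wop b (gword [fset j]%fset (letter x)) (gword S z) =
  sg2 F S [fset j]%fset *: gword (S `|` [fset j])%fset (aop b (odd #|` S|) z x).
Proof.
case: b; rewrite /= ?gword_mulE // /Top !gword_mulE (sg2C F S) cardfs1 andbT.
by rewrite [([fset j] `|` S)%fset]fsetUC gwordD gwordZ; lmod F.
Qed.

Local Notation yg := (fun q => gword (tE q) (tl q)).

Lemma sg2_prod i s : i \notin s ->
  \prod_(q <- s) sg2 F [fset tpos i]%fset [fset tpos q]%fset =
  (-1) ^+ count (fun q => (q < i)%N) s.
Proof.
elim: s => [|q s IH]; first by rewrite big_nil.
rewrite inE negb_or big_cons => /andP[iq /IH ->] /=.
rewrite sg2_1; last by apply: contra iq => /eqP /tpos_inj ->.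
rewrite exprD; congr (_ ^+ _ * _); rewrite /tpos.
by have [qi|iq'|qi] := ltngtP q i; [case: (isb i) (isb q) => [] []; lia
  |case: (isb i) (isb q) => [] []; lia|rewrite qi eqxx in iq].
Qed.

Lemma tE_letter q : q != i0 -> gword (tE q) (tl q) = gword [fset tpos q]%fset (letter (isb q)).
Proof. by rewrite /tE /tl => /negbTE ->. Qed.

Lemma fold_gword b S (z : A) s : uniq s -> i0 \notin s -> (forall q, q \in s -> tpos q \notin S) ->
  wfold b (gword S z) (map yg s) =
  ((\prod_(q <- s) sg2 F S [fset tpos q]%fset) * sg F s) *:
    gword (S `|` [fset tpos q | q in s])%fset (afold b (odd #|` S|) z (map isb s)).
Proof.
elim: s b S z => [|q s IH] b S z us i0s sS.
  rewrite big_nil mulr1 scale1r /=; congr gword.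
  by apply/fsetP => i; rewrite !inE; case: (i \in S) => //=; apply/esym/imfsetP => -[].
move: us i0s; rewrite /= inE negb_or => /andP[qs us] /andP[i0q i0s].
rewrite tE_letter 1?eq_sym // wop_gword -[_ *: gword _ _]addr0 wfold_lin wfold0 addr0.
have qS : tpos q \notin S by apply: sS; rewrite mem_head.
rewrite IH //; last first.
  move=> r rs; rewrite !inE negb_or sS ?inE ?rs ?orbT //=.
  by apply: contraNneq qs => /tpos_inj <-.
rewrite scalerA big_cons; congr (_ *: gword _ _).
- rewrite -mulrA -sg2_prod //; congr (_ * _); rewrite mulrA; congr (_ * _).
  rewrite -big_split; apply: eq_bigr => r _ /=.
  apply: (@mulfI _ (sg2 F S [fset tpos q]%fset)).
    by rewrite /sg2 fdisjointX1 qS signr_eq0.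
  exact: sg2Ul.
- apply/fsetP => i; rewrite !inE -orbA; congr (_ || _).
  apply/orP/imfsetP => [[/eqP ->|/imfsetP[r rs ->]]|[r]].
  + by exists q; rewrite ?mem_head.
  + by exists r => //=; rewrite inE rs orbT.
  + rewrite /= inE => /orP[/eqP -> ->|rs ->]; first by left.
    by right; apply/imfsetP; exists r.
congr afold; rewrite fsetUC cardfsU1 qS; by [].
Qed.

Definition Cst (c : F) : A := mk5 0 0 c 0 0.
Definition Dst (d e : F) : A := mk5 0 0 0 d e.
Arguments Cst : simpl never.
Arguments Dst : simpl never.

Lemma afold0 b p s : afold b p 0 s = 0.
Proof.
elim: s b p => //= x s IH b p; rewrite /aop namul0r namulr0 scaler0 addr0.
by case: b; exact: IH.
Qed.

Lemma aopTC c x : aop true false (Cst c) x = Dst (c * (~~ x)%:R) (c * x%:R).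
Proof.
by rewrite /aop /letter /Cst /ga /gb; case: x; rewrite !mk5M expr0 scale1r; apply: five_eq => /=; ring.
Qed.

Lemma aopRC p c x : aop false p (Cst c) x = 0.
Proof. by rewrite /aop /letter /Cst /ga /gb; case: x; rewrite !mk5M; apply: five_eq => /=; ring. Qed.

Lemma aopTD d e x : aop true true (Dst d e) x = 0.
Proof.
by rewrite /aop /letter /Dst /ga /gb; case: x; rewrite !mk5M expr1; apply: five_eq;
  rewrite /= /GRing.scale /=; ring.
Qed.

Lemma aopRD p d e x : aop false p (Dst d e) x = Cst (d * (~~ x)%:R).
Proof. by rewrite /aop /letter /Dst /Cst /ga /gb; case: x; rewrite !mk5M; apply: five_eq => /=; ring. Qed.

(** From [c], T with [a] leads to [d] and R with [a] back to [c]; T with [b] leads to [e], which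
    every further operator kills. So [b] can only be the last letter, at odd length; [belast] gives
    the letters before it. *)
Lemma afold_C c s : afold true false (Cst c) s = if odd (size s)
  then Dst (c * (all negb s)%:R) (c * (all negb (belast (head false s) (behead s)) && last false s)%:R)
  else Cst (c * (all negb s)%:R).
Proof.
have [n] := ubnP (size s); elim: n s c => // n IH [|x [|y s]] c /= sn.
- by rewrite mulr1.
- by rewrite aopTC andbT.
rewrite aopTC aopRD IH; last by lia.
rewrite negbK; case: ifP => os; last by rewrite -!mulnb !natrM !mulrA.
by case: s os {sn} => // z s _ /=; rewrite -!mulnb !natrM !mulrA.
Qed.

Lemma afold_C_odd c m u : ~~ odd (size m) -> afold true false (Cst c) (rcons m u) =
  Dst (c * (all negb (rcons m u))%:R) (c * (all negb m && u)%:R).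
Proof.
move=> om; rewrite afold_C size_rcons /= om; congr (Dst _ (c * (all _ _ && _)%:R)).
  by case: m {om} => //= x m; rewrite belast_rcons.
by rewrite last_rcons.
Qed.

Lemma afold_C_even c s : ~~ odd (size s) ->
  afold true false (Cst c) s = Cst (c * (all negb s)%:R).
Proof. by move=> os; rewrite afold_C (negbTE os). Qed.

Lemma afold_RD d e x s :
  afold false true (Dst d e) (x :: s) = afold true false (Cst (d * (~~ x)%:R)) s.
Proof. by rewrite /= aopRD. Qed.

Lemma afold_TD d e x s : afold true true (Dst d e) (x :: s) = 0.
Proof. by rewrite /= aopTD afold0. Qed.

Lemma afold_RC p c s : s != [::] -> afold false p (Cst c) s = 0.
Proof. by case: s => // x s _; rewrite /= aopRC afold0. Qed.

Lemma letter_sym x y : letter x ** letter y + letter y ** letter x = Cst (2%:R * (x && y)%:R).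
Proof. by rewrite /letter /Cst /ga /gb; case: x y => [] []; rewrite !mk5M; apply: five_eq => /=; ring. Qed.

(** The super bracket of the special value with a letter: [2c] for [d] and [a], zero for [d] and
    [b], and [-d] or [-e] for [c] with [a] or [b]. *)
Definition special_brac x : A :=
  if spd then Cst (2%:R * (~~ x)%:R) else Dst (- (~~ x)%:R) (- x%:R).

Lemma tl_special x : tl i0 ** letter x - (-1) ^+ spd *: (letter x ** tl i0) = special_brac x.
Proof.
rewrite /tl eqxx /special_brac /letter /Cst /Dst /ga /gb.
by case: spd x => [] []; rewrite !mk5M ?expr0 ?expr1; apply: five_eq;
  rewrite /= /GRing.scale /=; ring.
Qed.

Lemma card_tE0 : odd #|` tE0| = spd.
Proof.
by rewrite /tE0; case: spd; rewrite ?cardfs2 // fsetUC cardfsU1 !inE cardfs2.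
Qed.

Lemma kval_plain b i j s : uniq [:: i, j & s] -> i0 \notin [:: i, j & s] -> s != [::] ->
  kval (Some b) (map yg [:: i, j & s]) = sg F [:: i, j & s] *:
    gword ([fset tpos i; tpos j] `|` [fset tpos q | q in s])%fset
      (afold b false (Cst (2%:R * (isb i && isb j)%:R)) (map isb s)).
Proof.
move=> un; rewrite !inE !negb_or => /and3P[i0i i0j i0s] s0.
have -> : kval (Some b) (map yg [:: i, j & s]) =
    wfold b (brac (gword (tE i) (tl i)) (gword (tE j) (tl j))) (map yg s) by case: (s) s0.
move: un; rewrite /= inE negb_or => /and3P[/andP[ij is'] js us].
rewrite !tE_letter 1?eq_sym // brac_gword !cardfs1 /= expr1 scaleN1r opprK letter_sym.
rewrite -[_ *: gword _ _]addr0 wfold_lin wfold0 addr0.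
have pij : tpos i != tpos j by apply: contra ij => /eqP /tpos_inj ->.
rewrite fold_gword //; last first.
  by move=> q qs; rewrite !inE negb_or; apply/andP; split;
    [apply: contraNneq is' => /tpos_inj <-|apply: contraNneq js => /tpos_inj <-].
rewrite scalerA; congr (_ *: gword _ (afold _ _ _ _)).
- have pE : \prod_(q <- s) sg2 F ([fset tpos i] `|` [fset tpos j])%fset [fset tpos q]%fset =
     (-1) ^+ count (fun q => (q < i)%N) s * (-1) ^+ count (fun q => (q < j)%N) s.
    rewrite -!sg2_prod // -big_split; apply: eq_bigr => q _ /=.
    apply: (@mulfI _ (sg2 F [fset tpos i]%fset [fset tpos j]%fset)).
      by rewrite sg2_1 // signr_eq0.
    exact: sg2Ul.
  rewrite pE sg2_1 // exprD !mulrA; congr (_ ^+ _ * _ * _ * _).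
  by rewrite /tpos; case: (ltngtP j i) ij => [ji|ij _|->]; rewrite ?eqxx //;
    case: (isb i) (isb j) => [] []; lia.
by rewrite cardfs2 pij.
Qed.

(** The letter [i0] is missing from the sign because its indices lie below all others, whatever its
    own rank. *)
Lemma kval_special b j s : uniq (j :: s) -> i0 \notin j :: s -> s != [::] ->
  kval (Some b) (map yg [:: i0, j & s]) = sg F (j :: s) *:
    gword (tE0 `|` [fset tpos j] `|` [fset tpos q | q in s])%fset
      (afold b (~~ spd) (special_brac (isb j)) (map isb s)).
Proof.
move=> un; rewrite !inE !negb_or => /andP[i0j i0s] s0.
have -> : kval (Some b) (map yg [:: i0, j & s]) =
    wfold b (brac (gword (tE i0) (tl i0)) (gword (tE j) (tl j))) (map yg s) by case: (s) s0.
have below q : sg2 F tE0 [fset tpos q]%fset = 1.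
  by apply: sg2_below => i /tE0P; rewrite /tpos; lia.
have pE0 q : tpos q \notin tE0 by apply/negP => /tE0P; rewrite /tpos; lia.
move: un; rewrite /= => /andP[js us].
rewrite (@tE_letter j) 1?eq_sym // {1}/tE eqxx brac_gword below scale1r cardfs1 andbT card_tE0.
rewrite tl_special fold_gword //; last first.
  move=> q qs; rewrite !inE negb_or pE0 /=.
  by apply: contraNneq js => /tpos_inj <-.
congr (_ *: gword _ (afold _ _ _ _)).
  congr (_ * _); rewrite -sg2_prod //; apply: eq_bigr => q _.
  apply: (@mulfI _ (sg2 F tE0 [fset tpos j]%fset)).
    by rewrite below oner_neq0.
  by rewrite sg2Ul !below !mul1r.
by rewrite fsetUC cardfsU1 pE0 /= card_tE0.
Qed.

Lemma tU n : {U : {fset nat} | forall i, (i \in U) = has (fun q => i \in tE q) (iota 0 n)}.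
Proof.
exists [fset i | i in flatten [seq enum_fset (tE q) | q <- iota 0 n]]%fset => i.
apply/imfsetP/hasP => [[k /flatten_mapP[q qn kq] ->]|[q qn iq]]; first by exists q.
by exists i => //; apply/flatten_mapP; exists q.
Qed.

End TestElements.

(** * Sums over keys read off the evaluations *)

Section Tests.
Variables (F : fieldType) (h2 : 2%:R != 0 :> F).
Let A := five F.
Variables (f : npoly F nat) (L : seq (F * word)).
Hypotheses (tf : testable f)
  (fL : forall B : naAlgType F, V B -> forall a : nat -> B, neval a f = fval a L).
Variables (n : nat) (phi : nat -> nat).
Hypothesis n3 : (2 < n)%N.
Local Notation LL := (lift_list L n phi).

Section OneTest.
Variables (isb : pred nat) (i0 : nat) (spd : bool) (psi : A -> F).
Hypotheses (psiD : forall x y, psi (x + y) = psi x + psi y)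
  (psiZ : forall k x, psi (k *: x) = k * psi x).
Let E := tE isb i0 spd.
Let l := tl F isb i0 spd.
Let U := sval (tU isb i0 spd n).
Let tc k h := top_coef E l U psi k h.

Lemma psi00 : psi 0 = 0. Proof. by rewrite -(scale0r (0 : A)) psiZ mul0r. Qed.

Lemma UE i : (i \in U) = has (fun q => i \in E q) (iota 0 n).
Proof. exact: (svalP (tU isb i0 spd n)). Qed.

Lemma top_plain i j s : perm_eq [:: i, j & s] (iota 0 n) -> i0 \notin [:: i, j & s] ->
  ([fset tpos isb i; tpos isb j] `|` [fset tpos isb q | q in s])%fset = U.
Proof.
move=> p; rewrite !inE !negb_or => /and3P[i0i i0j i0s].
apply/fsetP => k; rewrite UE -(perm_has _ p) /= /E /tE ![_ == i0]eq_sym (negbTE i0i) (negbTE i0j).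
rewrite !inE -orbA; congr (_ || (_ || _)).
apply/imfsetP/hasP => [[q qs ->]|[q qs]].
  exists q => //; rewrite ifN ?inE //; by apply: contraNneq i0s => <-.
rewrite ifN; last by apply: contraNneq i0s => <-.
by rewrite inE => /eqP ->; exists q.
Qed.

Lemma top_special j s : perm_eq [:: i0, j & s] (iota 0 n) ->
  (tE0 spd `|` [fset tpos isb j] `|` [fset tpos isb q | q in s])%fset = U.
Proof.
move=> p; have : uniq [:: i0, j & s] by rewrite (perm_uniq p) iota_uniq.
rewrite /= !inE !negb_or => /andP[/andP[i0j i0s] _].
apply/fsetP => k; rewrite UE -(perm_has _ p) /= /E /tE eqxx ![_ == i0]eq_sym (negbTE i0j).
rewrite !inE -orbA; congr (_ || (_ || _)).
apply/imfsetP/hasP => [[q qs ->]|[q qs]].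
  exists q => //; rewrite ifN ?inE //; by apply: contraNneq i0s => <-.
rewrite ifN; last by apply: contraNneq i0s => <-.
by rewrite inE => /eqP ->; exists q.
Qed.

Lemma tc_plain b i j s : perm_eq [:: i, j & s] (iota 0 n) -> i0 \notin [:: i, j & s] ->
  tc (Some b) [:: i, j & s] = sg F [:: i, j & s] *
    psi (afold b false (Cst (2%:R * (isb i && isb j)%:R)) (map isb s)).
Proof.
move=> p i0s; have s0 : s != [::].
  by apply: contraTneq n3 => s0; rewrite -(size_iota 0 n) -(perm_size p) s0.
rewrite /tc /top_coef kval_plain //; last by rewrite (perm_uniq p) iota_uniq.
by rewrite gfunZ psiZ (top_plain p i0s) /gword eqxx.
Qed.

Lemma tc_special b j s : perm_eq [:: i0, j & s] (iota 0 n) ->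
  tc (Some b) [:: i0, j & s] = (-1) ^+ i0 * sg F [:: i0, j & s] *
    psi (afold b (~~ spd) (special_brac F spd (isb j)) (map isb s)).
Proof.
move=> p; have s0 : s != [::].
  by apply: contraTneq n3 => s0; rewrite -(size_iota 0 n) -(perm_size p) s0.
have : uniq [:: i0, j & s] by rewrite (perm_uniq p) iota_uniq.
rewrite cons_uniq => /andP[i0s us].
rewrite /tc /top_coef kval_special // gfunZ psiZ (top_special p) /gword eqxx.
congr (_ * _).
have -> : sg F [:: i0, j & s] = (-1) ^+ count (fun y => (y < i0)%N) (j :: s) * sg F (j :: s) by [].
(* The word is multilinear, so all [i0] letters smaller than [i0] follow it. *)
have -> : count (fun y => (y < i0)%N) (j :: s) = i0.
  have i0n : (i0 < n)%N by have := perm_mem p i0; rewrite mem_head mem_iota => /esym.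
  have := permP p (fun y => (y < i0)%N); rewrite /= ltnn add0n => ->.
  have -> : n = (i0 + (n - i0))%N by lia.
  have e1 : count (fun y => (y < i0)%N) (iota 0 i0) = size (iota 0 i0).
    by apply/eqP; rewrite -all_count; apply/allP => y; rewrite mem_iota.
  have e2 : count (fun y => (y < i0)%N) (iota i0 (n - i0)) = 0%N.
    apply/eqP; rewrite -leqn0 leqNgt -has_count; apply/hasPn => y.
    by rewrite mem_iota -leqNgt => /andP[].
  by rewrite iotaD count_cat add0n e1 e2 size_iota addn0.
by rewrite mulrA -expr2 sqrr_sign mul1r.
Qed.

Lemma psiN x : psi (- x) = - psi x.
Proof. by rewrite -scaleN1r psiZ mulN1r. Qed.

Lemma tc_swap b i j s : tc (Some b) [:: i, j & s] = - tc (Some b) [:: j, i & s].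
Proof.
rewrite /tc /top_coef -psiN; congr psi.
case: s => [|q s] /=; first by rewrite oppr0.
by rewrite brac_sym wopN wfoldN.
Qed.

Lemma tc_zero b i j s : i != i0 -> j != i0 -> ~~ (isb i && isb j) ->
  tc (Some b) [:: i, j & s] = 0.
Proof.
move=> ii0 ji0 ij; rewrite /tc /top_coef.
case: s => [|q s]; first by rewrite psi00.
have -> : kval (Some b) (map (fun q => gword (E q) (l q)) [:: i, j, q & s]) = wfold b
  (brac (gword (E i) (l i)) (gword (E j) (l j))) (map (fun q => gword (E q) (l q)) (q :: s)) by [].
rewrite /E /l !tE_letter // brac_gword !cardfs1 /= expr1 scaleN1r opprK letter_sym (negbTE ij).
by rewrite mulr0 (_ : Cst 0 = 0) // gword0 scaler0 wop0 wfold0 psi00.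
Qed.

(** It suffices to treat words beginning with [i0]: the second place follows by skew symmetry of the
    bracket, and if [i0] is in neither place, the bracket vanishes because its letters are not both
    [b]. *)
Lemma special_tc b kappa (P : pred (seq nat)) :
  (forall i j, i != j -> ~~ (isb i && isb j)) ->
  (forall i j s, s != [::] -> P [:: i, j & s] = P [:: j, i & s]) ->
  (forall i j s, P [:: i, j & s] -> (i0 == i) || (i0 == j)) ->
  (forall j s, perm_eq [:: i0, j & s] (iota 0 n) ->
     psi (afold b (~~ spd) (special_brac F spd (isb j)) (map isb s)) =
       kappa * (P [:: i0, j & s])%:R /\
     psi (afold (~~ b) (~~ spd) (special_brac F spd (isb j)) (map isb s)) = 0) ->
  forall h, perm_eq h (iota 0 n) ->
     tc (Some b) h = ((-1) ^+ i0 * kappa) * (sg F h * (P h)%:R) /\ tc (Some (~~ b)) h = 0.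
Proof.
move=> isb1 Psym Pi0 val h hn.
have first j s : perm_eq [:: i0, j & s] (iota 0 n) ->
    tc (Some b) [:: i0, j & s] = ((-1) ^+ i0 * kappa) * (sg F [:: i0, j & s] * (P [:: i0, j & s])%:R) /\
    tc (Some (~~ b)) [:: i0, j & s] = 0.
  move=> p; have [e1 e2] := val j s p.
  rewrite !tc_special // e1 e2 mulr0; split=> //; ring.
case: h hn => [|i [|j s]] p; try by have := perm_size p; rewrite size_iota => e; move: n3; rewrite -e.
have uh : uniq [:: i, j & s] by rewrite (perm_uniq p) iota_uniq.
have ij : i != j by move: uh; rewrite /= inE negb_or => /andP[/andP[]].
have [ei|ii0] := eqVneq i i0; first by rewrite ei in p *; exact: first.
have [ej|ji0] := eqVneq j i0.
  rewrite ej in p ij *; rewrite !(tc_swap _ i).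
  have p' : perm_eq [:: i0, i & s] (iota 0 n) by exact: perm_eq_swap2.
  have [-> ->] := first _ _ p'; rewrite oppr0; split=> //.
  rewrite Psym; last by apply: contraTneq n3 => s0; rewrite -(size_iota 0 n) -(perm_size p) s0.
  have -> : sg F [:: i, i0 & s] = - sg F [:: i0, i & s] by exact: (sg_swap F [::]).
  by ring.
rewrite !tc_zero ?isb1 //; split=> //.
case Pij: (P _); last by rewrite !mulr0.
by have := Pi0 _ _ _ Pij; rewrite eq_sym (negbTE ii0) eq_sym (negbTE ji0).
Qed.

Lemma key_vanish_test b (P : pred (seq nat)) kappa : kappa != 0 ->
  (forall h, perm_eq h (iota 0 n) ->
     tc (Some b) h = kappa * (sg F h * (P h)%:R) /\ tc (Some (~~ b)) h = 0) ->
  \sum_(p <- LL (Some b) | P p.2) p.1 * sg F p.2 = 0.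
Proof.
move=> k0 tcE.
have st := star h2 tf fL phi (tE_disjoint isb i0 spd) (tE_neq0 isb i0 spd)
  (tE_gen F isb i0 spd) UE psiD psiZ.
have e0 : \sum_(p <- LL None) p.1 * tc None p.2 = 0.
  rewrite big1_seq // => p /andP[_ /lift_listP/perm_size]; rewrite size_iota.
  case: p.2 => [|i [|j [|q s]]] //=; try (by move=> e; move: n3; rewrite -e).
  by rewrite /tc /top_coef /= psi00 mulr0.
have e1 : \sum_(p <- LL (Some (~~ b))) p.1 * tc (Some (~~ b)) p.2 = 0.
  rewrite big1_seq // => p /andP[_ /lift_listP hp].
  by have [_ ->] := tcE _ hp; rewrite mulr0.
have e2 : \sum_(p <- LL (Some b)) p.1 * tc (Some b) p.2 = 0.
  move: st; rewrite e0 add0r => st; rewrite -[RHS]st; case: (b) e1 => /= e1.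
    by rewrite [X in _ = _ + X]e1 addr0.
  by rewrite [X in _ = X + _]e1 add0r.
apply: (mulfI k0); rewrite mulr0 -[RHS]e2 big_distrr /= big_mkcond.
rewrite big_seq [RHS]big_seq; apply: eq_bigr => p /lift_listP hp.
by have [-> _] := tcE _ hp; case: (P p.2); rewrite ?mulr1 ?mulr0 //; ring.
Qed.

End OneTest.

Lemma pair_split h : perm_eq h (iota 0 n) ->
  exists i j m u, [/\ h = [:: i, j & rcons m u], uniq h & (i < n)%N /\ (j < n)%N /\ (u < n)%N].
Proof.
move=> p; have := perm_size p; rewrite size_iota.
have lt q : q \in h -> (q < n)%N by rewrite (perm_mem p) mem_iota.
have : uniq h by rewrite (perm_uniq p) iota_uniq.
case: h p lt => [|i [|j s]] p lt uh /= sz; try by move: n3; rewrite -sz.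
case/lastP: s p lt uh sz => [|m u] p lt uh sz; first by move: n3; rewrite -sz.
exists i, j, m, u; split=> //.
by rewrite !lt // !inE ?mem_rcons ?inE eqxx ?orbT.
Qed.

(** The key letter goes to [c], all others to [a], and the coordinate of [c] is read. The bracket is
    [-d], and the operators then alternate between [c] and [d], ending at [c]. *)
Lemma test_V : odd n -> key_vanish (LL (Some false)) keyV.
Proof.
move=> on p k /lift_listP pn kp.
apply: (@key_vanish_test (fun=> false) k false (fun x => x.1.2) _ _ false (fun h => k \in keyV h)
  ((-1) ^+ k * -1)) => //; first by rewrite mulrN1 oppr_eq0 signr_eq0.
apply: special_tc => // [i j s _|i j s|j s hn].
- by rewrite /keyV !mem_undup !inE orbC.
- by rewrite /keyV !mem_undup !inE.
have sz := perm_size hn; rewrite size_iota /= in sz.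
case: s sz hn => [|q s] sz hn; first by move: n3; rewrite -sz.
rewrite /special_brac [map _ _]/= afold_RD afold_TD afold_C_even; last first.
  by move: on; rewrite -sz size_map /= negbK.
rewrite /keyV mem_undup !inE eqxx /=; split=> //.
rewrite (_ : all negb _) /=; first by ring.
by apply/allP => x /mapP[r _ ->].
Qed.

Lemma only_last (u0 j u : nat) m : uniq (j :: rcons m u) ->
  (~~ pred1 u0 j)%:R * (all negb (map (pred1 u0) m) && pred1 u0 u)%:R = (u == u0)%:R :> F.
Proof.
rewrite /= rcons_uniq mem_rcons inE negb_or => /andP[/andP[ju jm] /andP[um _]].
have [uu0|] := eqVneq u u0; last by rewrite andbF mulr0.
rewrite andbT -uu0 ju mul1r (_ : all _ _) //.
by apply/allP => x /mapP[r rm ->] /=; apply: contraNneq um => <-.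
Qed.

Lemma keyC_last i0 u0 i j m u : ((i0, u0) \in keyC [:: i, j & rcons m u]) =
  ((i0 == i) || (i0 == j)) && (u == u0).
Proof. by rewrite /keyC mem_undup !inE /= last_rcons !xpair_eqE -andb_orl [u0 == u]eq_sym. Qed.

Lemma key_C_facts h k : perm_eq h (iota 0 n) -> k \in keyC h -> k.1 != k.2.
Proof.
move=> hn kh; have [i [j [m [u [hE uh _]]]]] := pair_split hn.
move: kh; rewrite hE; case: k => a b; rewrite keyC_last /= => /andP[aij /eqP <-].
move: uh; rewrite hE /= !inE !mem_rcons !inE !negb_or => /and3P[/and3P[_ iu _] /andP[ju _] _].
by case/orP: aij => /eqP ->.
Qed.

(** [u0] goes to [b], and [k] goes to [d] or [c] according as the word begins with T or R; the other
    letters go to [a]. The coordinate of [e] is reached only through a final letter [b]. The factor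
    [kappa] is that of the brackets [2c] and [-d]. *)
Lemma test_C (b : bool) : b = odd n -> key_vanish (LL (Some b)) keyC.
Proof.
move=> bn p [k u0] /lift_listP pn kp; have ku := key_C_facts pn kp; rewrite /= in ku.
pose kappa : F := if b then 2%:R else -1.
apply: (@key_vanish_test (pred1 u0) k b (fun x => x.2.2) _ _ b (fun h => (k, u0) \in keyC h)
  ((-1) ^+ k * kappa)) => //.
  by rewrite mulf_neq0 ?signr_eq0 // /kappa; case: (b); rewrite ?oppr_eq0 ?oner_neq0.
apply: special_tc => // [i j ij|i j s s0|i j s|j s hn].
- by apply: contra ij => /= /andP[/eqP -> /eqP ->].
- by rewrite /keyC !mem_undup !inE orbC; case: s s0.
- by rewrite /keyC mem_undup !inE !xpair_eqE /= -andb_orl => /andP[].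
have [i [j' [m [u [hE uh _]]]]] := pair_split hn.
case: hE hn uh => _ _ -> {s i j'} hn uh; rewrite keyC_last eqxx /=.
have ujm : uniq (j :: rcons m u) by case/andP: uh.
have sz := perm_size hn; rewrite size_iota /= size_rcons in sz.
have om : odd (size m) = ~~ odd n by rewrite -sz /= negbK negbK.
rewrite map_rcons /special_brac {}/kappa; case: b bn => bn.
  rewrite afold_C_odd ?size_map ?om -?bn //; split; last by rewrite afold_RC // -size_eq0 size_rcons.
  rewrite -[LHS]/(2%:R * (~~ pred1 u0 j)%:R * (all negb (map (pred1 u0) m) && pred1 u0 u)%:R).
  by rewrite -mulrA only_last.
case: m ujm om sz {hn uh} => [|q m] ujm om sz; first by move: om; rewrite -bn.
rewrite [map _ _]/= rcons_cons afold_RD afold_TD afold_C_odd; last first.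
  by move: om; rewrite -bn /= size_map => ->.
split; last by [].
rewrite -[LHS]/(- (~~ pred1 u0 j)%:R * (~~ pred1 u0 q)%:R *
  (all negb (map (pred1 u0) m) && pred1 u0 u)%:R).
have := only_last u0 ujm; rewrite [map _ _]/= [all _ _]/= => <-.
by rewrite [pred1 u0 q]/= -!mulnb !natrM; ring.
Qed.

Lemma keyP_eq i j a b : i != j -> a != b ->
  ((minn a b, maxn a b) == (minn i j, maxn i j)) = ((a == i) || (a == j)) && ((b == i) || (b == j)).
Proof.
move=> ij ab; rewrite xpair_eqE /minn /maxn.
by case: (ltnP a b) => ?; case: (ltnP i j) => ?; apply/idP/idP; lia.
Qed.

(** The special letter is off, since [n] does not occur. The two key letters go to [b], the others
    to [a]; the value is nonzero only if the initial super bracket is that of [b] with itself, which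
    is [2c]. *)
Lemma test_P : ~~ odd n -> key_vanish (LL (Some true)) keyP.
Proof.
move=> on p k /lift_listP pn kp.
have [a [b [c [d [pE up [an [bn _]]]]]]] := pair_split pn.
have ab : a != b by move: up; rewrite pE /= inE negb_or => /andP[/andP[]].
move: kp; rewrite pE inE /= => /eqP kE {p pn pE up}.
apply: (@key_vanish_test [pred q | (q == a) || (q == b)] n false (fun x => x.1.2) _ _ true
  (fun h => k \in keyP h) 2%:R) => // h hn.
have [i [j [m [u [hE uh [i_n [jn un]]]]]]] := pair_split hn.
have nh : n \notin h by rewrite (perm_mem hn) mem_iota add0n ltnn.
have sz := perm_size hn; rewrite size_iota hE /= in sz.
rewrite hE in hn nh uh *; rewrite !tc_plain // afold_C_even ?size_map; last first.
  by move: on; rewrite -sz /= negbK.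
have ij : i != j by move: uh; rewrite /= inE negb_or => /andP[/andP[]].
split; last first.
  by rewrite afold_RC ?mulr0 // -size_eq0 size_map size_rcons.
have -> : (k \in keyP [:: i, j & rcons m u]) = ((minn a b, maxn a b) == (minn i j, maxn i j)).
  by rewrite kE /keyP inE.
rewrite keyP_eq //; set I := [pred q | _].
have qs q : q \in rcons m u -> (q != i) && (q != j).
  move: uh; rewrite /= inE negb_or => /and3P[/andP[_ i_s] js _] qm.
  by apply/andP; split; [apply: contraNneq i_s => <-|apply: contraNneq js => <-].
have -> : ((a == i) || (a == j)) && ((b == i) || (b == j)) =
    (I i && I j) && all negb (map I (rcons m u)).
  apply/idP/idP => [abij|/andP[] /=]; last by lia.
  apply/andP; split; first by rewrite /=; lia.
  apply/allP => x /mapP[q /qs qij ->] /=; lia.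
set P1 := I i && I j; set P2 := all _ _.
by rewrite -mulnb natrM -[LHS]/(_ * (2%:R * P1%:R * P2%:R)); ring.
Qed.

(** Three letters go to [b] and the coordinate of [e] is read: two of them must form the initial
    bracket, and the third must be last, because [e] survives no further operator. *)
Lemma test_T : odd n -> key_vanish (LL (Some true)) keyT.
Proof.
move=> on p k /lift_listP pn kp.
have [a [b [c [d [pE up _]]]]] := pair_split pn.
have uabd : uniq [:: a; b; d].
  move: up; rewrite pE /= !inE mem_rcons inE !negb_or mem_rcons inE negb_or.
  by move=> /and3P[/and3P[-> -> _] /andP[-> _] _].
move: kp; rewrite pE /keyT mem_seq1 [nth _ _ 0]/= [nth _ _ 1]/= [last _ _]/= last_rcons => /eqP kE.
move: kE => {p pn pE up} kE.
apply: (@key_vanish_test [pred q | q \in [:: a; b; d]] n false (fun x => x.2.2) _ _ true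
  (fun h => k \in keyT h) 2%:R) => // h hn.
have [i [j [m [u [hE uh [i_n [jn un]]]]]]] := pair_split hn.
have nh : n \notin h by rewrite (perm_mem hn) mem_iota add0n ltnn.
have sz := perm_size hn; rewrite size_iota hE /= size_rcons in sz.
rewrite hE in hn nh uh *; rewrite !tc_plain // map_rcons afold_C_odd ?size_map; last first.
  by move: on; rewrite -sz /= negbK.
split; last by rewrite afold_RC ?mulr0 // -size_eq0 size_rcons.
have uiju : uniq [:: i; j; u].
  move: uh; rewrite /= !inE mem_rcons inE !negb_or mem_rcons inE negb_or.
  by move=> /and3P[/and3P[-> -> _] /andP[-> _] _].
have -> : (k \in keyT [:: i, j & rcons m u]) = perm_eq [:: a; b; d] [:: i; j; u].
  rewrite kE /keyT mem_seq1 [nth _ _ 0]/= [nth _ _ 1]/= [last _ _]/= last_rcons.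
  by apply/eqP/idP => /perm_sortP; apply; [exact: leq_total|exact: leq_trans|exact: anti_leq|
    exact: leq_total|exact: leq_trans|exact: anti_leq].
set I := [pred q | _].
have -> : perm_eq [:: a; b; d] [:: i; j; u] = (I i && I j) && (all negb (map I m) && I u).
  apply/idP/idP => [pq|/andP[/andP[Ii Ij] /andP[_ Iu]]]; last first.
    rewrite perm_sym; apply: uniq_perm => //.
    have sub : {subset [:: i; j; u] <= [:: a; b; d]}.
      move=> x; have -> : (x \in [:: i; j; u]) = [|| x == i, x == j | x == u] by rewrite !inE.
      by case/or3P => /eqP ->.
    by have [] := uniq_min_size uiju sub (leqnn _).
  have mq x : (x \in [:: a; b; d]) = (x \in [:: i; j; u]) by exact: perm_mem.
  rewrite /I /= !mq !inE !eqxx !orbT /= andbT.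
  apply/allP => x /mapP[q qm ->]; rewrite /= -[X in ~~ X]/(q \in [:: a; b; d]) mq !inE !negb_or.
  move: uh; rewrite /= !inE mem_rcons inE !negb_or mem_rcons inE negb_or rcons_uniq.
  move=> /and3P[/and3P[_ _ im] /andP[_ jm] /andP[um _]].
  by apply/and3P; split; [apply: contraNneq im => <-|apply: contraNneq jm => <-
    |apply: contraNneq um => <-].
set P1 := I i && I j; set P2 := all _ _ && _.
by rewrite -mulnb natrM -[LHS]/(_ * (2%:R * P1%:R * P2%:R)); ring.
Qed.

End Tests.

(** * Identities that hold on the test elements *)

Section Main.
Variables (F : fieldType) (h2 : 2%:R != 0 :> F) (h3 : 3%:R != 0 :> F).
Let A := five F.

Section LowDegree.
Variables (f : npoly F nat) (L : seq (F * word)).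
Hypotheses (tf : testable f)
  (fL : forall B : naAlgType F, V B -> forall a : nat -> B, neval a f = fval a L).
Variable phi : nat -> nat.

Lemma star_None (i0 n : nat) (psi : A -> F) (psiD : forall x y, psi (x + y) = psi x + psi y)
    (psiZ : forall k x, psi (k *: x) = k * psi x) : (n < 3)%N ->
  \sum_(p <- lift_list L n phi None) p.1 *
    top_coef (tE (fun=> false) i0 false) (tl F (fun=> false) i0 false)
      (sval (tU (fun=> false) i0 false n)) psi None p.2 = 0.
Proof.
move=> n3; have UE := svalP (tU (fun=> false) i0 false n).
have psi0 : psi 0 = 0 by rewrite -(scale0r (0 : A)) psiZ mul0r.
have st := star h2 tf fL phi (tE_disjoint (fun=> false) i0 false) (tE_neq0 (fun=> false) i0 false)
  (tE_gen F (fun=> false) i0 false) UE psiD psiZ.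
have e0 b : \sum_(p <- lift_list L n phi (Some b)) p.1 *
    top_coef (tE (fun=> false) i0 false) (tl F (fun=> false) i0 false)
      (sval (tU (fun=> false) i0 false n)) psi (Some b) p.2 = 0.
  rewrite big1_seq // => p /andP[_ /lift_listP/perm_size]; rewrite size_iota.
  by case: p.2 => [|i [|j [|q s]]] /= e; rewrite /top_coef /= ?psi0 ?mulr0 //; move: n3; rewrite -e.
by rewrite -[RHS]st !e0 !addr0.
Qed.

Lemma lift_list1 : \sum_(p <- lift_list L 1 phi None) p.1 = 0.
Proof.
have := @star_None 1 1 (fun x => x.1.1.1) (fun _ _ => erefl) (fun _ _ => erefl) isT.
have UE := svalP (tU (fun=> false) 1 false 1); set U := sval _ in UE *.
rewrite big_seq => e; rewrite big_seq -[RHS]e; apply: eq_bigr => p /lift_listP hp.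
have -> : p.2 = [:: 0%N].
  have := perm_size hp; case: p.2 hp => [|i [|j s]] //= hp _.
  by have := perm_mem hp i; rewrite mem_head inE => /esym /eqP ->.
rewrite /top_coef /= /gword ifT ?mulr1 //; apply/eqP/fsetP => i.
by rewrite UE /= orbF.
Qed.

(** The letter [i] goes to [a] and [j] to [c]. Since [ac = d] and [ca = 0], the coordinate of [d]
    separates the two orders. *)
Lemma lift_list2 i j : perm_eq [:: i; j] (iota 0 2) ->
  \sum_(p <- lift_list L 2 phi None | p.2 == [:: i; j]) p.1 = 0.
Proof.
move=> ij; have uij : uniq [:: i; j] by rewrite (perm_uniq ij) iota_uniq.
have ji : i != j by move: uij; rewrite /= inE => /andP[].
have := @star_None j 2 (fun x => x.2.1) (fun _ _ => erefl) (fun _ _ => erefl) isT.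
have UE := svalP (tU (fun=> false) j false 2); set U := sval _ in UE *.
set E := tE _ _ _; set l := tl _ _ _ _.
have top : top_coef E l U (fun x => x.2.1) None [:: i; j] != 0.
  rewrite /top_coef /= gword_mulE gfunZ /gword ifT; last first.
    by apply/eqP/fsetP => k; rewrite UE -(perm_has _ ij) /= orbF inE.
  rewrite /l /tl (negbTE ji) eqxx /letter /ga mk5M /= mulr1 /sg2.
  by rewrite (tE_disjoint _ _ _ ji) [_ *: _]mulr1 signr_eq0.
have ht h : perm_eq h (iota 0 2) -> h = [:: i; j] \/ h = [:: j; i].
  move=> hp; have := perm_size hp; case: h hp => [|a [|b [|c s]]] //= hp _.
  have q : perm_eq [:: a; b] [:: i; j] by rewrite (permPl hp) perm_sym.
  have uab : uniq [:: a; b] by rewrite (perm_uniq hp).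
  have := perm_mem q a; have := perm_mem q b; rewrite !inE !eqxx ?orbT /=.
  move: uab; rewrite /= inE andbT => /negP ab /esym/orP[] /eqP bE /esym/orP[] /eqP aE.
  - by case: ab; rewrite aE bE.
  - by right; rewrite aE bE.
  - by left; rewrite aE bE.
  - by case: ab; rewrite aE bE.
move=> e; apply: (mulIf top); rewrite mul0r -[RHS]e big_distrl /= big_mkcond.
rewrite big_seq [RHS]big_seq; apply: eq_bigr => p /lift_listP /ht [] ->; first by rewrite eqxx.
rewrite eqseq_cons eq_sym (negbTE ji) /top_coef /= gword_mulE gfunZ /gword.
rewrite /l /tl eqxx (negbTE ji) /letter /ga mk5M.
by case: ifP => _ /=; rewrite ?mulr0 ?scaler0 /= ?mulr0 // mulr0.
Qed.

End LowDegree.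

(** The parity of [n] and the first operator select the shape of the words. Words of length [2k + 3]
    use the chain identity with index [k] only, so the maximal length of a word bounds the
    indices. *)
Theorem testable_identity (f : npoly F nat) : testable f -> exists N, forall B : naAlgType F,
  V B -> (forall k, (0 < k <= N)%N -> chainw B k) -> satisfies B f.
Proof.
move=> tf; have [L fL] := normal_form h2 f.
exists (\max_(p <- L) size p.2.2) => B VB cB a; rewrite fL //.
apply: (fval_polarized h2 h3 VB) => n phi k y nN.
have [n3|n3] := ltnP n 3.
  case: k => [b|].
    rewrite big1_seq // => p /andP[_ /lift_listP/perm_size]; rewrite size_iota.
    by case: p.2 => [|i [|j [|q s]]] /= e; rewrite ?scaler0 //; move: n3; rewrite -e.
  case: n nN n3 => [|[|[|n]]] // nN _.
  - rewrite big1_seq // => p /andP[_ /lift_listP/perm_size].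
    by case: p.2 => // _; rewrite scaler0.
  - transitivity (\sum_(p <- lift_list L 1 phi None) p.1 *: y 0%N).
      rewrite big_seq [RHS]big_seq; apply: eq_bigr => p /lift_listP hp.
      have := perm_size hp; case: p.2 hp => [|i [|j s]] //= hp _.
      by have := perm_mem hp i; rewrite mem_head inE => /esym /eqP ->.
    by rewrite -scaler_suml (lift_list1 tf fL phi) scale0r.
  rewrite big_seq; apply: etrans (_ : \sum_(p <- lift_list L 2 phi None)
      p.1 *: (\sum_(k <- [:: p.2]) kval None (map y k)) = 0).
    by rewrite big_seq; apply: eq_bigr => p _; rewrite big_seq1.
  apply: (@sum_by_keys _ _ _ _ _ (fun p => p.1) (fun p => [:: p.2]) (fun k => kval None (map y k))) => //.
  move=> p k /lift_listP hp; rewrite inE => /eqP ->.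
  have := perm_size hp; case e : p.2 hp => [|i [|j [|? ?]]] //= hp _.
  rewrite -[RHS](lift_list2 tf fL phi hp); apply: eq_bigl => q.
  by rewrite inE eq_sym.
case: k => [b|]; last first.
  rewrite big1_seq // => p /andP[_ /lift_listP/perm_size]; rewrite size_iota.
  case: p.2 => [|i [|j [|q s]]] /= e; rewrite ?scaler0 //; by move: n3; rewrite -e.
have rP k p : p \in lift_list L n phi k -> perm_eq p.2 (iota 0 n) by exact: lift_listP.
case: b; case on : (odd n).
(* For [n = 3] the index of the chain identity would be 0; this length is settled without chain
   identities. *)
- have [n5|n5] := ltnP n 5.
    apply: (multilinear_TT0 h2 VB n3 (@rP _)); last exact: (test_C h2 tf fL n3 (esym on)).
    by case: n n3 n5 on {nN rP} => [|[|[|[|[|n]]]]].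
  have nk : n = ((n - 3)./2.*2 + 3)%N.
    by rewrite halfK oddB ?on //=; lia.
  apply: (multilinear_TT h2 VB n3 (@rP _) y nk).
  + by lia.
  + by apply: cB; apply/andP; split; lia.
  + exact: (test_C h2 tf fL n3 (esym on)).
  + exact: (test_T h2 tf fL n3 on).
- apply: (multilinear_TR h2 VB n3 (@rP _)); first by rewrite on.
  by apply: (test_P h2 tf fL n3); rewrite on.
- by apply: (multilinear_RR h2 VB n3 (@rP _)) => //; exact: (test_V h2 tf fL n3 on).
apply: (multilinear_RT h2 VB n3 (@rP _)); first by rewrite on.
exact: (test_C h2 tf fL n3 (esym on)).
Qed.

End Main.

(** * Non-finite basis *)

Section ChainWordBase.
Variables (F : fieldType) (h2 : 2%:R != 0 :> F) (B : naAlgType F) (VB : V B).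
Variables (W : B -> Prop) (SW : squarelike W).

(** In the second place for [y], an element of W acts by zero on the bracket. In the first place,
    [[x, y1]] is [T_x y1 - 2 R_x y1]: the next T kills the first term, and the second becomes a word
    in which [x] is repeated. *)
Lemma chain_word_W2 x y y1 Z : ~~ odd (size Z) -> W y1 ->
  chain_word x (y + y1) Z = chain_word x y Z.
Proof.
move=> oZ Wy1; rewrite /chain_word; set s := Z ++ [:: x; x].
have s0 : s != [::] by rewrite /s; case: (Z).
have -> : kval (Some true) [:: x, y + y1, y + y1 & s] =
    kval (Some true) [:: x, y, y + y1 & s] + kval (Some true) [:: x, y1, y + y1 & s].
  exact: (kvalD _ [:: x]).
have -> : kval (Some true) [:: x, y, y + y1 & s] =
    kval (Some true) [:: x, y, y & s] + kval (Some true) [:: x, y, y1 & s].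
  exact: (kvalD _ [:: x; y]).
have -> : kval (Some true) [:: x, y, y1 & s] = 0.
  by rewrite /= [Top _ _](wop_W0 SW true Wy1 (W_brac SW _ _)) wfold0.
rewrite addr0 [X in _ + X](_ : _ = 0) ?addr0 //.
set t := y + y1; have -> : kval (Some true) [:: x, y1, t & s] = wfold true (brac x y1) (t :: s) by [].
have -> : brac x y1 = Top x y1 - 2%:R *: (y1 ** x) by rewrite /brac /Top; lmod F.
rewrite addrC -scaleNr wfold_lin.
have -> : wfold true (y1 ** x) (t :: s) = wfold false y1 ([::] ++ x :: (t :: Z) ++ x :: [:: x]) by [].
rewrite (wfold_dup h2 VB SW) // scaler0 add0r.
by rewrite -[wfold _ _ _]/(wfold false (Top t (Top x y1)) s) (opTT VB) wfold0.
Qed.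

End ChainWordBase.

Section FamilyProducts.
Variables (F : fieldType) (p : famdata F).
Implicit Types a b : fam p.

Lemma fmul_OO a b : a.2 = 0 -> b.1.2 = 0 -> b.2 = 0 ->
  fmul a b = (0, (beta a.1.1 * beta b.1.1) *: c0 p, 0).
Proof. by move=> ad bc bd; rewrite /fmul ad bc bd; fam F. Qed.

Lemma fmul_Dx a b : a.1.1 = 0 -> fmul a b = (0, rho b.1.1 *: rr a.2, 0).
Proof. by move=> ao; rewrite /fmul ao; fam F. Qed.

Lemma fmul_xC a b : b.1.1 = 0 -> b.2 = 0 -> fmul a b = (0, 0, theta a.1.1 b.1.2).
Proof. by move=> bo bd; rewrite /fmul bo bd; fam F. Qed.

Lemma fmul_Cx a b : a.1.1 = 0 -> a.2 = 0 -> fmul a b = 0.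
Proof. by move=> ao ad; rewrite /fmul ao ad; fam F. Qed.

End FamilyProducts.

(** * The chain identity with index n does not follow from those before it *)

Section ChainWitness.
Variables (F : fieldType) (h2 : 2%:R != 0 :> F) (n : nat).

Let seqD (c d : nat -> F^o) i : (c + d) i = c i + d i. Proof. by []. Qed.
Let seqZ k (c : nat -> F^o) i : (k *: c) i = k * c i. Proof. by []. Qed.

Definition shift (c : nat -> F^o) : nat -> F^o := fun i => if i is j.+1 then c j else 0.
(** T with the generator [a] acts in degrees below [n] only, which leaves degree [n] to the third
    generator. *)
Definition below (c : nat -> F^o) : nat -> F^o := fun i => if (i < n)%N then c i else 0.

(* Odd generators a, b, g with coordinates o.1.1, o.1.2, o.2.  The algebra remembers in the
   degree of [famC] how often rho was used, and g acts only in degree n. *)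
Definition chain_data : famdata F.
refine (@FamData F (F^o * F^o * F^o)%type (nat -> F^o) ((nat -> F^o) * F^o)%type
  (fun o => o.1.2) (fun o => o.1.1) (fun i => (i == 0%N)%:R)
  (fun o c => (o.1.1 *: below c, o.2 * c n)) (fun d => shift d.1) (fun c => shift (below c))
  _ _ _ _ _ _ _).
- by [].
- by [].
- move=> k x y c; rewrite -[RHS]/(_, _); congr (_, _).
    by apply/funext => i; rewrite /= !(seqD, seqZ) mulrDl mulrA.
  by rewrite /= mulrDl -scalerAl.
- move=> k x c d; rewrite -[RHS]/(_, _); congr (_, _).
    apply/funext => i; rewrite /= !(seqD, seqZ) /below !(seqD, seqZ).
    by case: ifP => _; ring.
  by rewrite /= mulrDr -scalerAr.
- by move=> k x y; apply/funext => -[|i]; rewrite !(seqD, seqZ) //= mulr0 addr0.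
- by move=> x c; apply/funext => -[|i]; rewrite !seqZ //= mulr0.
- move=> k x y; apply/funext => -[|i]; rewrite !(seqD, seqZ) /= ?mulr0 ?addr0 //.
  by rewrite /below; case: ifP => _; rewrite ?mulr0 ?addr0.
Defined.

Definition chain_alg : superAlgType F := fam chain_data.
Local Notation A := chain_alg.
Local Notation G := (grass_env A).

Definition every (P : fam chain_data -> Prop) (u : G) := forall S, P ((val u : gfun A) S).
Definition lin_closed (P : fam chain_data -> Prop) :=
  P 0 /\ forall k a b, P a -> P b -> P (k *: a + b).

Lemma every_lin P k u v : lin_closed P -> every P u -> every P v -> every P (k *: u + v).
Proof. by move=> [_ PL] Pu Pv S; rewrite GRing.valD GRing.valZ; apply: PL. Qed.

Lemma everyM (P Q R : fam chain_data -> Prop) u v : lin_closed R ->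
  (forall a b, P a -> Q b -> R (fmul a b)) -> every P u -> every Q v -> every R (u ** v).
Proof.
move=> [R0 RL] RM Pu Qv S; rewrite -[val (u ** v)]/(gfun_mul (val u) (val v)) /gfun_mul.
by elim/big_rec: _ => [|T w _ Rw]; [exact: R0|apply: (RL); [exact: RM|exact: Rw]].
Qed.

Definition inO (a : fam chain_data) := a.1.2 = 0 /\ a.2 = 0.
Definition inC j (a : fam chain_data) :=
  [/\ a.1.1 = 0, a.2 = 0 & forall i, (j < i)%N -> a.1.2 i = 0].
Definition inD j (a : fam chain_data) :=
  [/\ a.1.1 = 0, a.1.2 = 0 & forall i, (j < i)%N -> a.2.1 i = 0].

Lemma inC_lin j : lin_closed (inC j).
Proof.
split=> // k a b [ao ad aj] [bo bd bj].
split; rewrite /= ?ao ?bo ?ad ?bd ?scaler0 ?addr0 // => i ji.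
by rewrite !(seqD, seqZ) aj // bj // mulr0 addr0.
Qed.

Lemma inD_lin j : lin_closed (inD j).
Proof.
split=> // k a b [ao ad aj] [bo bd bj].
split; rewrite /= ?ao ?bo ?ad ?bd ?scaler0 ?addr0 // => i ji.
by rewrite !(seqD, seqZ) aj // bj // mulr0 addr0.
Qed.

Lemma every_eq0 u : every (eq 0) u -> u = 0.
Proof. by move=> u0; apply: val_inj; apply/funext => S; rewrite -u0. Qed.

Lemma eq0_lin : lin_closed (eq 0).
Proof. by split=> // k a b <- <-; rewrite scaler0 addr0. Qed.

Lemma every_brac x y : every inO x -> every inO y -> every (inC 0) (brac x y).
Proof.
have M a b : inO a -> inO b -> inC 0 (fmul a b).
  move=> [ac ad] [bc bd].
  by rewrite fmul_OO //; split=> // -[] // i _; exact: mulr0.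
move=> xo yo; rewrite /brac -scaleN1r addrC; apply: every_lin; first exact: inC_lin.
  exact: everyM (inC_lin 0) M yo xo.
exact: everyM (inC_lin 0) M xo yo.
Qed.

Lemma every_C0 j w z : every (inC j) w -> w ** z = 0.
Proof.
move=> Cw; apply: every_eq0; apply: (everyM (Q := fun=> True) eq0_lin _ Cw) => // a b [ao ad _] _.
by rewrite fmul_Cx.
Qed.

Lemma every_T j w z : every (inC j) w -> every (inD j) (Top z w).
Proof.
move=> Cw; rewrite /Top (every_C0 z Cw) add0r.
apply: (everyM (P := fun=> True) (inD_lin j) _ _ Cw) => // a b _ [bo bd bj].
by rewrite fmul_xC //; split=> // i ji; rewrite /= seqZ /below bj //; case: ifP; rewrite mulr0.
Qed.

Lemma every_R j w z : every (inD j) w -> every (inC j.+1) (w ** z).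
Proof.
move=> Dw; apply: (everyM (Q := fun=> True) (inC_lin j.+1) _ Dw) => // a b [ao ac aj] _.
rewrite fmul_Dx //; split=> // -[] // i ji; have e : shift a.2.1 i.+1 = 0 by exact: aj.
by rewrite -[RHS](mulr0 (rho b.1.1)) -e.
Qed.

Lemma every_wfold j w Z : ~~ odd (size Z) -> every (inD j) w ->
  every (inD (j + (size Z)./2)) (wfold false w Z).
Proof.
have [m] := ubnP (size Z); elim: m => // m IH in Z j w *.
case: Z => [|z [|t Z]] //= sZ; first by rewrite addn0.
rewrite negbK => oZ Dw; rewrite addnS -addSn; apply: IH => //; first exact: ltnW.
by apply: every_T; exact: every_R.
Qed.

(** The product [w x] has degree at most [j + 1 < n], where the third generator acts by zero and
    [below] changes nothing. So [x (w x)] depends symmetrically on the [a]-coordinates of its two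
    factors [x], whose odd Grassmann coefficients anticommute. *)
Lemma every_RT0 j w x : (j.+1 < n)%N -> every (inD j) w -> Top x (w ** x) = 0.
Proof.
move=> jn Dw; rewrite /Top (every_C0 x (every_R x Dw)) add0r.
apply: (half2 h2); apply: val_inj; rewrite GRing.valD -[val _]/(val x ** (val w ** val x)).
suff : forall f g, grass_pred f -> grass_pred g ->
    f ** ((val w : gfun A) ** g) + g ** ((val w : gfun A) ** f) = 0.
  by move=> e; apply: e; exact: grassP.
have [wfin wh] := grassP w; move: wfin wh Dw; rewrite /every; move: (val w : gfun A).
move=> {}w wfin wh Dw f g Gf Gg.
move: f Gf; apply: grass_ind => [|f1 f2|S a ha]; rewrite ?(namulE _).
- by lmod F.
- by move=> e1 e2; lc 1 e1; lc 1 e2; lmod F.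
move: g Gg; apply: grass_ind => [|f1 f2|T b hb]; rewrite ?(namulE _).
- by lmod F.
- by move=> e1 e2; lc 1 e1; lc 1 e2; lmod F.
pattern w; apply: (finsupp_gfun_ind wfin) => [|f1 f2|U]; rewrite ?(namulE _).
- by lmod F.
- by move=> e1 e2; lc 1 e1; lc 1 e2; lmod F.
have [wo wc wj] := Dw U; have := wh U; set d := w U in wo wc wj * => hd.
rewrite !gword_mul3r.
have sgE : sg3 F T U S = sg2 F T U * sg2 F T S * sg2 F U S by rewrite /sg3 mulrA.
rewrite sgE sg2_reverse (_ : (T `|` U `|` S = S `|` U `|` T)%fset); last first.
  by rewrite -fsetUA fsetUC [(U `|` S)%fset]fsetUC.
pose v : fam chain_data := (0, 0, ((a.1.1.1.1 * b.1.1.1.1) *: shift d.2.1, 0)).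
have prod (a' b' : fam chain_data) : fmul a' (fmul d b') =
    (0, 0, ((a'.1.1.1.1 * b'.1.1.1.1) *: shift d.2.1, 0)).
  rewrite (fmul_Dx (a := d)) // fmul_xC //; congr (_, _, (_, _)).
    apply/funext => i; rewrite /= !seqZ /below; case: ltnP => ni; rewrite /= ?seqZ ?mulrA //.
    by case: i ni => [|i] ni; rewrite /= ?wj ?mulr0 //; lia.
  case: (n) jn => [|m] jm; rewrite /= !seqZ /=.
    by rewrite !mulr0.
  by rewrite wj ?mulr0.
have -> : (a : A) ** ((d : A) ** (b : A)) = v by rewrite -[LHS]/(fmul a (fmul d b)) prod.
have -> : (b : A) ** ((d : A) ** (a : A)) = v by rewrite -[LHS]/(fmul b (fmul d a)) prod mulrC.
rewrite -scalerDl; have [oS|eS] := boolP (odd #|` S|); last first.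
  rewrite /v; move: ha; rewrite (negbTE eS) => -[-> _].
  by rewrite mul0r scale0r gword0 scaler0.
have [oT|eT] := boolP (odd #|` T|); last first.
  rewrite /v; move: hb; rewrite (negbTE eT) => -[-> _].
  by rewrite mulr0 scale0r gword0 scaler0.
have [oU|eU] := boolP (odd #|` U|); last first.
  rewrite /v; move: hd; rewrite (negbTE eU) => -[_ ->].
  rewrite (_ : shift _ = 0) ?scaler0 ?gword0 ?scaler0 //.
  by apply/funext => -[].
by rewrite expr1 mulN1r subrr scale0r.
Qed.

Lemma every_decomposition (u : G) : exists u0 u1 : G,
  [/\ every inO u0, env_square u1 & u = u0 + u1].
Proof.
have [[s us] hu] := grassP u.
pose f : gfun A := fun S => (((val u : gfun A) S : fam chain_data).1.1, 0, 0) : fam chain_data.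
have Gf : grass_pred f.
  split=> [|S]; last by have := hu S; rewrite /f; case: (odd _) => // -[uo _].
  by exists s => S nz; apply: us => u0; apply: nz; rewrite /f u0.
pose u0 : G := SubalgElt (asboolT Gf : subalg_mem (grass_subalg A) _).
exists u0, (u - u0); split=> //; last by rewrite addrC subrK.
by move=> S; rewrite -scaleN1r GRing.valD GRing.valZ /= scaleN1r subrr.
Qed.

(** Once [x] and [y] are reduced to values in O, the word up to [Z] lies in D in degree at most
    [k - 1], and [every_RT0] applies because [k < n]. *)
Lemma chain_alg_chainw k : (0 < k < n)%N -> chainw G k.
Proof.
move=> /andP[k0 kn] x y Z sZ; have VG := @env_V F h2 chain_data.
have SG := @env_squarelike F h2 chain_data.
have [x0 [x1 [xo Wx ->]]] := every_decomposition x.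
have [y0 [y1 [yo Wy ->]]] := every_decomposition y.
have oZ : ~~ odd (size Z) by rewrite sZ odd_double.
rewrite -/(chain_word _ _ _) (chain_word_W h2 VG SG) // (chain_word_W2 h2 VG SG) //.
rewrite /chain_word -[kval _ _]/(wfold false (Top y0 (brac x0 y0)) (Z ++ [:: x0; x0])).
rewrite wfold_cat (negbTE oZ) -[wfold _ _ _]/(Top x0 (wfold false (Top y0 (brac x0 y0)) Z ** x0)).
apply: (@every_RT0 (size Z)./2); last first.
  by rewrite -[(size Z)./2]add0n; apply: every_wfold => //; apply: every_T; exact: every_brac.
by rewrite sZ half_double; case: k k0 kn {sZ}.
Qed.

Local Notation O := (F^o * F^o * F^o)%type.
Definition go i (o : O) : gfun A := gword [fset i]%fset ((o, 0, 0) : fam chain_data).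
Definition gC S (c : nat -> F^o) : gfun A := gword S ((0, c, 0) : fam chain_data).
Definition gD S (d : nat -> F^o) (h : F^o) : gfun A := gword S ((0, 0, (d, h)) : fam chain_data).
Definition delta j : nat -> F^o := fun i => (i == j)%:R.

Lemma go_go i j (o o' : O) : go i o ** go j o' =
  (sg2 F [fset i]%fset [fset j]%fset * (o.1.2 * o'.1.2)) *: gC [fset i; j]%fset (delta 0).
Proof.
rewrite /go /gC gword_mulE -scalerA -!gwordZ; congr (gword _ (_ *: _)).
by rewrite -[LHS]/(fmul _ _) fmul_OO //; apply: fam_eq; rewrite /= ?scaler0.
Qed.

Lemma gD_go S d h i o : gD S d h ** go i o =
  (sg2 F S [fset i]%fset * o.1.1) *: gC (S `|` [fset i])%fset (shift d).
Proof.
rewrite /go /gC /gD gword_mulE -scalerA -!gwordZ; congr (gword _ (_ *: _)).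
by rewrite -[LHS]/(fmul _ _) fmul_Dx //; apply: fam_eq; rewrite /= ?scaler0.
Qed.

Lemma Top_gC S c i (o : O) : Top (go i o) (gC S c) =
  sg2 F [fset i]%fset S *: gD ([fset i] `|` S)%fset (o.1.1 *: below c) (o.2 * c n).
Proof.
rewrite /Top !gword_mulE -[X in _ *: gword _ X + _]/(fmul _ _) -[X in _ + _ *: gword _ X]/(fmul _ _).
by rewrite fmul_Cx // fmul_xC // gword0 scaler0 add0r.
Qed.

Lemma below_delta j : below (delta j) = if (j < n)%N then delta j else 0.
Proof.
apply/funext => i; rewrite /below /delta; case: ifP => ni; case: ifP => nj //.
  by case: eqP => // e; rewrite e nj in ni.
by case: eqP => // e; rewrite e nj in ni.
Qed.

Lemma shift_delta j : shift (delta j) = delta j.+1.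
Proof. by apply/funext => -[]. Qed.

Lemma sg2_neq0 S i : i \notin S -> (sg2 F S [fset i]%fset != 0) && (sg2 F [fset i]%fset S != 0).
Proof.
by move=> iS; rewrite /sg2 fdisjointX1 fdisjoint1X iS !signr_eq0.
Qed.

Definition oa : O := (1, 0, 0).
Definition ob : O := (0, 1, 0).
Definition og : O := (0, 0, 1).

(** Indices from [m] on are free for the letters still to come; 0 and 2 are kept for the components
    of [x] along the first and third generators, used by the last two operators. *)
Definition pending (m j : nat) (w : gfun A) := exists k S, [/\ k != 0,
  w = k *: gD S (delta j) 0 & forall i, i \in S -> [&& (0 < i)%N, (i < m)%N & i != 2%N]].

Lemma pending_step m j w : (2 < m)%N -> (j.+1 < n)%N -> pending m j w ->
  pending m.+2 j.+1 (Top (go m.+1 oa) (w ** go m oa)).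
Proof.
move=> m2 jn [k [S [k0 -> SP]]].
have mS i : (m <= i)%N -> i \notin S.
  by move=> mi; apply/negP => /SP /and3P[_]; rewrite ltnNge mi.
have m1 : m.+1 \notin (S `|` [fset m])%fset by rewrite !inE negb_or mS //= eqn_leq ltnn.
have /andP[s1 _] := sg2_neq0 (mS m (leqnn m)); have /andP[_ s2] := sg2_neq0 m1.
exists (k * sg2 F S [fset m]%fset * sg2 F [fset m.+1]%fset (S `|` [fset m])%fset).
exists ([fset m.+1] `|` (S `|` [fset m]))%fset; split; first by rewrite !mulf_neq0.
  rewrite namulZl gD_go mulr1 shift_delta !TopZ Top_gC below_delta jn scale1r mul0r.
  by rewrite !scalerA.
move=> i; rewrite !inE => /or3P[/eqP ->|/SP /and3P[-> im ->]|/eqP ->]; last 1 first.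
- by apply/and3P; split; [|exact: leqW|]; move: m2; case: (m) => [|[|[|]]].
- by apply/and3P; split=> //; move: m2; case: (m) => [|[]].
by rewrite andbT /= (leq_trans im) // leqW.
Qed.

Lemma go_pred i o : grass_pred (go i o).
Proof. by apply: grass_pred_gword; rewrite cardfs1. Qed.
Definition gel i o : G := SubalgElt (asboolT (go_pred i o) : subalg_mem (grass_subalg A) _).

Fixpoint witness_tail m k : seq G :=
  if k is k'.+1 then [:: gel m oa, gel m.+1 oa & witness_tail m.+2 k'] else [::].

Lemma pending_fold k m j w : (2 < m)%N -> (j + k < n)%N -> pending m j w ->
  exists m', pending m' (j + k) (wfold false w (map val (witness_tail m k))).
Proof.
elim: k m j w => [|k IH] m j w m2 jk pw; first by exists m; rewrite addn0.
rewrite addnS -addSn; apply: IH; [exact: leqW (leqW m2)|by rewrite addSnnS|].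
by apply: pending_step => //; apply: leq_ltn_trans jk; rewrite addnS ltnS leq_addr.
Qed.

Lemma size_witness_tail m k : size (witness_tail m k) = k.*2.
Proof. by elim: k m => //= k IH m; rewrite IH. Qed.

(** Here [x = e_0 a + e_1 b + e_2 g] and [y = e_3 a + e_4 b]. The parts with [b] form the bracket
    and [y] acts by T through [a]; the tail raises the degree to [n - 1], and R with the [a] of [x]
    to [n], where only its [g] can act by T. No other choice of components contributes. *)
Lemma chain_alg_not_chainw : (0 < n)%N -> ~ chainw G n.
Proof.
move=> n0 cw; pose x := gel 0 oa + gel 1 ob + gel 2 og; pose y := gel 3 oa + gel 4 ob.
have := cw x y _ (size_witness_tail 5 n.-1) => /(congr1 val).
rewrite (kval_hom _ _ (hom_val _)) [RHS]/= map_cons map_cons map_cons map_cat.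
set Z := map val _.
have xE : val x = go 0 oa + go 1 ob + go 2 og by rewrite !GRing.valD.
have yE : val y = go 3 oa + go 4 ob by rewrite !GRing.valD.
rewrite [map _ [:: x; x]]/= xE yE; set X := _ + go 2 og; set Y := go 3 _ + _.
rewrite -[kval _ _]/(wfold false (Top Y (brac X Y)) (Z ++ [:: X; X])).
rewrite wfold_cat size_map size_witness_tail odd_double -[wfold (addb _ _) _ _]/(Top X (_ ** X)).
have bE : brac X Y = 2%:R *: gC [fset 1%N; 4%N]%fset (delta 0).
  rewrite /brac /X /Y !(namulE _) !go_go /= !(mul0r, mulr0, mulr1, scale0r, addr0, add0r).
  rewrite !sg2_1 //= [[fset 4%N; 1%N]%fset]fsetUC expr0 expr1.
  by rewrite scaleN1r scale1r opprK scaler_nat mulr2n.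
have start : pending 5 0 (Top Y (brac X Y)).
  rewrite bE TopZ TopDl !Top_gC below_delta n0 /= !mul0r scale1r scale0r.
  exists (2%:R * sg2 F [fset 3%N]%fset [fset 1%N; 4%N]%fset), ([fset 3%N] `|` [fset 1%N; 4%N])%fset.
  split.
  - have n3 : 3%N \notin [fset 1%N; 4%N]%fset by rewrite !inE.
    by have /andP[_ s3] := sg2_neq0 n3; rewrite mulf_neq0.
  - by rewrite /gD gword0 scaler0 addr0 scalerA.
  by move=> i; rewrite !inE => /or3P[] /eqP ->.
have [|m [k [S [k0 -> SP]]]] := @pending_fold n.-1 5 0 _ isT _ start.
  by rewrite add0n prednK.
have S0 : 0%N \notin S by apply/negP => /SP.
have S2 : 2%N \notin (S `|` [fset 0%N])%fset.
  by rewrite !inE negb_or andbT; apply/negP => /SP /and3P[].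
have /andP[s1 _] := sg2_neq0 S0; have /andP[_ s2] := sg2_neq0 S2.
rewrite /X namulZl !namulDr !gD_go !mulr1 !mulr0 !scale0r !addr0 shift_delta add0n prednK //.
rewrite !TopZ !TopDl !Top_gC below_delta ltnn /= /delta eqxx.
have gD00 U : gD U (0 : nat -> F^o) (0 : F) = 0 by rewrite /gD gword0.
rewrite !scaler0 !mul0r mulr1 !gD00 !scaler0 !add0r.
move/(congr1 (fun f : gfun A => f ([fset 2%N] `|` (S `|` [fset 0%N]))%fset)).
rewrite !gfunZ /gD /gword eqxx => /(congr1 (fun a : fam chain_data => a.2.2)) /eqP.
by rewrite /= /GRing.scale /= mulr1 !mulf_eq0 (negbTE k0) (negbTE s1) (negbTE s2).
Qed.

End ChainWitness.

(** * Chain identities in the envelope of the five-dimensional superalgebra *)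

Section FiveChain.
Variables (F : fieldType) (h2 : 2%:R != 0 :> F).
Local Notation A := (five F).
Local Notation G := (grass_env A).

Lemma odd_mul_pred l (a : A) : all (fun q : F * {fset nat} => odd #|` q.2|) l ->
  homog true a -> grass_pred (odd_mul l fset0 a).
Proof.
move=> lo ha; rewrite odd_mul_empty; elim: l lo => [|q l IH]; first by rewrite big_nil => _; exact: grass_pred0.
move=> /= /andP[qo /IH lo]; rewrite big_cons; apply: grass_predL => //.
by apply: grass_pred_gword; rewrite qo.
Qed.

Lemma five_oddD (f g : gfun A) l1 m1 l2 m2 (a b : A) S :
  (f S - odd_mul l1 fset0 a S - odd_mul l2 fset0 b S : fam (five_data F)).1.1 = 0 ->
  (g S - odd_mul m1 fset0 a S - odd_mul m2 fset0 b S : fam (five_data F)).1.1 = 0 ->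
  ((f + g) S - odd_mul (l1 ++ m1) fset0 a S - odd_mul (l2 ++ m2) fset0 b S :
    fam (five_data F)).1.1 = 0.
Proof.
have cat l m (c : A) : odd_mul (l ++ m) fset0 c = odd_mul l fset0 c + odd_mul m fset0 c.
  exact: big_cat.
rewrite (cat l1 m1) (cat l2 m2).
move: (odd_mul l1 _ a) (odd_mul m1 _ a) (odd_mul l2 _ b) (odd_mul m2 _ b) => u u' v v' e e'.
have add (c d w : fam (five_data F)) : c.1.1 = 0 -> d.1.1 = 0 -> w = c + d -> w.1.1 = 0.
  by move=> c0 d0 ->; rewrite /= c0 d0 addr0.
by apply: add e e' _; rewrite (gfunD f g) (gfunD u u') (gfunD v v'); lmod F.
Qed.

(** Modulo values in C + D an element is [g1 a + g2 b] with odd [g1], [g2], since coefficients at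
    even index sets have no component in O. *)
Lemma five_odd_decomposition (f : gfun A) : grass_pred f -> exists l1 l2,
  [/\ all (fun q => odd #|` q.2|) l1, all (fun q => odd #|` q.2|) l2
    & forall S, (f S - odd_mul l1 fset0 (ga F) S - odd_mul l2 fset0 (gb F) S : fam (five_data F)).1.1 = 0].
Proof.
move: f; apply: grass_ind => [|f g|S a ha].
- by exists [::], [::]; split=> // S; rewrite /odd_mul !big_nil !subr0.
- move=> [l1 [l2 [o1 o2 e]]] [m1 [m2 [p1 p2 e']]].
  exists (l1 ++ m1), (l2 ++ m2); split; [by rewrite all_cat o1|by rewrite all_cat o2|move=> S].
  exact: five_oddD (e S) (e' S).
exists [seq q <- [:: ((a : fam (five_data F)).1.1.1, S)] | odd #|` q.2|].
exists [seq q <- [:: ((a : fam (five_data F)).1.1.2, S)] | odd #|` q.2|].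
split; try exact: filter_all.
move=> T; rewrite !odd_mul_empty /=; move: ha; case: (odd _) => ha; last first.
  rewrite !big_nil !subr0 /gword; case: ifP => // _; by case: ha.
rewrite !big_seq1 !gfunZ /gword; case: ifP => _; last by rewrite !scaler0 !subr0.
case: a {ha} => [[[a1 a2] a3] a4]; rewrite /ga /gb /mk5 /=; congr (_, _) => /=.
  by rewrite /GRing.scale /=; ring.
by rewrite /GRing.scale /=; ring.
Qed.

Lemma five_chain n : (0 < n)%N -> satisfies G (chain_identity F n).
Proof.
move=> n0; have VG := @env_V F h2 (five_data F); apply: (chainw_satisfies h2 VG n0).
apply: (chainw_decomposition h2 VG (@env_squarelike F h2 (five_data F))) => x.
have [l1 [l2 [o1 o2 e]]] := five_odd_decomposition (grassP x).
have ha : homog true (ga F) by [].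
have hb : homog true (gb F) by [].
pose x1 : G := SubalgElt (asboolT (odd_mul_pred o1 ha) : subalg_mem (grass_subalg A) _).
pose x2 : G := SubalgElt (asboolT (odd_mul_pred o2 hb) : subalg_mem (grass_subalg A) _).
have vB (u v : G) : val (u - v) = val u - val v.
  by rewrite -scaleN1r GRing.valD GRing.valZ scaleN1r.
have fin (z : G) : finsupp_gfun (val z) by case: (grassP z).
exists (fun x => odd_ideal l1 (val x)), (fun x => odd_ideal l2 (val x)), x1, x2, (x - x1 - x2).
split.
- exact: odd_ideal_square_zero (hom_val _) val_inj fin.
- exact: odd_ideal_square_zero (hom_val _) val_inj fin.
- exact: OI_gen.
- exact: OI_gen.
split; last by lmod F.
move=> S; rewrite !vB; exact: e.
Qed.

End FiveChain.

(** * The variety and its generators *)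

Section Variety.
Variables (F : fieldType) (h2 : 2%:R != 0 :> F) (h3 : 3%:R != 0 :> F).
Local Notation Gt := (Gtilde (@V F) 2).
Local Notation A := (five F).

Lemma Gtilde_testable f : satisfies Gt f -> testable f.
Proof.
move=> sat a ga; apply: (Gtilde_generated (@env_V F h2 (five_data F)) _ sat ga).
by move=> i; rewrite /five_u; case: ifP.
Qed.

Lemma five_testable f : satisfies (grass_env A) f -> testable f.
Proof. by move=> sat a _; exact: sat. Qed.

Lemma testable_consequence f (B : naAlgType F) : testable f -> V B ->
  (forall n, (0 < n)%N -> satisfies B (chain_identity F n)) -> satisfies B f.
Proof.
move=> tf VB cB; have [N HN] := testable_identity h2 h3 tf; apply: HN => // k /andP[k0 _].
by apply: (satisfies_chainw h2 VB k0); exact: cB.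
Qed.

Lemma Var_GtildeP (B : naAlgType F) : Var Gt B <->
  (V B /\ forall n, (0 < n)%N -> satisfies B (chain_identity F n)).
Proof.
split=> [VarB|[VB cB] f /Gtilde_testable tf]; last exact: testable_consequence.
split=> [i|n n0]; apply: VarB; first exact: Gtilde_V.
exact: Gtilde_chain.
Qed.

Lemma Var_fiveP (B : naAlgType F) : Var (grass_env A) B <-> Var Gt B.
Proof.
rewrite Var_GtildeP; split=> [VarB|[VB cB] f /five_testable tf]; last exact: testable_consequence.
split=> [i|n n0]; apply: VarB; first exact: env_V.
exact: five_chain.
Qed.

(** Each identity of a finite basis follows from V and the chain identities up to some index. If [M]
    exceeds all these indices, the envelope of [chain_alg F M] satisfies the basis but not the chain
    identity with index [M]. *)
Lemma Var_Gtilde_not_finitely_based : ~ finitely_based (Var Gt).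
Proof.
case=> n [f fP].
have sat i : satisfies Gt (f i) by move: i; apply/fP.
have [N NP] := choice (fun i => testable_identity h2 h3 (Gtilde_testable (sat i))).
pose M := (\max_i N i).+1; pose B := grass_env (chain_alg F M).
have VB : V B by exact: env_V.
have /Var_GtildeP[_ cB] : Var Gt B.
  apply/fP => i; apply: (NP i) => // k /andP[k0 kN].
  apply: chain_alg_chainw => //; rewrite k0 ltnS /=.
  exact: leq_trans kN (leq_bigmax i).
by apply: (@chain_alg_not_chainw F h2 M) => //; apply: (satisfies_chainw h2 VB) => //; exact: cB.
Qed.

End Variety.

Theorem mainTheorem1 (F : fieldType)
    (char_neq2 : 2%N \notin [pchar F]) (char_neq3 : 3%N \notin [pchar F]) :
  [/\ subvariety (Var (Gtilde (@V F) 2)) (@V F),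
      ~ finitely_based (Var (Gtilde (@V F) 2)),
      forall B : naAlgType F,
        Var (Gtilde (@V F) 2) B <->
        (V B /\ forall n : nat, (1 <= n)%N -> satisfies B (chain_identity F n))
    & exists A : superAlgType F,
        [/\ has_dim (fun _ : A => True) 5,
            has_dim (fun x : A => homog false x) 1,
            exists a b : A, [/\ homog true a, homog true b
              & forall x : A, generated (fun z => z = a \/ z = b) x]
          & forall B : naAlgType F,
              Var (grass_env A) B <-> Var (Gtilde (@V F) 2) B]].
Proof.
have h2 : 2%:R != 0 :> F by move: char_neq2; rewrite inE.
have h3 : 3%:R != 0 :> F by move: char_neq3; rewrite inE.
split.
- split=> [|B /(Var_GtildeP h2 h3)[] //].
  by exists (satisfies (Gtilde (@V F) 2)).
- exact: Var_Gtilde_not_finitely_based.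
- exact: Var_GtildeP.
exists (five F); split.
- exact: five_dim.
- exact: five_even_dim.
- by exists (ga F), (gb F); split=> //; exact: five_generated.
exact: Var_fiveP.
Qed.
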